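(* Let $R_0=\arctan(2)/2$. For $0<R<R_0$, let $D_R$ be the spherical billiard obtained by removing from $\mathbb S^2$ the $12$ open disks of equal spherical radius $R$ whose centers are the vertices of a regular icosahedron inscribed in $\mathbb S^2$. Then for all $R<R_0$ sufficiently close to $R_0$, the billiard flow of $D_R$ is uniformly hyperbolic.
   Context: $\mathbb S^2$ is the round unit sphere. Billiard flow $\phi^t$ on $D=D_R$: outside the obstacles (the removed disks) a particle follows the geodesics of $\mathbb S^2$ with unit speed; when it hits an obstacle it bounces according to the usual reflection law. The phase space is $\Omega=T^1(\mathrm{Int}(D))$. $\tilde\Omega\subseteq\Omega$ is the set of all $(x,v)$ such that the trajectory starting at $(x,v)$ contains no grazing collision (each obstacle is reached with a nonzero angle). The billiard flow is uniformly hyperbolic if there exist $a>0$ and $\lambda\in(0,1)$ such that at each point $x\in\tilde\Omega$ there is a decomposition, stable under the flow, $$T_x\Omega=E^0_x\oplus E^u_x\oplus E^s_x,\qquad E^0_x=\mathbb R\left.\tfrac{d}{dt}\right|_{t=0}\phi^t(x),$$ with $\|D\phi^t_x|_{E^s_x}\|\le a\lambda^t$ and $\|D\phi^{-t}_x|_{E^u_x}\|\le a\lambda^t$ for all $t\ge 0$ (for which the image point lies in $\Omega$, i.e. is not at a collision instant); $a$ and $\lambda$ do not depend on $x$. *)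

(* Defs.v *)
From HB Require Import structures.
From mathcomp Require Import all_boot all_order all_algebra.
From mathcomp Require Import all_classical all_reals all_analysis.
Set Implicit Arguments.
Unset Strict Implicit.
Unset Printing Implicit Defensive.
Import Order.TTheory GRing.Theory Num.Theory.
Import numFieldNormedType.Exports.
Local Open Scope classical_set_scope.
Local Open Scope ring_scope.

Section SphericalBilliard.
Variable R : realType.

Local Notation V := 'rV[R]_3.
Local Notation VV := ('rV[R]_3 * 'rV[R]_3)%type.

(* The library norm on 'rV[R]_3 is the sup norm, hence an explicit Euclidean
   scalar product. *)
Definition dot (u v : V) : R := (u *m v^T) 0 0.

Definition sphere : set V := [set x | dot x x = 1].

Definition sdist (x y : V) : R := acos (dot x y).

Definition sdisk (c : V) (r : R) : set V :=
  [set x | sphere x /\ sdist x c < r].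

(* In what follows [C] is the set of the centers of the obstacles, and [r] is
   their common spherical radius. *)
Definition table (C : set V) (r : R) : set V :=
  sphere `\` \bigcup_(c in C) sdisk c r.

(* Interior of the table for the topology of the sphere. *)
Definition table_int (C : set V) (r : R) : set V :=
  [set x | sphere x /\ \forall y \near within sphere (nbhs x), table C r y].

(* A tangent vector of the sphere is encoded as a pair (position, velocity). *)
Definition unit_tangent : set VV :=
  [set z | [/\ sphere z.1, dot z.1 z.2 = 0 & dot z.2 z.2 = 1]].

Definition Omega (C : set V) (r : R) : set VV :=
  [set z | unit_tangent z /\ table_int C r z.1].

Definition geodesic (t : R) (z : VV) : VV :=
  (cos t *: z.1 + sin t *: z.2, cos t *: z.2 - sin t *: z.1).

Definition collides (r : R) (c : V) (z : VV) : Prop := sdist z.1 c = r.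

(* Gradient at [x] of [dot c] on the sphere: for [x] on the boundary of the disk
   of center [c] it is a (non-normalized) normal vector of that boundary. *)
Definition normal (c x : V) : V := c - dot c x *: x.

Definition reflect (c x v : V) : V :=
  v - (2 * dot v (normal c x) / dot (normal c x) (normal c x)) *: normal c x.

(* Complete billiard trajectories. At a collision instant the velocity is by
   convention the outgoing one, so that a trajectory is determined by any of its
   points lying in Omega. A grazing trajectory is not deflected, as [reflect]
   fixes the vectors orthogonal to the normal. *)
Record trajectory (C : set V) (r : R) (g : R -> VV) : Prop := Trajectory {
  traj_table : forall t, unit_tangent (g t) /\ table C r (g t).1 ;
  traj_cont : continuous (fun t => (g t).1) ;
  traj_isolated : forall t, \forall s \near t^', table_int C r (g s).1 ;
  traj_free : forall a b,
    (forall s, a < s < b -> table_int C r (g s).1) ->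
    forall s t, a < s < b -> a < t < b -> g t = geodesic (t - s) (g s) ;
  traj_collision : forall t c, C c -> collides r c (g t) ->
    exists v : V, [/\ (fun s => (g s).2) @ t^'- --> v,
      (fun s => (g s).2) @ t^'+ --> reflect c (g t).1 v
      & (g t).2 = reflect c (g t).1 v]
}.

Definition flow (C : set V) (r t : R) (z : VV) : VV :=
  get [set g | trajectory C r g /\ g 0 = z] t.

Definition Omega_tilde (C : set V) (r : R) : set VV :=
  [set z | Omega C r z /\
    forall t c, C c -> collides r c (flow C r t z) ->
      dot (flow C r t z).2 (normal c (flow C r t z).1) != 0].

(* Tangent space at [z] of the unit tangent bundle, in which Omega is open:
   linearization of the equations defining [unit_tangent]. *)
Definition tangent (z w : VV) : Prop :=
  [/\ dot z.1 w.1 = 0, dot z.1 w.2 + dot w.1 z.2 = 0 & dot z.2 w.2 = 0].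

(* Norm of the Sasaki metric; the second term involves the component of [w.2]
   tangent to the sphere, i.e. the covariant derivative of the velocity. *)
Definition sasaki_norm (z w : VV) : R :=
  let k := w.2 - dot w.2 z.1 *: z.1 in Num.sqrt (dot w.1 w.1 + dot k k).

(* [L] is a differential at [z] of [f] restricted to [A]; when [A] is a
   submanifold, its values on the tangent space at [z] are determined by [f]. *)
Definition is_diff_within (A : set VV) (f : VV -> VV) (z : VV) (L : 'End(VV))
  : Prop :=
  forall e : R, 0 < e ->
    \forall y \near within A (nbhs z),
      `|f y - f z - L (y - z)| <= e * `|y - z|.

Definition flow_line (C : set V) (r : R) (z : VV) : {vspace VV} :=
  <[derive1 (fun t : R => flow C r t z) 0]>%VS.

Definition uniformly_hyperbolic (C : set V) (r : R) : Prop :=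
  exists a lambda : R, [/\ 0 < a, 0 < lambda, lambda < 1 &
  exists Eu Es : VV -> {vspace VV}, forall z, Omega_tilde C r z ->
    let E0 := flow_line C r in
    [/\ forall w, w \in (E0 z + Eu z + Es z)%VS <-> tangent z w,
        directv (E0 z + Eu z + Es z) &
        forall t, Omega C r (flow C r t z) ->
          exists L : 'End(VV), [/\ is_diff_within (Omega C r) (flow C r t) z L,
            [/\ (L @: E0 z)%VS = E0 (flow C r t z),
                (L @: Eu z)%VS = Eu (flow C r t z) &
                (L @: Es z)%VS = Es (flow C r t z)],
            0 <= t -> forall w, w \in Es z ->
              sasaki_norm (flow C r t z) (L w)
                <= a * lambda `^ t * sasaki_norm z w &
            t <= 0 -> forall w, w \in Eu z ->
              sasaki_norm (flow C r t z) (L w)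
                <= a * lambda `^ (- t) * sasaki_norm z w]]].

(* With g the golden ratio, the normalized cyclic permutations of the vectors
   (0, +-1, +-g) are the 12 vertices of a regular icosahedron. *)
Definition golden : R := (1 + Num.sqrt 5) / 2.

Definition ico_vertex (k : 'I_3) (s1 s2 : bool) : V :=
  (Num.sqrt (1 + golden ^+ 2))^-1 *:
  \row_(j < 3) (if j == k then 0
                else if j == k + 1 then (-1) ^+ s1
                else (-1) ^+ s2 * golden).

Definition regular_icosahedron (C : set V) : Prop :=
  exists2 U : 'M[R]_3, U *m U^T = 1%:M &
    C = [set x | exists k s1 s2, x = ico_vertex k s1 s2 *m U].

End SphericalBilliard.

(* Main.v *)
(* A trajectory is a chain of free flights, of duration at most [pi / 2]
   because near [atan 2 / 2] the disks leave no gap: in a spherical face of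
   the icosahedron a geodesic comes close to one of the three vertices.

   Along a geodesic a contact vector [(X n, P n)], where [n] is the cross
   product of the position and the velocity, rotates; at a collision it is
   sheared by [P := P + (2 h / D) X], where [h] is the cosine of the radius
   and [D] the normal speed, so that the rate of the shear is at least twice
   the geodesic curvature [k = cot r], and [k > 1]. Just after the
   collisions the cone [Q > k X > 0] is thus invariant, and [X] grows there
   by a factor [1 + (k - 1) sg] if [sg] is a lower bound of the sines of the
   flight times. The slopes whose orbits enter this cone form an open
   half-line; the slope at its end gives the stable line, which is
   contracted at the same rate and consists of all contact vectors with
   bounded forward orbit. This description makes it invariant, and reversing
   time gives the unstable line. A vector in both is zero, because it is
   contracted both ways. *)

(* [flow] selects a complete trajectory, so each point of [Omega] must first be shown to lie on
   exactly one, grazing collisions included. Collision times could accumulate; this is excluded by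
   the gap between the disks, positive because [atan 2 / 2] is half an edge of the icosahedron. The
   same gap bounds the sines of the flight times from below. Near grazing collisions the rate
   [2 h / D] of the shear is unbounded, and so is the differential. Uniform constants are possible
   because only the lower bound of the rate is ever used: the contraction of a stable vector is read
   on the inverse step, and its [P] coordinate is controlled by the values of [X] at two successive
   collisions. The entrance time into a disk is never differentiated. Its cosine and sine are
   algebraic in the initial condition, so one closed formula continues a geodesic after its
   reflection, and the symmetries of that formula determine its differential. The bound 73 / 100 on
   the squared cosine of the radius lies between [(1 + 1 / sqrt 5) / 2], about 0.7236, attained at
   contact of the disks, and 0.735, which the finite horizon argument guarantees. *)
Require Import Defs.
From HB Require Import structures.
From mathcomp Require Import all_boot all_order all_algebra.
From mathcomp Require Import all_classical all_reals all_analysis.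
From mathcomp Require Import ring lra.
Set Implicit Arguments.
Unset Strict Implicit.
Unset Printing Implicit Defensive.
Import Order.TTheory GRing.Theory Num.Theory.
Import numFieldNormedType.Exports.
Local Open Scope classical_set_scope.
Local Open Scope ring_scope.

(** * Vectors and geodesics *)

Section Vectors.
Variable R : realType.
Local Notation V := 'rV[R]_3.
Local Notation VV := ('rV[R]_3 * 'rV[R]_3)%type.
Implicit Types (u v w x c : V) (z : VV) (s t : R).

Let i0 : 'I_3 := ord0.
Let i1 : 'I_3 := lift ord0 ord0.
Let i2 : 'I_3 := lift ord0 (lift ord0 ord0).

Lemma ord3_ind (P : 'I_3 -> Prop) : P i0 -> P i1 -> P i2 -> forall i, P i.
Proof.
move=> P0 P1 P2 [[|[|[|//]]] lti]; [move: P0|move: P1|move: P2];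
  by congr P; apply: val_inj.
Qed.

Lemma dotE u v :
  dot u v = u 0 i0 * v 0 i0 + u 0 i1 * v 0 i1 + u 0 i2 * v 0 i2.
Proof. by rewrite /dot mxE !big_ord_recl big_ord0 !mxE addr0 addrA. Qed.

Lemma row3P u v : u 0 i0 = v 0 i0 -> u 0 i1 = v 0 i1 -> u 0 i2 = v 0 i2 -> u = v.
Proof. by move=> e0 e1 e2; apply/rowP; apply: ord3_ind. Qed.

Definition cross u v : V :=
  \row_j (if j == i0 then u 0 i1 * v 0 i2 - u 0 i2 * v 0 i1
          else if j == i1 then u 0 i2 * v 0 i0 - u 0 i0 * v 0 i2
          else u 0 i0 * v 0 i1 - u 0 i1 * v 0 i0).

Lemma dotC u v : dot u v = dot v u.
Proof. by rewrite !dotE; ring. Qed.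
Lemma dotDl u v w : dot (u + v) w = dot u w + dot v w.
Proof. by rewrite !dotE !mxE; ring. Qed.
Lemma dotZl s u w : dot (s *: u) w = s * dot u w.
Proof. by rewrite !dotE !mxE; ring. Qed.
Lemma dotNl u w : dot (- u) w = - dot u w.
Proof. by rewrite !dotE !mxE; ring. Qed.
Lemma dot0l w : dot 0 w = 0.
Proof. by rewrite !dotE !mxE; ring. Qed.
Lemma dotDr u v w : dot w (u + v) = dot w u + dot w v.
Proof. by rewrite !(dotC w) dotDl. Qed.
Lemma dotZr s u w : dot w (s *: u) = s * dot w u.
Proof. by rewrite !(dotC w) dotZl. Qed.
Lemma dotNr u w : dot w (- u) = - dot w u.
Proof. by rewrite !(dotC w) dotNl. Qed.
Lemma dot0r w : dot w 0 = 0.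
Proof. by rewrite dotC dot0l. Qed.

Definition dotlin := (dotDl, dotDr, dotNl, dotNr, dotZl, dotZr, dot0l, dot0r).

Lemma dot_ge0 u : 0 <= dot u u.
Proof. by rewrite dotE -!expr2; rewrite !addr_ge0 ?sqr_ge0. Qed.

Lemma dot_cross_l u v : dot u (cross u v) = 0.
Proof. by rewrite dotE !mxE /=; ring. Qed.
Lemma dot_cross_r u v : dot v (cross u v) = 0.
Proof. by rewrite dotE !mxE /=; ring. Qed.
Lemma cross_anti u v : cross u v = - cross v u.
Proof. by apply: row3P; rewrite !mxE /=; ring. Qed.
Lemma crossvv u : cross u u = 0.
Proof. by apply: row3P; rewrite !mxE /=; ring. Qed.
Lemma crossDr u v w : cross u (v + w) = cross u v + cross u w.
Proof. by apply: row3P; rewrite !mxE /=; ring. Qed.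
Lemma crossZr s u v : cross u (s *: v) = s *: cross u v.
Proof. by apply: row3P; rewrite !mxE /=; ring. Qed.
Lemma crossDl u v w : cross (v + w) u = cross v u + cross w u.
Proof. by apply: row3P; rewrite !mxE /=; ring. Qed.
Lemma crossZl s u v : cross (s *: v) u = s *: cross v u.
Proof. by apply: row3P; rewrite !mxE /=; ring. Qed.
Lemma crossNr u v : cross u (- v) = - cross u v.
Proof. by apply: row3P; rewrite !mxE /=; ring. Qed.
Lemma crossNl u v : cross (- v) u = - cross v u.
Proof. by apply: row3P; rewrite !mxE /=; ring. Qed.
Lemma dot_cross_cross u v :
  dot (cross u v) (cross u v) = dot u u * dot v v - dot u v ^+ 2.
Proof. by rewrite !dotE !mxE /=; ring. Qed.

Lemma cross_cross_l u v : cross u (cross u v) = dot u v *: u - dot u u *: v.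
Proof. by apply: row3P; rewrite !dotE !mxE /=; ring. Qed.

(* Expansion of [u] in the orthogonal basis attached to a pair of vectors,
   multiplied by the Gram determinant. *)
Lemma gram_expansion u x v :
  (dot x x * dot v v - dot x v ^+ 2) *: u =
  (dot u x * dot v v - dot u v * dot x v) *: x +
  (dot u v * dot x x - dot u x * dot x v) *: v +
  dot u (cross x v) *: cross x v.
Proof. by apply: row3P; rewrite !dotE !mxE /=; ring. Qed.

Lemma frame_expansion z u : unit_tangent z ->
  u = dot u z.1 *: z.1 + dot u z.2 *: z.2 + dot u (cross z.1 z.2) *: cross z.1 z.2.
Proof.
case: z => x v [/= xx xv vv]; have := gram_expansion u x v.
by rewrite /sphere /= in xx; rewrite xx xv vv expr0n /= !(mulr1, mulr0, subr0) scale1r.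
Qed.

Lemma parseval z u : unit_tangent z ->
  dot u u = dot u z.1 ^+ 2 + dot u z.2 ^+ 2 + dot u (cross z.1 z.2) ^+ 2.
Proof.
move=> zu; rewrite {2}(frame_expansion u zu) !dotlin; ring.
Qed.

Lemma dot_le1 u v : dot u u = 1 -> dot v v = 1 -> -1 <= dot u v <= 1.
Proof.
move=> uu vv.
have := dot_ge0 (u - v); have := dot_ge0 (u + v).
rewrite !dotlin uu vv (dotC v u); lra.
Qed.

Lemma geodesicD s t z : geodesic (s + t) z = geodesic s (geodesic t z).
Proof.
by case: z => x v; rewrite /geodesic /= cosD sinD; congr pair; apply: row3P;
  rewrite !mxE; ring.
Qed.

Lemma geodesic0 z : geodesic 0 z = z.
Proof.
by case: z => x v; rewrite /geodesic /= cos0 sin0 !scale1r !scale0r addr0 subr0.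
Qed.

Lemma geodesicK t z : geodesic (- t) (geodesic t z) = z.
Proof. by rewrite -geodesicD addNr geodesic0. Qed.

Lemma geodesicNK t z : geodesic t (geodesic (- t) z) = z.
Proof. by rewrite -geodesicD addrN geodesic0. Qed.

Lemma geodesic_unit t z : unit_tangent z -> unit_tangent (geodesic t z).
Proof.
case: z => x v [/=]; rewrite /sphere /= => xx xv vv.
have E := cos2Dsin2 t.
by split; rewrite /sphere /= !dotlin ?(dotC v x) xx xv vv; lra.
Qed.

(** A flight stays in the plane of its position and velocity. The contact frame is therefore
    constant between collisions, and only the coordinates in it rotate. *)
Lemma geodesic_cross t z :
  cross (geodesic t z).1 (geodesic t z).2 = cross z.1 z.2.
Proof.
case: z => x v /=; have E := cos2Dsin2 t.
apply: row3P; rewrite !mxE /=; rewrite -[RHS]mul1r -E; ring.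
Qed.

(** Time reversal. It yields the past of a trajectory from the future of another one, and the
    unstable line from a stable one. *)
Definition flip z : VV := (z.1, - z.2).

Lemma flipK z : flip (flip z) = z.
Proof. by case: z => x v; rewrite /flip /= opprK. Qed.

Lemma geodesic_flip t z : geodesic t (flip z) = flip (geodesic (- t) z).
Proof.
case: z => x v; rewrite /geodesic /flip /= cosN sinN; congr pair;
  by apply: row3P; rewrite !mxE; ring.
Qed.

Lemma flip_unit z : unit_tangent z -> unit_tangent (flip z).
Proof. by case: z => x v [/= a b c]; split => //=; rewrite !dotlin ?b ?oppr0 // opprK. Qed.

End Vectors.

(** * Finite horizon of the icosahedral billiard *)

Section Icosahedron.
Variable R : realType.
Local Notation V := 'rV[R]_3.
Local Notation VV := ('rV[R]_3 * 'rV[R]_3)%type.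
Implicit Types (u v w x c n p q : V) (z : VV) (s t h : R).

(* What is used of the obstacles, [h] being the cosine of their radius: they are
   disjoint, every geodesic arc of length [pi / 2] meets the interior of one of
   them, and the radius is less than [pi / 4]. *)
Record admissible (C : set V) (h : R) : Prop := Admissible {
  adm_finite : exists l : seq V, forall c, C c <-> c \in l ;
  adm_unit : forall c, C c -> dot c c = 1 ;
  adm_sep : exists2 d : R, 0 < d & forall c c' x, C c -> C c' -> c != c' ->
    dot x x = 1 -> dot c x + dot c' x <= h *+ 2 - d ;
  adm_horizon : forall z, unit_tangent z -> exists t c,
    [/\ 0 <= t <= pi / 2, C c & h < dot c (geodesic t z).1] ;
  adm_pos : 0 < h ;
  adm_lt1 : h < 1 ;
  adm_curv : 1 < h ^+ 2 *+ 2
}.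

Lemma cos_piquarter_sqr : cos (pi / 4 : R) ^+ 2 = 1 / 2.
Proof.
have := cos_mulr2n (pi / 4 : R).
have -> : (pi / 4 : R) *+ 2 = pi / 2 by field.
by rewrite cos_pihalf; lra.
Qed.

Lemma piquarter_bounds : 0 < (pi / 4 : R) /\ pi / 4 < (pi / 2 : R).
Proof. by have := @pi_gt0 R; split; lra. Qed.

Lemma cos_piquarter_gt0 : 0 < cos (pi / 4 : R).
Proof. by apply: cos_gt0_pihalf; have [] := piquarter_bounds; lra. Qed.

Lemma sin_piquarter : sin (pi / 4 : R) = cos (pi / 4).
Proof.
have c0 : cos (pi / 4 : R) != 0 by rewrite gt_eqF ?cos_piquarter_gt0.
by rewrite -[LHS](divfK c0) -/(tan _) tan_piquarter mul1r.
Qed.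

Lemma lt_of_sqr (h v : R) : 0 <= v -> h ^+ 2 < v ^+ 2 -> h < v.
Proof. by move=> v0 hv; rewrite ltNge; apply/negP => le; nra. Qed.

(** Along a geodesic the scalar product with a center is [A * cos t + B * sin t], whose maximum
    [sqrt (A ^+ 2 + B ^+ 2)] is reached at [atan (B / A)]. This time is in the window if [|B| <= A].
    Otherwise the endpoint on the side of [B] is used; its value [(A + |B|) / sqrt 2] is large
    enough because [A >= s]. *)
Lemma sweep (s A B h : R) : 0 < s -> s ^+ 2 = 1 / 5 -> s <= A ->
  (5 + 3 * s) / 8 <= A ^+ 2 + B ^+ 2 -> h ^+ 2 < 73 / 100 ->
  exists2 t, - (pi / 4) <= t <= pi / 4 & h < A * cos t + B * sin t.
Proof.
move=> s0 s2 sA AB hlt.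
have s1 : 44 / 100 < s by nra.
have s1' : s < 46 / 100 by nra.
have A0 : 0 < A by lra.
have [BA|BA] := leP `|B| A.
  have bd : `|B / A| <= 1 by rewrite normrM normfV (gtr0_norm A0) ler_pdivrMr ?mul1r.
  exists (atan (B / A)).
    by move: bd; rewrite ler_norml => /andP[b1 b2];
      rewrite -(@atan1 R) -atanN !le_atan.
  have cE := cos_atan (B / A).
  have q1 : 0 < 1 + (B / A) ^+ 2 by have := sqr_ge0 (B / A); lra.
  have cpos : 0 < cos (atan (B / A)) by rewrite cE invr_gt0 sqrtr_gt0.
  have sE : sin (atan (B / A)) = B / A * cos (atan (B / A)).
    by rewrite -{2}(atanK (B / A)) /tan mulfVK ?gt_eqF.
  have c2 : cos (atan (B / A)) ^+ 2 * (1 + (B / A) ^+ 2) = 1.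
    by rewrite cE exprVn sqr_sqrtr ?mulVf ?gt_eqF // ltW.
  rewrite sE; set c := cos _ in cpos c2 *.
  have AA : A * (B / A) = B by field; rewrite gt_eqF.
  set b := B / A in AA c2 *.
  have v0 : 0 < A * c + B * (b * c).
    by rewrite -AA; have := mulr_gt0 A0 cpos; have := sqr_ge0 b; nra.
  have e : (A * c + B * (b * c)) ^+ 2 = A ^+ 2 + B ^+ 2.
    rewrite -AA; transitivity (A ^+ 2 * (1 + b ^+ 2) * (c ^+ 2 * (1 + b ^+ 2))); first by ring.
    by rewrite c2; ring.
  by apply: (lt_of_sqr (ltW v0)); rewrite e; lra.
have c2 := cos_piquarter_sqr; have c0 := cos_piquarter_gt0.
have [q0 _] := piquarter_bounds.
have key : h < (A + `|B|) * cos (pi / 4).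
  have nB : `|B| ^+ 2 = B ^+ 2 by rewrite real_normK ?num_real.
  rewrite -nB in AB.
  set b := `|B| in BA AB *.
  (* Both [A ^+ 2] and [b ^+ 2] are at least [s ^+ 2 = 2 / 10]. The product of the two excesses
     being nonnegative, [A * b] exceeds 34 / 100, and the squared value at the endpoint exceeds 79 /
     200 + 34 / 100 = 0.735. *)
  have pq : (2 / 10) * (A ^+ 2 + b ^+ 2) - 4 / 100 <= (A * b) ^+ 2.
    have : 0 <= (A ^+ 2 - 2 / 10) * (b ^+ 2 - 2 / 10) by apply: mulr_ge0; nra.
    by nra.
  have pr : 34 / 100 < A * b.
    have b0 : 0 <= A * b by rewrite mulr_ge0 ?normr_ge0 // ltW.
    by apply: lt_of_sqr => //; clear -pq AB s1; lra.
  have e : ((A + b) * cos (pi / 4)) ^+ 2 = (A ^+ 2 + b ^+ 2 + 2 * (A * b)) / 2.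
    by rewrite exprMn c2; field.
  have v0 : 0 < (A + b) * cos (pi / 4).
    by apply: mulr_gt0 => //; rewrite ltr_wpDr ?normr_ge0.
  by apply: (lt_of_sqr (ltW v0)); rewrite e; clear -pr AB hlt s1; lra.
have [B0|B0] := leP 0 B.
  exists (pi / 4); first by rewrite lexx andbT; lra.
  by rewrite (ger0_norm B0) in key; rewrite sin_piquarter -mulrDl.
exists (- (pi / 4)); first by rewrite lexx /=; lra.
by rewrite (ltr0_norm B0) in key; rewrite cosN sinN sin_piquarter mulrN -mulNr -mulrDl.
Qed.

(** The three numbers stand for the scalar products of the vertices of a face with the normal of a
    great circle. The threshold [3 * (1 - s) / 8] is chosen so that four times its square root is
    [sqrt (6 - 6 * s)], the norm of [c1 *+ 2 - c2 - c3]. A great circle that separates one vertex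
    from the two others, while being farther than this from all three, would thus violate the Bessel
    inequality. *)
Lemma triangle_split (N1 N2 N3 s : R) : 0 <= 1 - s ->
  N1 ^+ 2 > 3 * (1 - s) / 8 -> N2 ^+ 2 > 3 * (1 - s) / 8 ->
  N3 ^+ 2 > 3 * (1 - s) / 8 -> 0 < N1 -> N2 < 0 -> N3 < 0 ->
  6 - 6 * s < (N1 *+ 2 - N2 - N3) ^+ 2.
Proof.
move=> s1 h1 h2 h3 p1 p2 p3.
set th := Num.sqrt (3 * (1 - s) / 8).
have th2 : th ^+ 2 = 3 * (1 - s) / 8 by rewrite sqr_sqrtr //; lra.
have th0 : 0 <= th by apply: sqrtr_ge0.
have a1 : th < N1 by rewrite ltNge; apply/negP => le; nra.
have a2 : th < - N2 by rewrite ltNge; apply/negP => le; nra.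
have a3 : th < - N3 by rewrite ltNge; apply/negP => le; nra.
have : 4 * th < N1 *+ 2 - N2 - N3 by lra.
nra.
Qed.

Lemma triangle_split_opp (N1 N2 N3 s : R) : 0 <= 1 - s ->
  N1 ^+ 2 > 3 * (1 - s) / 8 -> N2 ^+ 2 > 3 * (1 - s) / 8 ->
  N3 ^+ 2 > 3 * (1 - s) / 8 -> N1 < 0 -> 0 < N2 -> 0 < N3 ->
  6 - 6 * s < (N1 *+ 2 - N2 - N3) ^+ 2.
Proof.
rewrite -oppr_gt0 -(oppr_lt0 N2) -(oppr_lt0 N3) -[N1 ^+ 2]sqrrN.
rewrite -[N2 ^+ 2]sqrrN -[N3 ^+ 2]sqrrN => s1 h1 h2 h3 n1 n2 n3.
have := triangle_split s1 h1 h2 h3 n1 n2 n3.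
by rewrite -[in X in _ < X -> _]sqrrN; congr (_ < _ ^+ 2); ring.
Qed.

(** A great circle through a point of a face cannot have the three vertices strictly on one side,
    because the barycentric sum vanishes. In the six remaining sign patterns one vertex is isolated,
    and the bound for that vertex fails. *)
Lemma triangle_signs (a1 a2 a3 n1 n2 n3 s : R) : s < 1 ->
  0 <= a1 -> 0 <= a2 -> 0 <= a3 -> 1 <= a1 + a2 + a3 ->
  a1 * n1 + a2 * n2 + a3 * n3 = 0 ->
  n1 ^+ 2 > 3 * (1 - s) / 8 -> n2 ^+ 2 > 3 * (1 - s) / 8 ->
  n3 ^+ 2 > 3 * (1 - s) / 8 ->
  ~ [/\ (n1 *+ 2 - n2 - n3) ^+ 2 <= 6 - 6 * s,
       (n2 *+ 2 - n3 - n1) ^+ 2 <= 6 - 6 * s &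
       (n3 *+ 2 - n1 - n2) ^+ 2 <= 6 - 6 * s].
Proof.
move=> s1 p1 p2 p3 sum1 e N1 N2 N3 [].
have nz (x : R) : 3 * (1 - s) / 8 < x ^+ 2 -> x != 0.
  by move=> lt; apply/eqP => x0; rewrite x0 expr0n /= in lt; clear -lt s1; lra.
have s1' : 0 <= 1 - s by rewrite subr_ge0 ltW.
have T := triangle_split s1'; have T' := triangle_split_opp s1'.
have pos : [|| 0 < a1, 0 < a2 | 0 < a3].
  apply/negPn/negP; rewrite !negb_or -!leNgt => /and3P[q1 q2 q3].
  by clear -q1 q2 q3 sum1; lra.
have := nz _ N1; rewrite neq_lt => /orP[] g1; have := nz _ N2;
rewrite neq_lt => /orP[] g2; have := nz _ N3; rewrite neq_lt => /orP[] g3.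
- have q1 := mulr_le0_ge0 (ltW g1) p1; have q2 := mulr_le0_ge0 (ltW g2) p2.
  have q3 := mulr_le0_ge0 (ltW g3) p3.
  move=> _ _ _; rewrite mulrC (mulrC a2) (mulrC a3) in e.
  have {}pos : [|| n1 * a1 < 0, n2 * a2 < 0 | n3 * a3 < 0].
    by rewrite !nmulr_rlt0.
  by case/or3P: pos; clear -e q1 q2 q3; lra.
- by move=> _ _; rewrite leNgt T.
- by move=> _ + _; rewrite leNgt T.
- by rewrite leNgt T'.
- by rewrite leNgt T.
- by move=> _ + _; rewrite leNgt T'.
- by move=> _ _; rewrite leNgt T'.
- have q1 := mulr_ge0 p1 (ltW g1); have q2 := mulr_ge0 p2 (ltW g2).
  have q3 := mulr_ge0 p3 (ltW g3).
  by move=> _ _ _; case/or3P: pos => [/mulr_gt0/(_ g1)|/mulr_gt0/(_ g2)|/mulr_gt0/(_ g3)];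
    clear -e q1 q2 q3; lra.
Qed.

(** By Parseval, [dot c z.1 ^+ 2 + dot c z.2 ^+ 2] is 1 minus the squared scalar product of [c] with
    the normal of the geodesic, so the claim is that this square is at most [3 * (1 - s) / 8] for
    some vertex. *)
Lemma triangle_near (z : VV) c1 c2 c3 (a1 a2 a3 s : R) : unit_tangent z ->
  0 < s -> s < 1 -> 0 <= a1 -> 0 <= a2 -> 0 <= a3 ->
  dot c1 c1 = 1 -> dot c2 c2 = 1 -> dot c3 c3 = 1 ->
  dot c1 c2 = s -> dot c2 c3 = s -> dot c3 c1 = s ->
  z.1 = a1 *: c1 + a2 *: c2 + a3 *: c3 ->
  exists2 c, c \in [:: c1; c2; c3] &
    s <= dot c z.1 /\ (5 + 3 * s) / 8 <= dot c z.1 ^+ 2 + dot c z.2 ^+ 2.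
Proof.
move=> zu s0 s1 p1 p2 p3 u1 u2 u3 d12 d23 d31 zE.
(* Since [s < 1], the squared norm of [z.1] is at most [(a1 + a2 + a3) ^+ 2]. The sum bound also
   gives [s <= dot c z.1] for every vertex. *)
have sum1 : 1 <= a1 + a2 + a3.
  case: (zu) => + _ _; rewrite /sphere /= zE !dotlin u1 u2 u3.
  rewrite (dotC c2 c1) (dotC c3 c2) (dotC c1 c3) d12 d23 d31 => e.
  have q1 := mulr_ge0 p1 p2; have q2 := mulr_ge0 p2 p3; have q3 := mulr_ge0 p1 p3.
  have : (a1 + a2 + a3) ^+ 2 >= 1 by clear -e q1 q2 q3 s0 s1; nra.
  by clear -p1 p2 p3; nra.
have A1 : s <= dot c1 z.1.
  by rewrite zE !dotlin u1 d12 (dotC c1 c3) d31; clear -s0 s1 p1 p2 p3 sum1; nra.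
have A2 : s <= dot c2 z.1.
  by rewrite zE !dotlin u2 (dotC c2 c1) d12 d23; clear -s0 s1 p1 p2 p3 sum1; nra.
have A3 : s <= dot c3 z.1.
  by rewrite zE !dotlin u3 d31 (dotC c3 c2) d23; clear -s0 s1 p1 p2 p3 sum1; nra.
set n := cross z.1 z.2.
have Nsum : a1 * dot c1 n + a2 * dot c2 n + a3 * dot c3 n = 0.
  by have := dot_cross_l z.1 z.2; rewrite {1}zE !dotlin -/n.
have P u := parseval u zu.
have fin c : dot c c = 1 -> dot c n ^+ 2 <= 3 * (1 - s) / 8 ->
    (5 + 3 * s) / 8 <= dot c z.1 ^+ 2 + dot c z.2 ^+ 2.
  by move=> cc; have := P c; rewrite cc -/n; lra.
have [N1|N1] := leP (dot c1 n ^+ 2) (3 * (1 - s) / 8).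
  by exists c1; [rewrite !inE eqxx | split => //; exact: fin].
have [N2|N2] := leP (dot c2 n ^+ 2) (3 * (1 - s) / 8).
  by exists c2; [rewrite !inE eqxx orbT | split => //; exact: fin].
have [N3|N3] := leP (dot c3 n ^+ 2) (3 * (1 - s) / 8).
  by exists c3; [rewrite !inE eqxx !orbT | split => //; exact: fin].
exfalso.
have bound u : dot u n ^+ 2 <= dot u u.
  by rewrite (P u) -/n lerDr addr_ge0 ?sqr_ge0.
apply: (triangle_signs s1 p1 p2 p3 sum1 Nsum N1 N2 N3).
(* Bessel inequality for [u *+ 2 - v - w], whose squared norm is [6 - 6 * s]. *)
have comb u v w : dot u u = 1 -> dot v v = 1 -> dot w w = 1 ->
    dot u v = s -> dot v w = s -> dot w u = s ->
    (dot u n *+ 2 - dot v n - dot w n) ^+ 2 <= 6 - 6 * s.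
  move=> uu vv ww uv vw wu; have := bound (u *+ 2 - v - w).
  rewrite !mulr2n !dotlin uu vv ww (dotC v u) (dotC w v) (dotC u w) uv vw wu.
  by apply: etrans; congr (_ <= _); ring.
by split; apply: comb.
Qed.

End Icosahedron.

(** * Scalar products between the vertices of the icosahedron *)

Section Vertices.
Variable R : realType.
Local Notation V := 'rV[R]_3.
Implicit Types (c : V).

Local Notation g := (golden R).
Local Notation m := ((Num.sqrt (1 + golden R ^+ 2))^-1).

Lemma golden_gt1 : 1 < g.
Proof.
have : (1 : R) < Num.sqrt 5 by rewrite -[X in X < _]sqrtr1 ltr_sqrt; lra.
by rewrite /golden; lra.
Qed.

Lemma golden_sqr : g * g = g + 1.
Proof.
have : Num.sqrt (5 : R) ^+ 2 = 5 by rewrite sqr_sqrtr; lra.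
by rewrite /golden; lra.
Qed.

Lemma ico_scale_gt0 : 0 < m.
Proof. by rewrite invr_gt0 sqrtr_gt0; have := sqr_ge0 g; lra. Qed.

Lemma ico_scale_sqr : m * m * (g + 2) = 1.
Proof.
have e : 1 + g ^+ 2 = g + 2 by rewrite expr2 golden_sqr; lra.
have p : 0 < 1 + g ^+ 2 by have := sqr_ge0 g; lra.
by rewrite -expr2 exprVn sqr_sqrtr ?ltW // -e mulVf // gt_eqF.
Qed.

(** The cosine of the edge length [atan 2], that is [1 / sqrt 5]. *)
Definition ico_cos : R := m * m * g.

Lemma ico_cos_gt0 : 0 < ico_cos.
Proof. by rewrite !mulr_gt0 ?ico_scale_gt0 //; have := golden_gt1; lra. Qed.

Lemma ico_cos_lt1 : ico_cos < 1.
Proof.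
have := ico_scale_sqr; have : 0 < m * m by rewrite mulr_gt0 ?ico_scale_gt0.
by rewrite /ico_cos; lra.
Qed.

Lemma ico_cos_sqr : ico_cos ^+ 2 = 1 / 5.
Proof.
have e := golden_sqr; have e2 := ico_scale_sqr.
rewrite /ico_cos; set M := m in e2 *; clearbody M; move: (golden R) e e2 => G e e2.
have -> : (1 / 5 : R) = (M * M * (G + 2)) ^+ 2 / 5 by rewrite e2; lra.
transitivity ((M * M) ^+ 2 * (G * G)); first by ring.
transitivity ((M * M) ^+ 2 * ((G * G + 4 * G + 4) / 5)); last by field.
by rewrite e; field.
Qed.

Lemma ico_dot_same k s1 s2 t1 t2 :
  dot (ico_vertex R k s1 s2) (ico_vertex R k t1 t2) =
  m * m * ((-1) ^+ s1 * (-1) ^+ t1 + (-1) ^+ s2 * (-1) ^+ t2 * (g + 1)).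
Proof.
rewrite -golden_sqr /ico_vertex; set M := m; move: (_ ^+ s1) (_ ^+ s2) (_ ^+ t1) (_ ^+ t2).
by elim/ord3_ind: k => e1 e2 f1 f2; rewrite dotE !mxE /=; ring.
Qed.

Lemma ico_dot_succ k s1 s2 t1 t2 :
  dot (ico_vertex R k s1 s2) (ico_vertex R (k + 1) t1 t2) =
  (-1) ^+ s2 * (-1) ^+ t1 * ico_cos.
Proof.
rewrite /ico_cos /ico_vertex; set M := m.
move: (_ ^+ s1) (_ ^+ s2) (_ ^+ t1) (_ ^+ t2).
by elim/ord3_ind: k => e1 e2 f1 f2; rewrite dotE !mxE /=; ring.
Qed.

Let sign_le1 (b b' : bool) : (-1) ^+ b * (-1) ^+ b' * ico_cos <= ico_cos.
Proof.
have := ico_cos_gt0.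
by case: b; case: b'; rewrite ?expr1 ?expr0 ?mulrNN ?mul1r ?mulr1 ?mulN1r => p;
  rewrite // -subr_ge0 opprK addr_ge0 // ltW.
Qed.

(** Two indices in ['I_3] are equal or cyclic neighbours, so the two formulas for scalar products
    cover all pairs. It is this bound that separates the obstacles. *)
Lemma ico_dot_bound k s1 s2 k' t1 t2 :
  let c := ico_vertex R k s1 s2 in let c' := ico_vertex R k' t1 t2 in
  c = c' \/ dot c c' <= ico_cos.
Proof.
have : [|| k' == k, k' == k + 1 | k == k' + 1].
  by elim/ord3_ind: k; elim/ord3_ind: k'.
case/or3P => /eqP ->; last 2 first.
- by right; rewrite ico_dot_succ.
- by right; rewrite dotC ico_dot_succ.
case: (eqVneq s1 t1) => [->|n1]; case: (eqVneq s2 t2) => [->|n2] /=; first by left.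
all: right; rewrite ico_dot_same /ico_cos ler_pM2l ?mulr_gt0 ?ico_scale_gt0 //;
  have g1 := golden_gt1.
- by have -> : (-1) ^+ s2 * (-1) ^+ t2 = -1 :> R;
    [case: (s2) n2; case: (t2) => //= _; ring|rewrite -expr2 sqrr_sign; lra].
- by have -> : (-1) ^+ s1 * (-1) ^+ t1 = -1 :> R;
    [case: (s1) n1; case: (t1) => //= _; ring|rewrite -expr2 sqrr_sign; lra].
- have -> : (-1) ^+ s1 * (-1) ^+ t1 = -1 :> R by case: (s1) n1; case: (t1) => //= _; ring.
  have -> : (-1) ^+ s2 * (-1) ^+ t2 = -1 :> R by case: (s2) n2; case: (t2) => //= _; ring.
  by lra.
Qed.

Lemma ico_unit k s1 s2 : dot (ico_vertex R k s1 s2) (ico_vertex R k s1 s2) = 1.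
Proof.
rewrite ico_dot_same -!expr2 !sqrr_sign expr2.
by apply: etrans ico_scale_sqr; congr (_ * _); ring.
Qed.

Lemma ico_dot_next k s1 s2 t1 :
  dot (ico_vertex R k s1 s2) (ico_vertex R (k + 1) s2 t1) = ico_cos.
Proof. by rewrite ico_dot_succ -expr2 sqrr_sign mul1r. Qed.

Lemma ico_dot_pair k s1 s2 :
  dot (ico_vertex R k s1 s2) (ico_vertex R k (~~ s1) s2) = ico_cos.
Proof.
rewrite ico_dot_same -(expr2 (_ ^+ s2)) sqrr_sign /ico_cos.
by case: s1; rewrite /= ?expr0 ?expr1; ring.
Qed.

End Vertices.

(** * Covering by the faces, and admissibility of the icosahedral table *)

Section Faces.
Variable R : realType.
Local Notation V := 'rV[R]_3.
Local Notation VV := ('rV[R]_3 * 'rV[R]_3)%type.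
Implicit Types (u v w x y c : V) (z : VV).

Local Notation g := (golden R).
Local Notation m := ((Num.sqrt (1 + golden R ^+ 2))^-1).
Local Notation ico_cos := (ico_cos R).
Local Notation i0 := (ord0 : 'I_3).
Local Notation i1 := (lift ord0 ord0 : 'I_3).
Local Notation i2 := (lift ord0 (lift ord0 ord0) : 'I_3).

Definition face_point x := exists c1 c2 c3 : V, exists a1 a2 a3 : R,
  [/\ [/\ 0 <= a1, 0 <= a2 & 0 <= a3], x = a1 *: c1 + a2 *: c2 + a3 *: c3,
    [/\ dot c1 c2 = ico_cos, dot c2 c3 = ico_cos & dot c3 c1 = ico_cos] &
    forall c, c \in [:: c1; c2; c3] -> exists k s1 s2, c = ico_vertex R k s1 s2].

Let scaleK (a e : R) : a / m * (m * e) = a * e.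
Proof. by rewrite mulrA divfK // gt_eqF ?ico_scale_gt0. Qed.

(** Each octant contains one face with a vertex in each of the three coordinate planes. The three
    inequalities say that the coordinates of [x] in these vertices are nonnegative. *)
Lemma face_central x (b : 'I_3 -> bool) (y : 'I_3 -> R) :
  (forall i, x 0 i = (-1) ^+ b i * y i) ->
  0 <= y i1 + g * g * y i2 - g * y i0 -> 0 <= y i2 + g * g * y i0 - g * y i1 ->
  0 <= y i0 + g * g * y i1 - g * y i2 -> face_point x.
Proof.
move=> xE h0 h1 h2; have e := (golden_sqr R); have m0 := (ico_scale_gt0 R).
(* Cramer's rule. The determinant of the three unnormalized vertices is [g * g * g + 1 = 2 * g * g],
   and its inverse is [(2 - g) / 2]. *)
pose al := (y i1 + g * g * y i2 - g * y i0) * ((2 - g) / 2).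
pose be := (y i2 + g * g * y i0 - g * y i1) * ((2 - g) / 2).
pose ga := (y i0 + g * g * y i1 - g * y i2) * ((2 - g) / 2).
have g2 : 0 <= (2 - g) / 2.
  rewrite divr_ge0 // subr_ge0 leNgt; apply/negP => g2; clear -e g2; nra.
exists (ico_vertex R i0 (b i1) (b i2)), (ico_vertex R i1 (b i2) (b i0)),
  (ico_vertex R i2 (b i0) (b i1)), (al / m), (be / m), (ga / m); split.
- by split; apply: divr_ge0; rewrite ?(ltW m0) // mulr_ge0.
- rewrite /ico_vertex.
  have K t : t = t * ((2 - g) * (g * g * g + 1) / 2).
    have -> : (2 - g) * (g * g * g + 1) = 2; last by field.
    transitivity (2 * (g * g * g) + 2 - (g * g) * (g * g) - g); first by ring.
    by rewrite e; transitivity (g * g - g + 1); [ring|rewrite e; ring].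
  have e0 : y i0 = be * g + ga by rewrite [LHS]K /be /ga; ring.
  have e1 : y i1 = al + ga * g by rewrite [LHS]K /al /ga; ring.
  have e2 : y i2 = al * g + be by rewrite [LHS]K /al /be; ring.
  apply: row3P; rewrite xE ?e0 ?e1 ?e2 !mxE /= !scaleK; ring.
- have k1 : i0 + 1 = i1 by apply: val_inj.
  have k2 : i1 + 1 = i2 by apply: val_inj.
  have k0 : i2 + 1 = i0 by apply: val_inj.
  have d0 := ico_dot_next R i0 (b i1) (b i2) (b i0).
  have d1 := ico_dot_next R i1 (b i2) (b i0) (b i1).
  have d2 := ico_dot_next R i2 (b i0) (b i1) (b i2).
  by rewrite k1 in d0; rewrite k2 in d1; rewrite k0 in d2.
- by move=> c; rewrite !inE => /or3P[] /eqP ->; do 3!eexists.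
Qed.

(** Beyond one side of the central face lies a face that straddles two octants: two of its vertices
    differ only by the sign of the coordinate [k + 1]. Hence [y (k + 1)] is the difference [al - be]
    of their weights. *)
Lemma face_edge x (b : 'I_3 -> bool) (y : 'I_3 -> R) k :
  (forall i, x 0 i = (-1) ^+ b i * y i) -> (forall i, 0 <= y i) ->
  y k + g * g * y (k + 1) - g * y (k + 2) <= 0 -> face_point x.
Proof.
move=> xE y0 hk; have e := (golden_sqr R); have m0 := (ico_scale_gt0 R).
have g1 := (golden_gt1 R).
pose be := ((y (k + 2) - y k * (g - 1)) * (g - 1) - y (k + 1)) / 2.
pose al := be + y (k + 1); pose de := y k * (g - 1).
have de0 : 0 <= de by rewrite mulr_ge0 // subr_ge0 ltW.
have be0 : 0 <= be.
  have -> : be = (g - 1) * (g * y (k + 2) - y k - g * g * y (k + 1)) * (g - 1) / 2.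
    have E : (g - 1) * g = 1 by rewrite mulrBl e; ring.
    transitivity ((y (k + 2) * ((g - 1) * g) - y k * (g - 1)) * (g - 1) / 2
      - y (k + 1) * ((g - 1) * g) * ((g - 1) * g) / 2); last by ring.
    by rewrite E /be; ring.
  by rewrite divr_ge0 // !mulr_ge0 //; lra.
exists (ico_vertex R k (b (k + 1)) (b (k + 2))),
  (ico_vertex R k (~~ b (k + 1)) (b (k + 2))),
  (ico_vertex R (k + 1) (b (k + 2)) (b k)), (al / m), (be / m), (de / m); split.
- by split; apply: divr_ge0; rewrite ?(ltW m0) // addr_ge0.
- have E : (g - 1) * g = 1 by rewrite mulrBl e; ring.
  have e0 : y k = de * g by rewrite /de -mulrA E mulr1.
  have e1 : y (k + 1) = al - be by rewrite /al; ring.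
  have e2 : y (k + 2) = (al + be) * g + de.
    rewrite /al /be /de; transitivity (y (k + 2) * ((g - 1) * g) - y k * (g - 1) * ((g - 1) * g - 1)); last by field.
    by rewrite E; ring.
  have sN (d : bool) : (-1) ^+ (~~ d) = - (-1) ^+ d :> R.
    by case: d; rewrite ?opprK.
  have xk := xE k; have xk1 := xE (k + 1); have xk2 := xE (k + 2).
  rewrite e0 in xk; rewrite e1 in xk1; rewrite e2 in xk2.
  rewrite /ico_vertex; move: (al) (be) (de) xk xk1 xk2 => A B D.
  move: (b k) (b (k + 1)) (b (k + 2)) => b0 b1 b2.
  have kk (i j : 'I_3) : val i = val j -> x 0 j = x 0 i.
    by move=> ij; rewrite (val_inj ij).
  elim/ord3_ind: k {hk be al de de0 be0 e0 e1 e2} => xk xk1 xk2.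
  - rewrite (kk i1) // in xk1; rewrite (kk i2) // in xk2.
    by apply: row3P; rewrite ?xk ?xk1 ?xk2 !mxE /= !scaleK ?sN; ring.
  - rewrite (kk i2) // in xk1; rewrite (kk i0) // in xk2.
    by apply: row3P; rewrite ?xk ?xk1 ?xk2 !mxE /= !scaleK ?sN; ring.
  - rewrite (kk i0) // in xk1; rewrite (kk i1) // in xk2.
    by apply: row3P; rewrite ?xk ?xk1 ?xk2 !mxE /= !scaleK ?sN; ring.
- have d1 := ico_dot_pair R k (b (k + 1)) (b (k + 2)).
  have d2 := ico_dot_next R k (~~ b (k + 1)) (b (k + 2)) (b k).
  by split=> //; rewrite dotC ico_dot_next.
- by move=> c; rewrite !inE => /or3P[] /eqP ->; do 3!eexists.
Qed.

(** After removal of the signs, a point of the positive octant is in the central face or beyond one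
    of its three sides. This counts the twenty faces as eight central ones and twelve straddling
    ones. *)
Lemma face_cover x : face_point x.
Proof.
pose b i := x 0 i < 0; pose y i := `|x 0 i|.
have xE i : x 0 i = (-1) ^+ b i * y i.
  rewrite /b /y; case: (ltrP (x 0 i) 0) => h.
    by rewrite expr1 ltr0_norm // mulN1r opprK.
  by rewrite expr0 ger0_norm // mul1r.
have y0 i : 0 <= y i by apply: normr_ge0.
have kk (i j : 'I_3) : val i = val j -> y j = y i by move=> ij; rewrite (val_inj ij).
have [h0|/ltW h0] := leP 0 (y i0 + g * g * y i1 - g * y i2); last first.
  by apply: (face_edge xE y0 (k := i0));
    rewrite (kk i1 (i0 + 1)) // (kk i2 (i0 + 2)).
have [h1|/ltW h1] := leP 0 (y i1 + g * g * y i2 - g * y i0); last first.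
  by apply: (face_edge xE y0 (k := i1));
    rewrite (kk i2 (i1 + 1)) // (kk i0 (i1 + 2)).
have [h2|/ltW h2] := leP 0 (y i2 + g * g * y i0 - g * y i1); last first.
  by apply: (face_edge xE y0 (k := i2));
    rewrite (kk i0 (i2 + 1)) // (kk i1 (i2 + 2)).
exact: (face_central xE).
Qed.

Lemma dot_orthogonal (U : 'M[R]_3) x y : U *m U^T = 1%:M ->
  dot (x *m U) (y *m U) = dot x y.
Proof. by move=> UU; rewrite /dot trmx_mul mulmxA -(mulmxA x) UU mulmx1. Qed.

Local Notation R0 := (atan 2 / 2 : R).

Lemma atan2_bounds : 0 < R0 /\ R0 < pi / 4.
Proof.
have h0 : 0 < atan (2 : R) by rewrite -[X in X < _]atan0 lt_atan.
by have := atan_ltpi2 (2 : R); split; lra.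
Qed.

Lemma cos_R0 : cos R0 ^+ 2 = (1 + ico_cos) / 2.
Proof.
have e : cos (atan (2 : R)) = ico_cos.
  rewrite cos_atan; have -> : 1 + 2 ^+ 2 = (5 : R) by ring.
  have s0 := ico_cos_gt0 R; have s2 := ico_cos_sqr R.
  have f0 : 0 < (Num.sqrt (5 : R))^-1 by rewrite invr_gt0 sqrtr_gt0.
  have f2 : (Num.sqrt (5 : R))^-1 ^+ 2 = 1 / 5.
    by rewrite exprVn sqr_sqrtr ?div1r.
  move: (ico_cos) ((Num.sqrt _)^-1) s0 s2 f0 f2 => a f a0 a2 f0 f2; nra.
have := cos_mulr2n R0; have -> : R0 *+ 2 = atan 2 by field.
by rewrite e; lra.
Qed.

(* [cos (atan 2 / 2) ^+ 2 = (1 + 1 / sqrt 5) / 2 < 73 / 100] *)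
Definition radius_min : R := acos (Num.sqrt (73 / 100)).

Lemma sqrt73 (w := Num.sqrt (73 / 100 : R)) :
  [/\ 0 <= w, w ^+ 2 = 73 / 100 & -1 <= w <= 1].
Proof.
have w0 : 0 <= w by exact: sqrtr_ge0.
have w2 : w ^+ 2 = 73 / 100 by rewrite sqr_sqrtr //; lra.
by split=> //; clearbody w; apply/andP; split; nra.
Qed.

Lemma near_R0 r : radius_min < r -> r < R0 -> cos R0 < cos r /\ cos r ^+ 2 < 73 / 100.
Proof.
have [p0 p4] := atan2_bounds; have [q0 q2] := piquarter_bounds R.
have pp := @pi_gt0 R.
have [w0 w2 w1] := sqrt73.
have a0 : 0 <= radius_min by apply: acos_ge0.
move=> h1 h2.
have m1 : radius_min \in `[0, pi]%R by rewrite in_itv /=; lra.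
have m2 : r \in `[0, pi]%R by rewrite in_itv /=; lra.
have m3 : R0 \in `[0, pi]%R by rewrite in_itv /=; lra.
split; first by rewrite ltr_cos.
have c0 : 0 <= cos r by apply: cos_ge0_pihalf; lra.
have : cos r < Num.sqrt (73 / 100) by rewrite -[X in _ < X]acosK ?ltr_cos // in_itv.
by move: (Num.sqrt _) (cos r) w0 w2 c0 => w c w0 w2 c0 cw; nra.
Qed.

Lemma radius_min_lt : radius_min < R0.
Proof.
have [p0 p4] := atan2_bounds; have pp := @pi_gt0 R.
have [w0 w2 w1] := sqrt73.
have m1 : radius_min \in `[0, pi]%R by rewrite in_itv /= acos_ge0 ?acos_lepi.
have m3 : R0 \in `[0, pi]%R by rewrite in_itv /=; lra.
rewrite -ltr_cos // acosK ?in_itv //; apply: (@lt_of_sqr R _ _ w0).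
rewrite cos_R0 w2.
have s2 := ico_cos_sqr R; have s0 := ico_cos_gt0 R.
by move: (ico_cos) s0 s2 => a a0 a2; nra.
Qed.

Lemma icosahedron_admissible (C : set V) r : regular_icosahedron C ->
  radius_min < r -> 0 < r -> r < R0 -> admissible C (cos r).
Proof.
move=> [U UU CE] r1 r0 rR.
have UU' : U^T *m U = 1%:M by apply: mulmx1C.
have [p0 p4] := atan2_bounds; have [q0 q2] := piquarter_bounds R.
have pp := @pi_gt0 R; have [c1 c2] := near_R0 r1 rR.
have cR := cos_R0; have s0 := ico_cos_gt0 R; have s1 := ico_cos_lt1 R.
have cR0 : 0 < cos R0 by apply: cos_gt0_pihalf; lra.
have s2 := ico_cos_sqr R.
have inC k s t : C (ico_vertex R k s t *m U) by rewrite CE; exists k, s, t.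
have unit c : C c -> dot c c = 1.
  by rewrite CE => -[k [s [t ->]]]; rewrite dot_orthogonal ?ico_unit.
split.
- exists [seq ico_vertex R i.1.1 i.1.2 i.2 *m U | i <- enum {: 'I_3 * bool * bool}].
  move=> c; split.
    rewrite CE => -[k [s [t ->]]]; apply/mapP.
    by exists (k, s, t); rewrite ?mem_enum.
  by case/mapP => i _ ->.
- exact: unit.
(* [dot (c + c') x] is at most the norm of [c + c'], hence at most [2 * cos R0] since
   [dot c c' <= ico_cos]. The gap is the slack left by [r < R0]. *)
- exists ((cos r - cos R0) *+ 2); first by rewrite mulrn_wgt0 // subr_gt0.
  move=> c c' x Cc Cc' ne xx.
  have d : dot c c' <= ico_cos.
    move: Cc Cc' ne; rewrite CE => -[k [s [t ->]]] [k' [s' [t' ->]]] ne.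
    rewrite dot_orthogonal //.
    by case: (ico_dot_bound R k s t k' s' t') => // e; rewrite e eqxx in ne.
  have -> : cos r *+ 2 - (cos r - cos R0) *+ 2 = cos R0 *+ 2 by ring.
  rewrite -dotDl leNgt; apply/negP => lt.
  have cs := dot_ge0 (c + c' - dot (c + c') x *: x).
  rewrite !dotlin xx (unit _ Cc) (unit _ Cc') (dotC c' c) (dotC x c) (dotC x c') in cs.
  rewrite dotDl in lt.
  move: (dot c x) (dot c' x) (dot c c') lt d cs => a b d lt dl cs.
  have : (a + b) ^+ 2 <= 2 + 2 * d by lra.
  have : 4 * cos R0 ^+ 2 < (a + b) ^+ 2.
    by move: (cos R0) cR0 lt => w w0 lt; clear -w0 lt; nra.
  by rewrite cR; lra.
(* The face is the one containing the midpoint of the arc, so that the symmetric window of [sweep]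
   becomes [[0, pi / 2]]. *)
- move=> z zu; set z' := geodesic (pi / 4) z.
  have zu' : unit_tangent z' by apply: geodesic_unit.
  have [c1' [c2' [c3' [a1 [a2 [a3 [[p1 p2 p3] xE [d12 d23 d31] vert]]]]]]] := face_cover (z'.1 *m U^T).
  have v c : c \in [:: c1'; c2'; c3'] -> dot c c = 1 /\ C (c *m U).
    by move=> /vert [k [s [t ->]]]; rewrite ico_unit.
  have [u1 C1] := v c1' (mem_head _ _).
  have [u2 C2] : dot c2' c2' = 1 /\ C (c2' *m U) by apply: v; rewrite !inE eqxx orbT.
  have [u3 C3] : dot c3' c3' = 1 /\ C (c3' *m U) by apply: v; rewrite !inE eqxx !orbT.
  have zE : z'.1 = a1 *: (c1' *m U) + a2 *: (c2' *m U) + a3 *: (c3' *m U).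
    by rewrite !scalemxAl -!mulmxDl -xE -mulmxA UU' mulmx1.
  have [c cin [hA hAB]] : exists2 c, c \in [:: c1' *m U; c2' *m U; c3' *m U] &
     ico_cos <= dot c z'.1 /\ (5 + 3 * ico_cos) / 8 <= dot c z'.1 ^+ 2 + dot c z'.2 ^+ 2.
    by apply: (triangle_near zu' s0 s1 p1 p2 p3 _ _ _ _ _ _ zE); rewrite dot_orthogonal.
  have Cc : C c by move: cin; rewrite !inE => /or3P[] /eqP ->.
  have [t /andP[t1 t2] ht] := sweep s0 s2 hA hAB c2.
  exists (t + pi / 4), c; split=> //; first by apply/andP; split; lra.
  rewrite geodesicD -/z'; move: ht; rewrite mulrC (mulrC _ (sin t)).
  by rewrite [geodesic t z']/geodesic [X in dot c X]/= !dotlin.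
- by apply: cos_gt0_pihalf; lra.
- have := cos2Dsin2 r; have := sin_gt0_pi (x := r).
  have -> : 0 < r < pi by apply/andP; split; lra.
  move=> /(_ isT) sn0; have := cos_ge0_pihalf (x := r).
  have -> : - (pi / 2) <= r <= pi / 2 by apply/andP; split; lra.
  by move=> /(_ isT); move: (cos r) (sin r) sn0 => a b b0 a0 e; nra.
- have : cos R0 ^+ 2 < cos r ^+ 2.
    by move: (cos R0) (cos r) cR0 c1 => w w' w0 lt; clear -w0 lt; nra.
  by rewrite cR; lra.
Qed.

End Faces.

(** * The table and the reflection law *)

Section RealNear.
Variable R : realType.
Implicit Types (t e : R) (P Q : R -> Prop).

Lemma near_distP t P :
  (\forall s \near t, P s) <-> exists2 e : R, 0 < e & forall s, `|s - t| < e -> P s.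
Proof.
split=> [/nbhs_normP[e e0 Pe]|[e e0 Pe]].
  by exists e => // s st; apply: Pe; rewrite /= distrC.
by apply/nbhs_normP; exists e => // s /= st; apply: Pe; rewrite distrC.
Qed.

Lemma dnear_distP t P : (\forall s \near t^', P s) <->
  exists2 e : R, 0 < e & forall s, `|s - t| < e -> s != t -> P s.
Proof. exact: (near_distP t (fun s => s != t -> P s)). Qed.

Lemma rnear_distP t P : (\forall s \near t^'+, P s) <->
  exists2 e : R, 0 < e & forall s, t < s < t + e -> P s.
Proof.
rewrite [X in X <-> _](near_distP t (fun s => t < s -> P s)).
split=> -[e e0 Pe]; exists e => // s.
  by move=> /andP[ts se]; apply: Pe => //; rewrite gtr0_norm; lra.
by move=> st ts; apply: Pe; rewrite gtr0_norm in st; lra.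
Qed.

Lemma lnear_distP t P : (\forall s \near t^'-, P s) <->
  exists2 e : R, 0 < e & forall s, t - e < s < t -> P s.
Proof.
rewrite [X in X <-> _](near_distP t (fun s => s < t -> P s)).
split=> -[e e0 Pe]; exists e => // s.
  by move=> /andP[ts se]; apply: Pe => //; rewrite ltr0_norm; lra.
by move=> st ts; apply: Pe; rewrite ltr0_norm in st; lra.
Qed.

(** Connectedness of the interval: the set where [Q] holds is both open and closed in it. *)
Lemma interval_locally_constant (a b : R) Q :
  (forall t, a < t < b ->
     (\forall s \near t, Q s) \/ (\forall s \near t, ~ Q s)) ->
  forall s t, a < s < b -> a < t < b -> Q s -> Q t.
Proof.
move=> loc s t hs ht Qs.
have con : connected (`]a, b[%classic : set R).
  by apply/connected_intervalP; exact: interval_is_interval.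
pose B := [set u | a < u < b /\ Q u].
have inJ u : a < u < b -> \forall w \near u, a < w < b.
  by move=> hu; have := @near_in_itvoo R a b u; rewrite in_itv; apply.
suff : B = `]a, b[%classic by move/seteqP => -[_ /(_ t)]; rewrite /= in_itv => /(_ ht)[].
apply: con.
- by exists s.
- exists (interior B); first exact: open_interior.
  apply/seteqP; split=> u /=.
    move=> [hu Qu]; split; first by rewrite in_itv.
    case: (loc u hu) => [Qn|/nbhs_singleton//].
    by near=> w; split; near: w; [exact: inJ|exact: Qn].
  by move=> [_ /nbhs_singleton].
- pose B' := [set u | a < u < b /\ ~ Q u].
  exists (~` interior B'); first by apply: open_closedC; exact: open_interior.
  apply/seteqP; split=> u /=.
    by move=> [hu Qu]; rewrite in_itv; split => // /nbhs_singleton[].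
  rewrite in_itv => -[hu nB]; split => //; apply: contrapT => nQu; apply: nB.
  case: (loc u hu) => [/nbhs_singleton//|Qn].
  by near=> w; split; near: w; [exact: inJ|exact: Qn].
Unshelve. all: by end_near. Qed.

(* [h cos u + k sin u - h = 2 sin (u/2) (k cos (u/2) - h sin (u/2))] *)
Lemma sweep_increases (h k : R) : 0 < k ->
  \forall u \near 0^'+, h < h * cos u + k * sin u.
Proof.
move=> k0; pose f u := k * cos (u / 2) - h * sin (u / 2).
have hu : u / 2 @[u --> (0 : R)] --> 0 / (2 : R).
  by apply: cvgM; [exact: cvg_id|exact: cvg_cst].
have cf : f u @[u --> (0 : R)] --> f 0.
  by apply: cvgB; apply: cvgM; [exact: cvg_cst|apply: continuous_cvg hu; exact: continuous_cos
    |exact: cvg_cst|apply: continuous_cvg hu; exact: continuous_sin].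
have f0 : 0 < f 0 by rewrite /f mul0r cos0 sin0 mulr0 subr0 mulr1.
have /near_distP[e e0 fe] : \forall u \near 0, 0 < f u by apply: (cvgr_gt _ cf).
have pp := @pi_gt0 R.
apply/rnear_distP; exists (Order.min e pi); first by rewrite lt_min e0.
move=> u /andP[u0]; rewrite add0r lt_min => /andP[ue up].
have fu : 0 < f u by apply: fe; rewrite subr0 gtr0_norm.
have su : 0 < sin (u / 2) by apply: sin_gt0_pi; lra.
have u2 : u = u / 2 *+ 2 by field.
rewrite -subr_gt0 {1}u2 (_ : sin u = (cos (u / 2) * sin (u / 2)) *+ 2); last first.
  by rewrite {1}u2 sin_mulr2n.
rewrite cos_mulr2n cos2sin2.
have -> : h * ((1 - sin (u / 2) ^+ 2) *+ 2 - 1) + k * ((cos (u / 2) * sin (u / 2)) *+ 2) - h = 2 * (sin (u / 2) * f u).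
  by rewrite /f; ring.
by rewrite !mulr_gt0.
Qed.

Lemma cos_lt1 t : 0 < t < pi -> cos t < 1.
Proof.
move=> h; have := sin_gt0_pi h; have := cos2Dsin2 t; have := cos_le1 t.
by move: (cos t) (sin t) => c s c1 e s0; nra.
Qed.

End RealNear.

Section Continuity.
Variable R : realType.
Local Notation V := 'rV[R]_3.
Local Notation VV := ('rV[R]_3 * 'rV[R]_3)%type.
Implicit Types (y c : V) (z : VV).

Lemma cvg_dot T (F : set_system T) {FF : Filter F} (f : T -> V) (l c : V) :
  f @ F --> l -> dot c (f t) @[t --> F] --> dot c l.
Proof.
move=> fl; have cc i : c 0 i * f t 0 i @[t --> F] --> c 0 i * l 0 i.
  apply: cvgM; first exact: cvg_cst.
  by apply: (@continuous_cvg _ _ _ F FF f (fun y : V => y 0 i)) fl; exact: coord_continuous.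
rewrite dotE (_ : (fun t => dot c (f t)) = fun t => c 0 ord0 * f t 0 ord0
   + c 0 (lift ord0 ord0) * f t 0 (lift ord0 ord0)
   + c 0 (lift ord0 (lift ord0 ord0)) * f t 0 (lift ord0 (lift ord0 ord0))).
  by apply: cvgD; [apply: cvgD|]; apply: cc.
by apply/funext => y; rewrite dotE.
Qed.

Lemma dot_geodesic1 c t z :
  dot c (geodesic t z).1 = dot c z.1 * cos t + dot c z.2 * sin t.
Proof. by rewrite /geodesic /= !dotlin; ring. Qed.

Lemma dot_geodesic2 c t z :
  dot c (geodesic t z).2 = dot c z.2 * cos t - dot c z.1 * sin t.
Proof. by rewrite /geodesic /= !dotlin; ring. Qed.

Lemma geodesic1_cvg z t : (geodesic s z).1 @[s --> t] --> (geodesic t z).1.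
Proof.
apply: cvgD; apply: cvgZr_tmp; [exact: continuous_cos|exact: continuous_sin].
Qed.

Lemma geodesic2_cvg z t : (geodesic s z).2 @[s --> t] --> (geodesic t z).2.
Proof.
apply: cvgB; apply: cvgZr_tmp; [exact: continuous_cos|exact: continuous_sin].
Qed.

End Continuity.

Section Table.
Variable R : realType.
Local Notation V := 'rV[R]_3.
Local Notation VV := ('rV[R]_3 * 'rV[R]_3)%type.
Implicit Types (u v x y c : V) (z : VV).
Variables (C : set V) (r : R).
Hypothesis r_pi : 0 < r < pi.
Hypothesis adm : admissible C (cos r).
Local Notation h := (cos r).

Definition open_air x := forall c, C c -> dot c x < h.

Lemma acos_lt (u : R) : -1 <= u <= 1 -> (acos u < r) = (h < u).
Proof.
move=> hu; rewrite -[in RHS](acosK (_ : u \in `[-1, 1]%R)) ?in_itv //.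
rewrite ltr_cos // in_itv /= ?acos_ge0 ?acos_lepi //.
by case/andP: r_pi => /ltW -> /ltW ->.
Qed.

Lemma collidesE c z : sphere z.1 -> C c -> collides r c z <-> dot c z.1 = h.
Proof.
move=> zs Cc; have cc := adm_unit adm Cc; have d := dot_le1 zs cc.
rewrite /collides /sdist dotC; rewrite dotC in d; split=> [<-|->].
  by rewrite acosK // in_itv.
by rewrite cosK // in_itv /=; case/andP: r_pi => /ltW -> /ltW ->.
Qed.

Lemma tableE x : table C r x <-> sphere x /\ forall c, C c -> dot c x <= h.
Proof.
split=> [[xs nb]|[xs le]]; split=> //.
  move=> c Cc; rewrite leNgt; apply/negP => lt; apply: nb; exists c => //; split=> //.
  by rewrite /sdist acos_lt dotC // dot_le1 // (adm_unit adm).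
move=> [c Cc [_]]; rewrite /sdist acos_lt; last by rewrite dot_le1 // (adm_unit adm).
by rewrite ltNge dotC le.
Qed.

(** There are finitely many obstacles, so finitely many neighbourhoods are intersected. *)
Lemma near_centers T (F : set_system T) {FF : Filter F} (P : V -> T -> Prop) :
  (forall c, C c -> \forall t \near F, P c t) ->
  \forall t \near F, forall c, C c -> P c t.
Proof.
have [l lE] := adm_finite adm => FP.
suff : \forall t \near F, forall c, c \in l -> P c t.
  by apply: filterS => t Pt c /lE; exact: Pt.
have {lE FP} : forall c, c \in l -> \forall t \near F, P c t by move=> c /lE; exact: FP.
elim: l => [|c l IH] FP; first by near=> t.
have Fc := FP c (mem_head _ _).
have Fl : \forall t \near F, forall c, c \in l -> P c t.
  by apply: IH => c' cl; apply: FP; rewrite inE cl orbT.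
by near=> t => c'; rewrite inE => /orP[/eqP ->|]; [near: t|move: (c'); near: t].
Unshelve. all: by end_near. Qed.

Lemma open_air_near T (F : set_system T) {FF : Filter F} (f : T -> V) l :
  f @ F --> l -> open_air l -> \forall t \near F, open_air (f t).
Proof.
by move=> fl ol; apply: near_centers => c Cc; apply: (cvgr_lt _ (cvg_dot (c := c) fl)); exact: ol.
Qed.

Lemma normal_unit c x : dot c c = 1 -> sphere x -> dot c x = h ->
  [/\ dot (normal c x) x = 0, dot (normal c x) (normal c x) = 1 - h ^+ 2 &
   dot (normal c x) c = 1 - h ^+ 2].
Proof.
move=> cc; rewrite /sphere /= => xx cx.
by split; rewrite /normal !dotlin ?cc ?xx ?(dotC x c) ?cx; ring.
Qed.

Lemma h_bounds : 0 < h /\ 0 < 1 - h ^+ 2.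
Proof. by have := adm_pos adm; have := adm_lt1 adm; split=> //; nra. Qed.

(** The point to exclude is a boundary point: the geodesic that leaves it towards the center, with
    unit velocity [v], enters the removed disk at once by [sweep_increases], whose slope is here
    [k], the sine of the radius. *)
Lemma table_intE x : table_int C r x <-> sphere x /\ open_air x.
Proof.
split=> [[xs near]|[xs op]]; split=> //; last first.
  have H : \forall y \near nbhs x, open_air y by apply: (open_air_near _ op); exact: cvg_id.
  by apply: filterS H => y oy ys; apply/tableE; split=> // c Cc; exact/ltW/oy.
have /tableE[_ le] : table C r x by have := nbhs_singleton near; apply.
move=> c Cc; rewrite lt_neqAle le // andbT; apply/eqP => cx.
have cc := adm_unit adm Cc; have [h0 h1] := h_bounds.
have [nx nn nc] := normal_unit cc xs cx.
pose k : R := Num.sqrt (1 - h ^+ 2).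
have k0 : 0 < k by rewrite sqrtr_gt0.
have kk : k ^+ 2 = 1 - h ^+ 2 by rewrite sqr_sqrtr // ltW.
pose v : V := k^-1 *: normal c x.
have zu : unit_tangent (x, v).
  split => //=; first by rewrite /v dotZr dotC nx mulr0.
  by rewrite /v dotZl dotZr nn -kk; field; rewrite gt_eqF.
have cv : dot c v = k by rewrite /v dotZr dotC nc -kk; field; rewrite gt_eqF.
have /near_distP[e e0 he] : \forall u \near 0, sphere (geodesic u (x, v)).1 -> table C r (geodesic u (x, v)).1.
  have nr : nbhs (geodesic 0 (x, v)).1 (fun y => sphere y -> table C r y).
    by rewrite geodesic0.
  exact: (geodesic1_cvg nr).
have /rnear_distP[d d0 hd] := sweep_increases h k0.
pose u := Order.min e d / 2.
have m0 : 0 < Order.min e d by rewrite lt_min e0.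
have ue : u < e by have := ge_min e e d; rewrite lexx /= /u => ?; lra.
have ud : u < d by have := ge_min d e d; rewrite lexx orbT /u => ?; lra.
have u0 : 0 < u by rewrite /u; lra.
have gs : sphere (geodesic u (x, v)).1 by case: (geodesic_unit u zu).
have /tableE[_ /(_ c Cc)] : table C r (geodesic u (x, v)).1.
  by apply: he => //; rewrite subr0 gtr0_norm.
rewrite leNgt => /negP; apply; rewrite dot_geodesic1 /= cv cx.
by apply: hd; rewrite u0 add0r.
Unshelve. all: by end_near. Qed.

Lemma OmegaE z : Omega C r z <-> unit_tangent z /\ open_air z.1.
Proof.
split=> [[zu /table_intE[]]|[zu op]]; split=> //.
by apply/table_intE; case: zu.
Qed.

Definition bounce c x v : V := Defs.reflect c x v.

Lemma bounceE c x v : dot c c = 1 -> sphere x -> dot c x = h -> dot v x = 0 ->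
  bounce c x v = v - (2 * dot c v / (1 - h ^+ 2)) *: normal c x.
Proof.
move=> cc xs cx vx; have [_ nn _] := normal_unit cc xs cx.
by rewrite /bounce /Defs.reflect nn {2}/normal !dotlin vx mulr0 subr0 (dotC v c).
Qed.

Lemma bounce_props c x v : dot c c = 1 -> sphere x -> dot c x = h -> dot v x = 0 ->
  [/\ dot (bounce c x v) x = 0, dot c (bounce c x v) = - dot c v,
    dot (bounce c x v) (bounce c x v) = dot v v &
    bounce c x (bounce c x v) = v].
Proof.
move=> cc xs cx vx; have [nx nn nc] := normal_unit cc xs cx.
have [h0 h1] := h_bounds; have h1' : 1 - h ^+ 2 != 0 by rewrite gt_eqF.
have nv : dot (normal c x) v = dot c v.
  by rewrite /normal !dotlin (dotC x v) vx mulr0 subr0.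
have rx : dot (bounce c x v) x = 0.
  by rewrite bounceE // dotDl dotNl dotZl vx nx; ring.
have rc : dot c (bounce c x v) = - dot c v.
  by rewrite bounceE // dotDr dotNr dotZr (dotC c (normal _ _)) nc; field.
split=> //.
  rewrite bounceE //; move: (normal c x) nx nn nc nv => N nx nn nc nv.
  by rewrite !dotlin nn (dotC v N) nv; field.
rewrite (bounceE cc xs cx rx) rc bounceE //.
by apply: row3P; rewrite !mxE; ring.
Qed.

Lemma bounce_unit c x v : C c -> dot c x = h -> unit_tangent (x, v) ->
  unit_tangent (x, bounce c x v).
Proof.
move=> Cc cx [/= xs xv vv]; have cc := adm_unit adm Cc.
have [rx _ rr _] := bounce_props cc xs cx (etrans (dotC v x) xv).
by split=> //=; [rewrite dotC|rewrite rr].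
Qed.

End Table.

(** * Existence and uniqueness of the trajectories *)

Section Trajectories.
Variable R : realType.
Local Notation V := 'rV[R]_3.
Local Notation VV := ('rV[R]_3 * 'rV[R]_3)%type.
Implicit Types (s t u a b m e : R) (x c q v : V) (Y : VV) (G : R -> VV).
Variables (C : set V) (r : R).
Hypothesis r_pi : 0 < r < pi.
Hypothesis adm : admissible C (cos r).
Local Notation h := (cos r).
Local Notation open_air := (open_air C r).

Lemma traj_unit G t : trajectory C r G -> unit_tangent (G t).
Proof. by move=> /traj_table/(_ t)[]. Qed.

Lemma traj_int G t : trajectory C r G ->
  table_int C r (G t).1 <-> open_air (G t).1.
Proof.
move=> tG; rewrite table_intE //; split=> [[]//|op]; split=> //.
by case: (traj_unit t tG).
Qed.

Lemma traj_free_near G t : trajectory C r G -> open_air (G t).1 ->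
  \forall s \near t, G s = geodesic (s - t) (G t).
Proof.
move=> tG op.
have /near_distP[e e0 he] : \forall s \near t, open_air (G s).1.
  exact: (open_air_near adm (traj_cont tG (x := t)) op).
apply/near_distP; exists e => // s st.
have F : forall s, t - e < s < t + e -> table_int C r (G s).1.
  by move=> u /andP[u1 u2]; apply/(traj_int _ tG)/he; rewrite ltr_norml; apply/andP; split; lra.
rewrite ltr_norml in st; case/andP: st => s1 s2.
by apply: (traj_free tG F); apply/andP; split; lra.
Qed.

(** The main tool to identify a trajectory: agreement with a geodesic at one instant spreads to the
    whole time interval on which that geodesic, rather than the trajectory, is known to avoid the
    obstacles. *)
Lemma traj_propagate G Y (a b m : R) : trajectory C r G ->
  (forall t, a < t < b -> open_air (geodesic t Y).1) ->
  a < m < b -> G m = geodesic m Y ->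
  forall t, a < t < b -> G t = geodesic t Y.
Proof.
move=> tG op hm Gm t ht.
apply: (interval_locally_constant (Q := fun t => G t = geodesic t Y) _ hm ht Gm).
move=> {Gm m hm ht}t ht; have opt := op t ht.
(* The alternative is on positions, the only continuous part of a trajectory. If they coincide, the
   trajectory is in open air and both curves are geodesics near [t]; if not, they stay distinct
   nearby. *)
have [e|ne] := eqVneq (G t).1 (geodesic t Y).1.
  have near := traj_free_near tG (t := t); rewrite e in near.
  have [Gt|nGt] := EM (G t = geodesic t Y).
    by left; apply: filterS (near opt) => s ->; rewrite Gt -geodesicD subrK.
  right; apply: filterS (near opt) => s -> Gs; apply: nGt.
  by rewrite -(geodesicK (s - t) (G t)) Gs -geodesicD; congr geodesic; ring.
right; have d0 : 0 < `|(G t).1 - (geodesic t Y).1| by rewrite normr_gt0 subr_eq0.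
have c : (G s).1 - (geodesic s Y).1 @[s --> t] --> (G t).1 - (geodesic t Y).1.
  by apply: cvgB; [exact: (traj_cont tG (x := t))|exact: geodesic1_cvg].
apply: filterS (cvgr_norm_gt _ c 0 d0) => s + Gs.
by rewrite Gs subrr normr0 ltxx.
Qed.

Lemma geodesic_limits (F : set_system R) {FF : ProperFilter F} G t s q v :
  F --> t -> (\forall u \near F, G s = geodesic (s - u) (G u)) ->
  (G u).1 @[u --> F] --> q -> (G u).2 @[u --> F] --> v ->
  (q, v) = geodesic (t - s) (G s).
Proof.
move=> Ft FG c1 c2.
have su : u - s @[u --> F] --> t - s by apply: cvgB => //; exact: cvg_cst.
have E : \forall u \near F, geodesic (u - s) (G s) = G u.
  apply: filterS FG => u {1}->; rewrite -geodesicD.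
  by have -> : u - s + (s - u) = 0 by [ring]; rewrite geodesic0.
rewrite [RHS]surjective_pairing; congr pair.
  apply: (@cvg_unique _ (@norm_hausdorff _ _) _ _ _ _ c1).
  have : (geodesic (u - s) (G s)).1 @[u --> F] --> (geodesic (t - s) (G s)).1.
    by apply: (@continuous_cvg _ _ _ F _ _ (fun w => (geodesic w (G s)).1)) su; exact: geodesic1_cvg.
  by apply: cvg_trans; apply: near_eq_cvg; apply: filterS E => u ->.
apply: (@cvg_unique _ (@norm_hausdorff _ _) _ _ _ _ c2).
have : (geodesic (u - s) (G s)).2 @[u --> F] --> (geodesic (t - s) (G s)).2.
    by apply: (@continuous_cvg _ _ _ F _ _ (fun w => (geodesic w (G s)).2)) su; exact: geodesic2_cvg.
by apply: cvg_trans; apply: near_eq_cvg; apply: filterS E => u ->.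
Qed.

(** [v] is the incoming velocity. Collisions being isolated, the one-sided limits of
    [traj_collision] become exact geodesics on both sides, and limits of velocities are not met
    again in the uniqueness proof. *)
Lemma crossing G t c : trajectory C r G -> C c -> dot c (G t).1 = h ->
  exists2 e : R, 0 < e & exists v, [/\ unit_tangent ((G t).1, v),
    (G t).2 = bounce c (G t).1 v,
    forall s, t - e < s < t -> G s = geodesic (s - t) ((G t).1, v),
    forall s, t < s < t + e -> G s = geodesic (s - t) (G t) &
    forall s, `|s - t| < e -> s != t -> open_air (G s).1].
Proof.
move=> tG Cc ct.
have ts : sphere (G t).1 by case: (traj_unit t tG).
have col : collides r c (G t) by apply/(collidesE r_pi adm).
have [v [vl vr Gt]] := traj_collision tG Cc col.
have /dnear_distP[e e0 iso] := traj_isolated tG t.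
have air s : `|s - t| < e -> s != t -> open_air (G s).1.
  by move=> st ne; apply/(traj_int _ tG)/iso.
have Fl : forall s, t - e < s < t -> table_int C r (G s).1.
  move=> s /andP[s1 s2]; apply: iso; last by rewrite lt_eqF.
  by rewrite ltr_norml; apply/andP; split; lra.
have Fr : forall s, t < s < t + e -> table_int C r (G s).1.
  move=> s /andP[s1 s2]; apply: iso; last by rewrite gt_eqF.
  by rewrite ltr_norml; apply/andP; split; lra.
have cl : (G u).1 @[u --> t^'-] --> (G t).1.
  by apply: cvg_within_filter; exact: (traj_cont tG (x := t)).
have cr : (G u).1 @[u --> t^'+] --> (G t).1.
  by apply: cvg_within_filter; exact: (traj_cont tG (x := t)).
have L s : t - e < s < t -> ((G t).1, v) = geodesic (t - s) (G s).
  move=> hs; apply: (geodesic_limits (F := t^'-)) => //.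
    by apply: cvg_within.
  apply/lnear_distP; exists e => // u hu.
  exact: (traj_free tG Fl hu hs).
have Rr s : t < s < t + e -> ((G t).1, bounce c (G t).1 v) = geodesic (t - s) (G s).
  move=> hs; apply: (geodesic_limits (F := t^'+)) => //.
    by apply: cvg_within.
  apply/rnear_distP; exists e => // u hu.
  exact: (traj_free tG Fr hu hs).
exists e => //; exists v; split=> //.
- by rewrite (L (t - e / 2)); [apply: geodesic_unit; exact: traj_unit|apply/andP; split; lra].
- by move=> s hs; rewrite (L s hs) -geodesicD; have -> : s - t + (t - s) = 0 by [ring]; rewrite geodesic0.
- move=> s hs; rewrite [G t in RHS]surjective_pairing Gt -/(bounce _ _ _) (Rr s hs) -geodesicD.
  by have -> : s - t + (t - s) = 0 by [ring]; rewrite geodesic0.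
Qed.

End Trajectories.

(** * Outgoing states, free flights and their reversal *)

Section Flights.
Variable R : realType.
Local Notation V := 'rV[R]_3.
Local Notation VV := ('rV[R]_3 * 'rV[R]_3)%type.
Implicit Types (s t u a m e : R) (x c q p v : V) (z : VV).
Variables (C : set V) (r : R).
Hypothesis r_pi : 0 < r < pi.
Hypothesis adm : admissible C (cos r).
Local Notation h := (cos r).
Local Notation open_air := (open_air C r).

Record outgoing z c : Prop := Outgoing {
  out_unit : unit_tangent z ; out_center : C c ;
  out_hit : dot c z.1 = h ; out_dir : dot c z.2 <= 0 }.

(** The weak inequalities in [fl_dir] and [out_dir] admit grazing, since trajectories must exist
    through every point of [Omega]. Air is required only strictly inside the interval, so that a
    flight may start on an obstacle. *)
Record flight z t c z' : Prop := Flight {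
  fl_unit : unit_tangent z ;
  fl_time : 0 < t <= pi / 2 ;
  fl_air : forall s, 0 < s < t -> open_air (geodesic s z).1 ;
  fl_center : C c ;
  fl_hit : dot c (geodesic t z).1 = h ;
  fl_dir : 0 <= dot c (geodesic t z).2 ;
  fl_end : z' = ((geodesic t z).1, bounce c (geodesic t z).1 (geodesic t z).2) }.

Lemma cvg_dot_geodesic c z t :
  dot c (geodesic s z).1 @[s --> t] --> dot c (geodesic t z).1.
Proof. by apply: cvg_dot; exact: geodesic1_cvg. Qed.

Lemma dot_geodesic_gt c z t a : a < dot c (geodesic t z).1 ->
  exists2 e : R, 0 < e & forall s, `|s - t| < e -> a < dot c (geodesic s z).1.
Proof.
by move=> lt; apply/near_distP; exact: (cvgr_gt _ (@cvg_dot_geodesic c z t)).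
Qed.

(** The flight time is the infimum of the positive hitting times: some exist before [pi / 2] by the
    horizon property, and the initial air keeps them away from 0. *)
Lemma exit_flight z : unit_tangent z ->
  (\forall s \near 0^'+, open_air (geodesic s z).1) ->
  exists t c z', flight z t c z'.
Proof.
move=> zu /rnear_distP[d d0 air0].
have [t0 [c0 [/andP[t00 t0p] Cc0 hit0]]] := adm_horizon adm zu.
pose E := [set s | 0 < s /\ exists2 c, C c & h <= dot c (geodesic s z).1].
have dE s : E s -> d <= s.
  move=> [s0 [c Cc hc]]; rewrite leNgt; apply/negP => sd.
  by have := air0 s _ c Cc; rewrite s0 add0r sd ltNge hc => /(_ isT).
have t0pos : 0 < t0.
  rewrite lt_neqAle t00 andbT; apply/eqP => t0E.
  rewrite -t0E in hit0.
  have [e e0 he] := dot_geodesic_gt hit0.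
  pose s := Order.min e d / 2; have m0 : 0 < Order.min e d by rewrite lt_min e0.
  have me := ge_min e e d; have md := ge_min d e d; rewrite !lexx /= orbT in me md.
  have s0 : 0 < s by rewrite /s; lra.
  have : h < dot c0 (geodesic s z).1.
    by apply: he; rewrite subr0 gtr0_norm // /s; lra.
  by rewrite ltNge ltW //; apply: air0 => //; rewrite s0 add0r /s; lra.
have Et0 : E t0 by split => //; exists c0 => //; exact: ltW.
have infE : has_inf E by split; [exists t0|exists d => s /dE].
pose t := inf E.
have dt : d <= t by apply: lb_le_inf; [exists t0|move=> s /dE].
have tt0 : t <= t0 by apply: ge_inf Et0; case: infE.
have tpos : 0 < t by lra.
have airt s : 0 < s < t -> open_air (geodesic s z).1.
  move=> /andP[s0 st] c Cc; rewrite ltNge; apply/negP => hc.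
  have : t <= s by apply: ge_inf; [case: infE|split => //; exists c].
  lra.
have [c Cc hc] : exists2 c, C c & h <= dot c (geodesic t z).1.
  apply: contrapT => nhit.
  have op : open_air (geodesic t z).1.
    by move=> c Cc; rewrite ltNge; apply/negP => hc; apply: nhit; exists c.
  have /near_distP[e e0 he] : \forall s \near t, open_air (geodesic s z).1.
    exact: (open_air_near adm (@geodesic1_cvg _ z t) op).
  have : t + e <= t.
    apply: lb_le_inf; first by exists t0.
    move=> s Es; rewrite leNgt; apply/negP => ste.
    have ts : t <= s by apply: ge_inf Es; case: infE.
    have [_ [c Cc]] := Es; rewrite leNgt he // ger0_norm; lra.
  lra.
have hit : dot c (geodesic t z).1 = h.
  apply/eqP; rewrite eq_le hc andbT leNgt; apply/negP => hlt.
  have [e e0 he] := dot_geodesic_gt hlt.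
  pose s := t - Order.min e t / 2; have m0 : 0 < Order.min e t by rewrite lt_min e0.
  have me := ge_min e e t; have md := ge_min t e t; rewrite !lexx /= orbT in me md.
  have : h < dot c (geodesic s z).1.
    by apply: he; rewrite ltr0_norm /s; lra.
  by rewrite ltNge ltW //; apply: airt => //; apply/andP; split; rewrite /s; lra.
(* With a negative derivative, the geodesic read backwards from [t] would enter the disk, so it
   would have been inside just before [t]. *)
have dir : 0 <= dot c (geodesic t z).2.
  rewrite leNgt; apply/negP => neg.
  have k0 : 0 < - dot c (geodesic t z).2 by rewrite oppr_gt0.
  have /rnear_distP[e e0 he] := sweep_increases h k0.
  pose u := Order.min e t / 2; have m0 : 0 < Order.min e t by rewrite lt_min e0.
  have me := ge_min e e t; have md := ge_min t e t; rewrite !lexx /= orbT in me md.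
  have u0 : 0 < u by rewrite /u; lra.
  have hu : 0 < u < 0 + e by apply/andP; split; rewrite /u; lra.
  have := he u hu.
  rewrite mulNr -mulrN -sinN -(cosN u) -{2}hit -dot_geodesic1 -geodesicD ltNge ltW //.
  by apply: airt => //; apply/andP; split; rewrite /u; lra.
exists t, c, ((geodesic t z).1, bounce c (geodesic t z).1 (geodesic t z).2).
split=> //; rewrite tpos /=; lra.
Qed.

Lemma outgoing_far z c c' : outgoing z c -> C c' -> c' != c -> dot c' z.1 < h.
Proof.
move=> [zu Cc hit _] Cc' ne; have [d d0 sep] := adm_sep adm.
have zs : dot z.1 z.1 = 1 by case: zu.
by have := sep c' c z.1 Cc' Cc ne zs; rewrite hit; lra.
Qed.

Lemma outgoing_le z c c' : outgoing z c -> C c' -> dot c' z.1 <= h.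
Proof.
move=> oz Cc'; have [->|ne] := eqVneq c' c; first by rewrite (out_hit oz).
exact/ltW/(outgoing_far oz).
Qed.

(** The level is [h * cos s + D * sin s] with [D <= 0 < h]. Grazing departures are included: [h > 0]
    makes the disk convex. *)
Lemma outgoing_leaves z c s : outgoing z c -> 0 < s < pi ->
  dot c (geodesic s z).1 < h.
Proof.
move=> [zu Cc hit dir] hs; have [h0 _] := h_bounds adm.
have s0 := sin_gt0_pi hs; have c1 := cos_lt1 hs.
by rewrite dot_geodesic1 hit; nra.
Qed.

Lemma outgoing_air z c : outgoing z c ->
  \forall s \near 0^'+, open_air (geodesic s z).1.
Proof.
move=> oz; apply: (near_centers adm) => c' Cc'.
have [->|ne] := eqVneq c' c.
  apply/rnear_distP; exists pi; first exact: pi_gt0.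
  by move=> s; rewrite add0r; exact: outgoing_leaves.
apply: cvg_within.
apply: (cvgr_lt _ (cvg_dot_geodesic (c := c') (z := z) (t := 0))).
by rewrite geodesic0; exact: (outgoing_far oz).
Qed.

Lemma flight_out z t c z' : flight z t c z' -> outgoing z' c.
Proof.
move=> [zu _ _ Cc hit dir ->].
have := geodesic_unit t zu; move: (geodesic t z) hit dir => [q p] /= hit dir qp.
have [qs qpo _] := qp; have cc := adm_unit adm Cc.
have [_ bc _ _] := bounce_props adm cc qs hit (etrans (dotC p q) qpo).
by split => //=; [exact: (bounce_unit adm)|rewrite bc oppr_le0].
Qed.

(** The disk reached is not the one just left, so [adm_sep] gives [A <= h - d] for [A = dot c' z.1].
    Reaching [h = A * cos t + B * sin t] with [B <= 1] then needs [sin t >= d] if [A >= 0], and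
    [sin t >= h] otherwise. *)
Lemma flight_sin : exists2 sg : R, 0 < sg &
  forall z c t c' z', outgoing z c -> flight z t c' z' -> sg <= sin t.
Proof.
have [d d0 sep] := adm_sep adm; have [h0 _] := h_bounds adm.
exists (Order.min h d); first by rewrite lt_min h0.
move=> z c t c' z' oz fl; have /andP[t0 tp] := fl_time fl.
have pp := @pi_gt0 R.
have ne : c' != c.
  have hb : 0 < t < pi by apply/andP; split; lra.
  by apply/eqP => e; have := outgoing_leaves oz hb; rewrite -e (fl_hit fl) ltxx.
have zs : dot z.1 z.1 = 1 by case: (out_unit oz).
have A : dot c' z.1 <= h - d.
  by have := sep c' c z.1 (fl_center fl) (out_center oz) ne zs; rewrite (out_hit oz); lra.
have B : dot c' z.2 <= 1.
  have v1 : dot z.2 z.2 = 1 by case: (out_unit oz).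
  by case/andP: (dot_le1 (adm_unit adm (fl_center fl)) v1).
have c0 : 0 <= cos t by apply: cos_ge0_pihalf; lra.
have c1 := cos_le1 t; have s0 : 0 < sin t by apply: sin_gt0_pi; lra.
have := fl_hit fl; rewrite dot_geodesic1.
move: (dot c' z.1) (dot c' z.2) (cos t) (sin t) A B c0 c1 s0 => A B k s hA hB k0 k1 s0 e.
rewrite ge_min; apply/orP; have [A0|A0] := leP 0 A; [right|left]; nra.
Qed.

(** The outgoing state of the reversed trajectory at the same collision: bouncing an outgoing
    velocity gives back the incoming one, which is then reversed. *)
Definition turn z c : VV := (z.1, - bounce c z.1 z.2).

Lemma bounceN c x v : bounce c x (- v) = - bounce c x v.
Proof.
by rewrite /bounce /Defs.reflect dotNl; apply: row3P; rewrite !mxE; ring.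
Qed.

Lemma turn_outgoing z c : outgoing z c -> outgoing (turn z c) c.
Proof.
move=> [zu Cc hit dir]; have cc := adm_unit adm Cc.
have [zs zv vv] := zu.
have [rx rc rr _] := bounce_props adm cc zs hit (etrans (dotC _ _) zv).
split=> //=; last by rewrite dotNr rc opprK.
by split=> //=; rewrite ?dotNr ?dotNl ?opprK ?rr // dotC rx oppr0.
Qed.

Lemma turnK z c : outgoing z c -> turn (turn z c) c = z.
Proof.
move=> [zu Cc hit dir]; have cc := adm_unit adm Cc.
have [zs zv vv] := zu.
have [rx rc rr rK] := bounce_props adm cc zs hit (etrans (dotC _ _) zv).
by rewrite /turn /= bounceN opprK rK -surjective_pairing.
Qed.

Lemma flight_turn z c0 t c z' : outgoing z c0 -> flight z t c z' ->
  flight (turn z' c) t c0 (turn z c0).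
Proof.
move=> oz fl; have [zu ht air Cc hit dir z'E] := fl.
have gu := geodesic_unit t zu; have [gs gv gg] := gu; have cc := adm_unit adm Cc.
have [_ _ _ bK] := bounce_props adm cc gs hit (etrans (dotC _ _) gv).
have -> : turn z' c = flip (geodesic t z) by rewrite /turn z'E /= bK.
have E s : geodesic s (flip (geodesic t z)) = flip (geodesic (t - s) z).
  by rewrite geodesic_flip -geodesicD addrC.
have [_ Cc0 hit0 dir0] := oz.
split; rewrite ?E ?subrr ?geodesic0 //.
- exact: flip_unit.
- move=> s /andP[s0 st]; rewrite E; apply: air; apply/andP; split; lra.
- by rewrite /= dotNr oppr_ge0.
- by rewrite /= bounceN.
Qed.

End Flights.

Section OneSided.
Variables (R : realType) (U : topologicalType).
Implicit Types (f g : R -> U) (s t e : R) (l : U).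

Lemma cvg_left_eq f g t l :
  (exists2 e : R, 0 < e & forall s, t - e < s < t -> f s = g s) ->
  g s @[s --> t] --> l -> f s @[s --> t^'-] --> l.
Proof.
move=> [e e0 fg] gl A nA; suff H : \forall s \near t^'-, A (f s) by exact: H.
have /near_distP[d d0 hd] : \forall s \near t, A (g s) by exact: gl nA.
have m0 : 0 < Order.min e d by rewrite lt_min e0.
have me := ge_min e e d; have md := ge_min d e d; rewrite !lexx /= orbT in me md.
apply/lnear_distP; exists (Order.min e d) => // s /andP[s1 s2].
rewrite fg; last by apply/andP; split; lra.
by apply: hd; rewrite ltr0_norm; lra.
Qed.

Lemma cvg_right_eq f g t l :
  (exists2 e : R, 0 < e & forall s, t < s < t + e -> f s = g s) ->
  g s @[s --> t] --> l -> f s @[s --> t^'+] --> l.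
Proof.
move=> [e e0 fg] gl A nA; suff H : \forall s \near t^'+, A (f s) by exact: H.
have /near_distP[d d0 hd] : \forall s \near t, A (g s) by exact: gl nA.
have m0 : 0 < Order.min e d by rewrite lt_min e0.
have me := ge_min e e d; have md := ge_min d e d; rewrite !lexx /= orbT in me md.
apply/rnear_distP; exists (Order.min e d) => // s /andP[s1 s2].
rewrite fg; last by apply/andP; split; lra.
by apply: hd; rewrite gtr0_norm; lra.
Qed.

End OneSided.

Section ShiftedGeodesic.
Variable R : realType.
Implicit Types (z : 'rV[R]_3 * 'rV[R]_3) (a t u : R).

Let shift_cvg a t : u - a @[u --> t] --> t - a.
Proof. by apply: cvgB; [exact: cvg_id|exact: cvg_cst]. Qed.

Lemma geodesic1_shift_cvg z a t :
  (geodesic (u - a) z).1 @[u --> t] --> (geodesic (t - a) z).1.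
Proof.
apply: (@continuous_cvg _ _ _ _ _ (fun u => u - a) (fun w => (geodesic w z).1)).
  exact: geodesic1_cvg.
exact: shift_cvg.
Qed.

Lemma geodesic2_shift_cvg z a t :
  (geodesic (u - a) z).2 @[u --> t] --> (geodesic (t - a) z).2.
Proof.
apply: (@continuous_cvg _ _ _ _ _ (fun u => u - a) (fun w => (geodesic w z).2)).
  exact: geodesic2_cvg.
exact: shift_cvg.
Qed.

End ShiftedGeodesic.

(** * Bi-infinite chains of flights and the trajectories that they define *)

Section Existence.
Variable R : realType.
Local Notation V := 'rV[R]_3.
Local Notation VV := ('rV[R]_3 * 'rV[R]_3)%type.
Implicit Types (s t u a b e : R) (c p : V) (z : VV).
Variables (C : set V) (r : R).
Hypothesis r_pi : 0 < r < pi.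
Hypothesis adm : admissible C (cos r).
Local Notation open_air := (open_air C r).
Local Notation outgoing := (outgoing C r).
Local Notation flight := (flight C r).

Record chain (T : int -> R) (Z : int -> VV) (cc : int -> V) : Prop := Chain {
  ch_out : forall k, outgoing (Z k) (cc k) ;
  ch_flight : forall k : int,
    flight (Z k) (T (k + 1) - T k) (cc (k + 1)) (Z (k + 1)) }.

(** Only the future of a state can be constructed directly. The past of [z0] is the future of
    [turn z0 c0], turned back state by state. *)
Lemma chain_exists z0 c0 t0 : outgoing z0 c0 ->
  exists T Z cc, chain T Z cc /\ [/\ T 0 = t0, Z 0 = z0 & cc 0 = c0].
Proof.
move=> oz0.
(* [f] gives the next flight time, state and center; its value at a pair that is not outgoing is
   arbitrary. *)
have /choice[f fP] : forall p : VV * V, exists n : R * (VV * V),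
    outgoing p.1 p.2 -> flight p.1 n.1 n.2.2 n.2.1.
  move=> [z c] /=; have [oz|noz] := EM (outgoing z c); last by exists (0, (z, c)).
  have [t [c' [z' fl]]] := exit_flight adm (out_unit oz) (outgoing_air adm oz).
  by exists (t, (z', c')).
pose W (w : VV * V) n := iter n (fun w => (f w).2) w.
have WO w : outgoing w.1 w.2 -> forall n, outgoing (W w n).1 (W w n).2.
  move=> op; elim=> [|n IH] //=; exact: (flight_out adm (fP _ IH)).
have WF w n : outgoing w.1 w.2 ->
    flight (W w n).1 (f (W w n)).1 (W w n.+1).2 (W w n.+1).1.
  by move=> op; apply: fP; exact: WO.
pose p0 := (z0, c0); pose p1 := (turn z0 c0, c0).
have op0 : outgoing p0.1 p0.2 by [].
have op1 : outgoing p1.1 p1.2 by apply: (turn_outgoing adm).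
(* [Negz n] is [- (n + 1)], so it corresponds to [n.+1] steps of the reversed sequence. *)
pose T (k : int) := match k with
  | Posz n => t0 + \sum_(i < n) (f (W p0 i)).1
  | Negz n => t0 - \sum_(i < n.+1) (f (W p1 i)).1 end.
pose Z (k : int) := match k with
  | Posz n => (W p0 n).1 | Negz n => turn (W p1 n.+1).1 (W p1 n.+1).2 end.
pose cc (k : int) := match k with
  | Posz n => (W p0 n).2 | Negz n => (W p1 n.+1).2 end.
exists T, Z, cc; split; last by split=> //; rewrite /T /= big_ord0 addr0.
split=> [[n|n]|[n|[|n]]].
- exact: WO.
- by apply: (turn_outgoing adm); exact: WO.
- have -> : Posz n + 1 = Posz n.+1 by rewrite -PoszD addn1.
  rewrite /T /Z /cc big_ord_recr /=.
  have -> : t0 + (\sum_(i < n) (f (W p0 i)).1 + (f (W p0 n)).1)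
    - (t0 + \sum_(i < n) (f (W p0 i)).1) = (f (W p0 n)).1 by ring.
  exact: WF.
- have -> : Negz 0 + 1 = 0 by [].
  rewrite /T /Z /cc big_ord_recr /= !big_ord0.
  have -> : t0 + 0 - (t0 - (0 + (f p1).1)) = (f p1).1 by ring.
  have := flight_turn adm op1 (WF p1 0%N op1).
  by rewrite (turnK adm oz0).
- have -> : Negz n.+1 + 1 = Negz n by rewrite !NegzE -[n.+2]addn1 PoszD; ring.
  rewrite /T /Z /cc [in X in flight _ (_ - X)]big_ord_recr /=.
  set S := \sum_(i < n.+1) _; have -> : t0 - S - (t0 - (S + (f (W p1 n.+1)).1)) = (f (W p1 n.+1)).1 by ring.
  exact: (flight_turn adm (WO _ op1 _) (WF p1 n.+1 op1)).
Qed.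

Section ChainTheory.
Variables (T : int -> R) (Z : int -> VV) (cc : int -> V).
Hypothesis ch : chain T Z cc.

(** A lower bound of [sin] at the flight times keeps these times away from 0. Collisions thus do not
    accumulate, and the chain covers the whole time axis. *)
Lemma chain_gap : exists2 e : R, 0 < e & forall k, e <= T (k + 1) - T k.
Proof.
have [sg sg0 hs] := flight_sin adm.
have sc : sin s @[s --> (0 : R)] --> sin 0 by exact: continuous_sin.
have /near_distP[e e0 he] : \forall s \near (0 : R), sin s < sg.
  by apply: (cvgr_lt _ sc); rewrite sin0.
exists e => // k; rewrite leNgt; apply/negP => lt.
have fl := ch_flight ch k; have /andP[t0 _] := fl_time fl.
have := hs _ _ _ _ _ (ch_out ch k) fl.
by rewrite leNgt he // subr0 gtr0_norm.
Qed.

Lemma chain_lt k : T k < T (k + 1).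
Proof. by have [e e0 /(_ k)] := chain_gap; lra. Qed.

Lemma chain_addn k (n : nat) : T k <= T (k + n%:Z).
Proof.
elim: n => [|n IH]; first by rewrite addr0.
apply: (le_trans IH); have -> : k + n.+1 = k + n + 1 by rewrite -addn1 PoszD addrA.
exact/ltW/chain_lt.
Qed.

Lemma chain_le (j k : int) : j <= k -> T j <= T k.
Proof.
move=> jk; have := chain_addn j `|k - j|%N.
by rewrite gez0_abs ?subr_ge0 // [j + _]addrC subrK.
Qed.

Lemma chain_locate t : exists k, T k <= t < T (k + 1).
Proof.
have [e e0 gap] := chain_gap.
have grow k (n : nat) : T k + n%:R * e <= T (k + n%:Z).
  elim: n => [|n IH]; first by rewrite mul0r !addr0.
  have -> : k + n.+1 = k + n + 1 by rewrite -addn1 PoszD addrA.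
  by have := gap (k + n); rewrite -natr1 mulrDl mul1r; lra.
have [N hN] : exists N : nat, `|t - T 0| < N%:R * e.
  have := archi_boundP (divr_ge0 (normr_ge0 (t - T 0)) (ltW e0)).
  by rewrite ltr_pdivrMr // => hN; exists (Num.bound (`|t - T 0| / e)).
have /andP[N1 N2] : - (N%:R * e) < t - T 0 < N%:R * e by rewrite -ltr_norml.
have lo : T (- N%:Z) <= t.
  by have := grow (- N%:Z) N; rewrite addNr; lra.
have hi : t < T (- N%:Z + (N + N)%N%:Z).
  have := grow 0 N; rewrite add0r PoszD addKr; lra.
have [n hn minn] := ex_minnP (ex_intro (fun n : nat => t < T (- N%:Z + n%:Z)) _ hi).
case: n hn minn => [|n] hn minn; first by rewrite addr0 ltNge lo in hn.
exists (- N%:Z + n%:Z); apply/andP; split; last first.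
  by rewrite -addrA -PoszD addn1.
by rewrite leNgt; apply/negP => /minn; rewrite ltnn.
Qed.

Definition chain_path t : VV :=
  let k := xget 0 [set k | T k <= t < T (k + 1)] in geodesic (t - T k) (Z k).

Lemma chain_pathE k t : T k <= t < T (k + 1) ->
  chain_path t = geodesic (t - T k) (Z k).
Proof.
move=> hk; rewrite /chain_path.
have hj : T (xget 0 [set k | T k <= t < T (k + 1)]) <= t <
          T (xget 0 [set k | T k <= t < T (k + 1)] + 1).
  by have := xgetPex 0 (chain_locate t).
suff -> : xget 0 [set k | T k <= t < T (k + 1)] = k by [].
move: (xget _ _) hj => j; case/andP: hk => k1 k2 /andP[j1 j2].
case: (ltgtP j k) => // [|].
- by rewrite -lezD1 => /chain_le le; exfalso; lra.
- by rewrite -lezD1 => /chain_le le; exfalso; lra.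
Qed.

Lemma chain_air k t : T k < t < T (k + 1) -> open_air (geodesic (t - T k) (Z k)).1.
Proof.
move=> /andP[t1 t2]; apply: (fl_air (ch_flight ch k)); apply/andP; split; lra.
Qed.

Lemma chain_at k : chain_path (T k) = Z k.
Proof. by rewrite (chain_pathE (k := k)) ?subrr ?geodesic0 // lexx chain_lt. Qed.

Lemma chain_left k : geodesic (T (k + 1) - T k) (Z k) =
  ((Z (k + 1)).1, (geodesic (T (k + 1) - T k) (Z k)).2).
Proof.
rewrite {1}[LHS]surjective_pairing; congr pair.
exact: (esym (congr1 fst (fl_end (ch_flight ch k)))).
Qed.

Lemma chain_near k : exists2 e : R, 0 < e & forall s, `|s - T (k + 1)| < e ->
  T k < s < T (k + 1) \/ T (k + 1) <= s < T (k + 1 + 1).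
Proof.
have [e e0 gap] := chain_gap; exists e => // s.
rewrite ltr_norml => /andP[s1 s2]; have g1 := gap k; have g2 := gap (k + 1).
have [lt|ge] := ltP s (T (k + 1)); [left|right]; rewrite ?lt ?ge ?andbT; lra.
Qed.

Lemma chain_path_cases t :
  (exists k, T k < t < T (k + 1)) \/ (exists k, t = T (k + 1)).
Proof.
have [k /andP[k1 k2]] := chain_locate t.
move: k1; rewrite le_eqVlt => /orP[/eqP <-|k1].
  by right; exists (k - 1); rewrite subrK.
by left; exists k; rewrite k1.
Qed.

Lemma chain_path_air k t : T k < t < T (k + 1) -> open_air (chain_path t).1.
Proof.
by move=> hk; rewrite (chain_pathE (k := k)); [exact: chain_air|case/andP: hk => /ltW -> ->].
Qed.

Lemma chain_path_unit t : unit_tangent (chain_path t).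
Proof.
have [k hk] := chain_locate t; rewrite (chain_pathE hk).
exact/geodesic_unit/(out_unit (ch_out ch k)).
Qed.

Lemma chain_path_int k t : T k < t < T (k + 1) -> table_int C r (chain_path t).1.
Proof.
move=> hk; apply/(table_intE r_pi adm); split; last exact: chain_path_air hk.
by case: (chain_path_unit t).
Qed.

Lemma chain_path_hit k : ~ table_int C r (chain_path (T k)).1.
Proof.
rewrite chain_at => /(table_intE r_pi adm)[_ /(_ _ (out_center (ch_out ch k)))].
by rewrite (out_hit (ch_out ch k)) ltxx.
Qed.

Lemma chain_trajectory : trajectory C r chain_path.
Proof.
split.
- move=> t; split; first exact: chain_path_unit.
  apply/(tableE r_pi adm); split; first by case: (chain_path_unit t).
  move=> c Cc; have [[k hk]|[k ->]] := chain_path_cases t.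
    exact/ltW/(chain_path_air hk).
  by rewrite chain_at; exact: (outgoing_le adm (ch_out ch _)).
- move=> t; have [[k hk]|[k ->]] := chain_path_cases t.
    have sub u : T k < u < T (k + 1) -> chain_path u = geodesic (u - T k) (Z k).
      by move=> /andP[u1 u2]; apply: chain_pathE; rewrite (ltW u1).
    rewrite /continuous_at (sub t hk) => A nA.
    have c := @geodesic1_shift_cvg _ (Z k) (T k) t.
    have n := @near_in_itvoo R (T k) (T (k + 1)) t; rewrite in_itv in n.
    suff H : \forall u \near t, A (chain_path u).1 by exact: H.
    near=> u; rewrite sub; first by near: u; exact: c nA.
    by have : u \in `](T k), (T (k + 1))[%R; [near: u; exact: n|rewrite in_itv].
  rewrite /continuous_at chain_at => A nA.
  have cl : (geodesic (u - T k) (Z k)).1 @[u --> T (k + 1)] --> (Z (k + 1)).1.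
    have -> : (Z (k + 1)).1 = (geodesic (T (k + 1) - T k) (Z k)).1 by rewrite chain_left.
    exact: geodesic1_shift_cvg.
  have cr : (geodesic (u - T (k + 1)) (Z (k + 1))).1 @[u --> T (k + 1)] --> (Z (k + 1)).1.
    have -> : (Z (k + 1)).1 = (geodesic (T (k + 1) - T (k + 1)) (Z (k + 1))).1.
      by rewrite subrr geodesic0.
    exact: geodesic1_shift_cvg.
  have /near_distP n := chain_near k.
  suff H : \forall u \near T (k + 1), A (chain_path u).1 by exact: H.
  near=> u; have : T k < u < T (k + 1) \/ T (k + 1) <= u < T (k + 1 + 1) by near: u.
  case=> [/andP[u1 u2]|hu].
    by rewrite (chain_pathE (k := k)) ?(ltW u1) //; near: u; exact: cl nA.
  by rewrite (chain_pathE hu); near: u; exact: cr nA.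
- move=> t; have [[k hk]|[k ->]] := chain_path_cases t.
    have n := @near_in_itvoo R (T k) (T (k + 1)) t; rewrite in_itv in n.
    apply: nbhs_dnbhs; apply: filterS (n hk) => u; rewrite in_itv.
    exact: chain_path_int.
  apply/dnear_distP; have [e e0 he] := chain_near k; exists e => // s /he[hs _|].
    exact: chain_path_int hs.
  move=> /andP[s1 s2] ne; apply: (chain_path_int (k := k + 1)).
  by rewrite lt_neqAle eq_sym ne s1.
(* An interval without collision lies between two consecutive times of the chain, on which the path
   is a single geodesic. *)
- move=> a b int s t hs ht.
  have [[k hk]|[k sE]] := chain_path_cases s; last first.
    by have := int s hs; rewrite sE => /chain_path_hit.
  case/andP: (hs) => as_ sb; case/andP: (ht) => at_ tb; case/andP: (hk) => ks sk.
  have ka : T k <= a.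
    by rewrite leNgt; apply/negP => lt; apply: (@chain_path_hit k); apply: int; rewrite lt /=; lra.
  have kb : b <= T (k + 1).
    by rewrite leNgt; apply/negP => lt; apply: (@chain_path_hit (k + 1)); apply: int; rewrite lt andbT; lra.
  rewrite !(chain_pathE (k := k)); [|apply/andP; split; lra..].
  by rewrite -geodesicD; congr geodesic; ring.
- move=> t c Cc col.
  have tu := chain_path_unit t; have ts : sphere (chain_path t).1 by case: tu.
  move/(collidesE r_pi adm ts Cc): col => hit.
  have [[k hk]|[k tE]] := chain_path_cases t.
    by have := chain_path_air hk Cc; rewrite hit ltxx.
  have o := ch_out ch (k + 1); rewrite tE chain_at in hit.
  have -> : c = cc (k + 1).
    apply/eqP; apply: contraT => ne.
    by have := outgoing_far adm o Cc ne; rewrite hit ltxx.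
  rewrite tE chain_at; have [e e0 he] := chain_near k.
  have fe := fl_end (ch_flight ch k).
  have qE : (geodesic (T (k + 1) - T k) (Z k)).1 = (Z (k + 1)).1 by exact: (esym (congr1 fst fe)).
  exists (geodesic (T (k + 1) - T k) (Z k)).2; split.
  + apply: cvg_left_eq (geodesic2_shift_cvg (z := Z k) (a := T k) (t := T (k + 1))).
    exists (T (k + 1) - T k); first by rewrite subr_gt0 chain_lt.
    by move=> s /andP[s1 s2]; rewrite (chain_pathE (k := k)) // s2 andbT; lra.
  + have -> : Defs.reflect (cc (k + 1)) (Z (k + 1)).1 (geodesic (T (k + 1) - T k) (Z k)).2
      = (geodesic (T (k + 1) - T (k + 1)) (Z (k + 1))).2.
      by rewrite subrr geodesic0; rewrite -qE; exact: (esym (congr1 snd fe)).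
    apply: cvg_right_eq (geodesic2_shift_cvg (z := Z (k + 1)) (a := T (k + 1)) (t := T (k + 1))).
    exists (T (k + 1 + 1) - T (k + 1)); first by rewrite subr_gt0 chain_lt.
    by move=> s /andP[s1 s2]; rewrite (chain_pathE (k := k + 1)) // (ltW s1) /=; lra.
  + by rewrite -qE; exact: (congr1 snd fe).
Unshelve. all: by end_near. Qed.

End ChainTheory.

End Existence.

(** * Uniqueness of trajectories, group law and time reversal of the flow *)

Section Flow.
Variable R : realType.
Local Notation V := 'rV[R]_3.
Local Notation VV := ('rV[R]_3 * 'rV[R]_3)%type.
Implicit Types (s t u a b m e : R) (x c q v : V) (z : VV) (G : R -> VV).
Implicit Types (T : int -> R) (Z : int -> VV) (cc : int -> V).
Variables (C : set V) (r : R).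
Hypothesis r_pi : 0 < r < pi.
Hypothesis adm : admissible C (cos r).
Local Notation h := (cos r).
Local Notation open_air := (open_air C r).
Local Notation flight := (flight C r).
Local Notation chain := (chain C r).
Local Notation Omega := (Omega C r).

Lemma turn_flight z t c z' : flight z t c z' -> turn z' c = flip (geodesic t z).
Proof.
move=> [zu _ _ Cc hit _ ->].
have [gs gv _] := geodesic_unit t zu; have cc := adm_unit adm Cc.
have [_ _ _ bK] := bounce_props adm cc gs hit (etrans (dotC _ _) gv).
by rewrite /turn /= bK.
Qed.

(** A flight from [flip z] finds the previous collision; turned around, it is the state at index 0
    of a chain that starts at the negative time [- t]. *)
Lemma chain_through z : Omega z ->
  exists T Z cc, chain T Z cc /\ T 0 < 0 < T 1 /\ chain_path T Z 0 = z.
Proof.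
move=> /(OmegaE r_pi adm)[zu zair].
have fu := flip_unit zu.
have near0 : \forall s \near 0^'+, open_air (geodesic s (flip z)).1.
  apply: cvg_within; apply: (open_air_near adm (@geodesic1_cvg _ (flip z) 0)).
  by rewrite geodesic0.
have [t [c [w fl]]] := exit_flight adm fu near0.
have ow := flight_out adm fl; have oz := turn_outgoing adm ow.
have Z0E : turn w c = geodesic (- t) z.
  by rewrite (turn_flight fl) geodesic_flip flipK.
have [T [Z [cc [ch [T0 Z0 c0]]]]] := chain_exists adm (- t) oz.
exists T, Z, cc; split=> //; have /andP[t0 _] := fl_time fl.
have fl1 := ch_flight ch 0; rewrite add0r Z0 Z0E T0 opprK in fl1.
(* A next collision at a time [T 1 <= 0] would lie on the arc from the previous collision to [z],
   which the reversed flight shows to be in open air. *)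
have T1 : 0 < T 1.
  rewrite ltNge; apply/negP => T1.
  have := fl_hit fl1; rewrite -geodesicD -addrA subrr addr0 => hit.
  have /andP[t1 _] := fl_time fl1.
  suff op : open_air (geodesic (T 1) z).1.
    by have := op _ (fl_center fl1); rewrite hit ltxx.
  move: T1; rewrite le_eqVlt => /orP[/eqP ->|T1]; first by rewrite geodesic0.
  have := fl_air fl (s := - T 1); rewrite geodesic_flip opprK /=; apply.
  by apply/andP; split; lra.
have T01 : T 0 < 0 < T 1 by rewrite T1 andbT T0 oppr_lt0.
split=> //; case/andP: T01 => a1 a2.
rewrite (chain_pathE adm ch (k := 0)) ?add0r ?(ltW a1) ?a2 //.
by rewrite T0 opprK Z0 Z0E geodesicNK.
Qed.

Section Uniqueness.
Variables (T : int -> R) (Z : int -> VV) (cc : int -> V) (G : R -> VV).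
Hypothesis ch : chain T Z cc.
Hypothesis tG : trajectory C r G.
Local Notation path := (chain_path T Z).

Lemma path_propagate k m : T k < m < T (k + 1) -> G m = path m ->
  forall t, T k < t < T (k + 1) -> G t = path t.
Proof.
have E t : T k < t < T (k + 1) -> path t = geodesic t (geodesic (- T k) (Z k)).
  by move=> /andP[t1 t2]; rewrite (chain_pathE adm ch (k := k)) ?(ltW t1) // geodesicD.
move=> hm; rewrite (E m hm) => Gm t ht; rewrite (E t ht).
refine (traj_propagate r_pi adm tG _ hm Gm ht) => u hu.
by rewrite -geodesicD; apply: (chain_air ch hu).
Qed.

(** Continuity gives the same collision point, the flight before it the same incoming velocity, and
    the reflection law then the same outgoing state. *)
Lemma path_next k : (forall t, T k < t < T (k + 1) -> G t = path t) ->
  G (T (k + 1)) = Z (k + 1) /\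
  forall t, T (k + 1) < t < T (k + 1 + 1) -> G t = path t.
Proof.
move=> eqG; set t := T (k + 1).
have lt1 := chain_lt adm ch k; have lt2 := chain_lt adm ch (k + 1).
have pE s : T k < s < t -> path s = geodesic (s - T k) (Z k).
  by move=> /andP[t1 t2]; rewrite (chain_pathE adm ch (k := k)) ?(ltW t1).
have qE : (G t).1 = (geodesic (t - T k) (Z k)).1.
  apply: (@cvg_unique _ (@norm_hausdorff _ _) ((G s).1 @[s --> t^'-])).
    by apply: cvg_within_filter; exact: (traj_cont tG (x := t)).
  apply: cvg_left_eq (@geodesic1_shift_cvg _ (Z k) (T k) t).
  exists (t - T k); first by rewrite subr_gt0.
  by move=> s /andP[s1 s2]; rewrite eqG ?pE // -?/t; apply/andP; split; lra.
have fl := ch_flight ch k; have Cc := fl_center fl.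
have hit : dot (cc (k + 1)) (G t).1 = h by rewrite qE; exact: fl_hit fl.
have [e e0 [v [vu Gt Gl Gr _]]] := crossing r_pi adm tG Cc hit.
have vE : ((G t).1, v) = geodesic (t - T k) (Z k).
  pose s := t - Order.min e (t - T k) / 2.
  have tk : 0 < t - T k by rewrite subr_gt0.
  have m0 : 0 < Order.min e (t - T k) by rewrite lt_min e0.
  have me := ge_min e e (t - T k); have md := ge_min (t - T k) e (t - T k).
  rewrite !lexx /= orbT in me md.
  have s1 : t - e < s < t by apply/andP; split; rewrite /s; lra.
  have s2 : T k < s < t by apply/andP; split; rewrite /s; lra.
  have := Gl s s1; rewrite eqG // pE // => E.
  rewrite -(geodesicNK (s - t) (_, v)) -geodesicD addrN geodesic0.
  rewrite -(geodesicK (s - t) (_, v)) -E -geodesicD; congr geodesic; ring.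
have GZ : G t = Z (k + 1).
  by rewrite [LHS]surjective_pairing Gt (fl_end fl) -[in RHS]vE.
split=> //; apply: (path_propagate (m := t + Order.min e (T (k + 1 + 1) - t) / 2)).
  have tk : 0 < T (k + 1 + 1) - t by rewrite subr_gt0.
  have m0 : 0 < Order.min e (T (k + 1 + 1) - t) by rewrite lt_min e0.
  have md := ge_min (T (k + 1 + 1) - t) e (T (k + 1 + 1) - t).
  by rewrite lexx orbT in md; rewrite -/t; apply/andP; split; lra.
set s := t + _.
have tk : 0 < T (k + 1 + 1) - t by rewrite subr_gt0.
have m0 : 0 < Order.min e (T (k + 1 + 1) - t) by rewrite lt_min e0.
have me := ge_min e e (T (k + 1 + 1) - t); have md := ge_min (T (k + 1 + 1) - t) e (T (k + 1 + 1) - t).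
rewrite !lexx /= orbT in me md.
rewrite Gr; last by apply/andP; split; rewrite /s; lra.
by rewrite GZ (chain_pathE adm ch (k := k + 1)) // -/t; apply/andP; split; rewrite /s; lra.
Qed.

(** Backwards, the incoming velocity is recovered from the outgoing one because the reflection is an
    involution. *)
Lemma path_prev k : (forall t, T (k + 1) < t < T (k + 1 + 1) -> G t = path t) ->
  forall t, T k < t < T (k + 1) -> G t = path t.
Proof.
move=> eqG; set t := T (k + 1).
have lt1 := chain_lt adm ch k; have lt2 := chain_lt adm ch (k + 1).
have pE s : t < s < T (k + 1 + 1) -> path s = geodesic (s - t) (Z (k + 1)).
  by move=> /andP[t1 t2]; rewrite (chain_pathE adm ch (k := k + 1)) ?(ltW t1).
have qE : (G t).1 = (Z (k + 1)).1.
  apply: (@cvg_unique _ (@norm_hausdorff _ _) ((G s).1 @[s --> t^'+])).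
    by apply: cvg_within_filter; exact: (traj_cont tG (x := t)).
  have -> : (Z (k + 1)).1 = (geodesic (t - t) (Z (k + 1))).1.
    by rewrite subrr geodesic0.
  apply: cvg_right_eq (@geodesic1_shift_cvg _ (Z (k + 1)) t t).
  exists (T (k + 1 + 1) - t); first by rewrite subr_gt0.
  by move=> s /andP[s1 s2]; rewrite eqG ?pE // -/t; apply/andP; split; lra.
have fl := ch_flight ch k; have Cc := fl_center fl.
have hit : dot (cc (k + 1)) (G t).1 = h by rewrite qE; exact: out_hit (ch_out ch _).
have [e e0 [v [vu Gt Gl Gr _]]] := crossing r_pi adm tG Cc hit.
have GZ : G t = Z (k + 1).
  pose s := t + Order.min e (T (k + 1 + 1) - t) / 2.
  have tk : 0 < T (k + 1 + 1) - t by rewrite subr_gt0.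
  have m0 : 0 < Order.min e (T (k + 1 + 1) - t) by rewrite lt_min e0.
  have me := ge_min e e (T (k + 1 + 1) - t); have md := ge_min (T (k + 1 + 1) - t) e (T (k + 1 + 1) - t).
  rewrite !lexx /= orbT in me md.
  have s1 : t < s < t + e by apply/andP; split; rewrite /s; lra.
  have s2 : t < s < T (k + 1 + 1) by apply/andP; split; rewrite /s; lra.
  have := Gr s s1; rewrite eqG // pE // => E.
  by rewrite -(geodesicK (s - t) (G t)) -E geodesicK.
have cu := adm_unit adm Cc.
have vE : ((G t).1, v) = geodesic (t - T k) (Z k).
  have fE := fl_end fl; rewrite -GZ -/t in fE.
  have [gs gv _] := geodesic_unit (t - T k) (fl_unit fl).
  have [vs vv _] := vu.
  have [_ _ _ b1] := bounce_props adm cu vs hit (etrans (dotC _ _) vv).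
  have [_ _ _ b2] := bounce_props adm cu gs (fl_hit fl) (etrans (dotC _ _) gv).
  have q1 : (G t).1 = (geodesic (t - T k) (Z k)).1 by rewrite fE.
  rewrite [RHS]surjective_pairing -q1; congr pair.
  rewrite [LHS](esym b1) [X in bounce _ _ X](esym Gt) [X in bounce _ X _]q1.
  by rewrite (congr1 snd fE).
pose s := t - Order.min e (t - T k) / 2.
have tk : 0 < t - T k by rewrite subr_gt0.
have m0 : 0 < Order.min e (t - T k) by rewrite lt_min e0.
have me := ge_min e e (t - T k); have md := ge_min (t - T k) e (t - T k).
rewrite !lexx /= orbT in me md.
have s1 : t - e < s < t by apply/andP; split; rewrite /s; lra.
have s2 : T k < s < t by apply/andP; split; rewrite /s; lra.
apply: (path_propagate s2).
rewrite Gl // vE -geodesicD (chain_pathE adm ch (k := k)); first by congr geodesic; ring.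
by case/andP: s2 => /ltW -> ->.
Qed.

Lemma path_unique k m : T k < m < T (k + 1) -> G m = path m ->
  forall t, G t = path t.
Proof.
move=> hm Gm; have Pk := path_propagate hm Gm.
have up j (n : nat) : (forall t, T j < t < T (j + 1) -> G t = path t) ->
    forall t, T (j + n%:Z) < t < T (j + n%:Z + 1) -> G t = path t.
  move=> Pj; elim: n => [|n IH]; first by rewrite addr0.
  have -> : j + n.+1 = j + n + 1 by rewrite -addn1 PoszD addrA.
  by case: (path_next IH).
have down j (n : nat) : (forall t, T (j + n%:Z) < t < T (j + n%:Z + 1) -> G t = path t) ->
    forall t, T j < t < T (j + 1) -> G t = path t.
  elim: n => [|n IH] Pn; first by rewrite addr0 in Pn.
  apply: IH; apply: path_prev; move: Pn.
  by have -> : j + n.+1 = j + n + 1 by rewrite -addn1 PoszD addrA.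
have all j : forall t, T j < t < T (j + 1) -> G t = path t.
  case: (leP k j) => [kj|/ltW jk].
    by have := up k `|j - k|%N Pk; rewrite gez0_abs ?subr_ge0 // [k + _]addrC subrK.
  apply: (down j `|k - j|%N); rewrite gez0_abs ?subr_ge0 // [j + _]addrC subrK.
  exact: Pk.
move=> t; have [[j hj]|[j ->]] := chain_path_cases adm ch t; first exact: all hj.
by rewrite (chain_at adm ch); case: (path_next (all j)).
Qed.

End Uniqueness.

Lemma path_unique0 T Z cc G : chain T Z cc -> T 0 < 0 < T 1 -> trajectory C r G ->
  G 0 = chain_path T Z 0 -> forall t, G t = chain_path T Z t.
Proof.
by move=> ch h01 tG; apply: (path_unique ch tG (k := 0)); rewrite add0r.
Qed.

Definition itinerary z T Z cc :=
  [/\ chain T Z cc, T 0 < 0 < T 1 & forall t, flow C r t z = chain_path T Z t].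

Lemma flow_trajectory z : Omega z -> trajectory C r (flow C r ^~ z) /\ flow C r 0 z = z.
Proof.
move=> Oz; have [T [Z [cc [ch [h01 g0]]]]] := chain_through Oz.
rewrite /flow; apply: (@getPex _ [set g | trajectory C r g /\ g 0 = z]).
by exists (chain_path T Z); split=> //; exact: (chain_trajectory r_pi adm ch).
Qed.

Lemma flow0 z : Omega z -> flow C r 0 z = z.
Proof. by case/flow_trajectory. Qed.

Lemma flow_itinerary z : Omega z -> exists T Z cc, itinerary z T Z cc.
Proof.
move=> Oz; have [T [Z [cc [ch [h01 g0]]]]] := chain_through Oz.
have [tG G0] := flow_trajectory Oz.
by exists T, Z, cc; split=> //; apply: (path_unique0 ch h01 tG); rewrite G0.
Qed.

Lemma itinerary_of_chain z T Z cc : chain T Z cc -> T 0 < 0 < T 1 -> Omega z ->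
  chain_path T Z 0 = z -> itinerary z T Z cc.
Proof.
move=> ch h01 Oz g0; have [tG G0] := flow_trajectory Oz.
by split=> //; apply: (path_unique0 ch h01 tG); rewrite G0.
Qed.

Lemma itinerary_shift z T Z cc s k : itinerary z T Z cc -> Omega (flow C r s z) ->
  T k < s < T (k + 1) ->
  itinerary (flow C r s z) (fun j => T (k + j) - s) (fun j => Z (k + j)) (fun j => cc (k + j)).
Proof.
move=> [ch h01 fE] Os hs.
have ch' : chain (fun j => T (k + j) - s) (fun j => Z (k + j)) (fun j => cc (k + j)).
  split=> j; first exact: (ch_out ch).
  by rewrite addrA; have := ch_flight ch (k + j);
    have -> : T (k + j + 1) - s - (T (k + j) - s) = T (k + j + 1) - T (k + j) by ring.
case/andP: (hs) => s1 s2.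
apply: (itinerary_of_chain ch') => //; first by rewrite addr0 subr_lt0 s1 subr_gt0 s2.
rewrite fE (chain_pathE adm ch (k := k)) ?(ltW s1) //.
rewrite (chain_pathE adm ch' (k := 0)); last by rewrite addr0 subr_le0 (ltW s1) add0r subr_gt0.
by rewrite addr0; congr geodesic; ring.
Qed.

Lemma itinerary_interval z T Z cc s : itinerary z T Z cc -> Omega (flow C r s z) ->
  exists k, T k < s < T (k + 1).
Proof.
move=> [ch _ fE] [_ op]; have [//|[k sE]] := chain_path_cases adm ch s.
by case: (chain_path_hit r_pi adm ch (k := k + 1)); rewrite -fE -sE.
Qed.

Lemma itinerary_Omega z T Z cc s k : itinerary z T Z cc -> T k < s < T (k + 1) ->
  Omega (flow C r s z).
Proof.
move=> [ch _ fE] hs; split; rewrite fE; first exact: (chain_path_unit adm ch).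
exact: (chain_path_int r_pi adm ch hs).
Qed.

Lemma flowD z s t : Omega z -> Omega (flow C r s z) ->
  flow C r t (flow C r s z) = flow C r (t + s) z.
Proof.
move=> Oz Os; have [T [Z [cc it]]] := flow_itinerary Oz.
have [k hs] := itinerary_interval it Os.
have [ch' _ ->] := itinerary_shift it Os hs; have [ch _ ->] := it.
have [j hj] := chain_locate adm ch (t + s); rewrite (chain_pathE adm ch hj).
rewrite (chain_pathE adm ch' (k := j - k)).
  by rewrite [k + _]addrC subrK; congr geodesic; ring.
have -> : k + (j - k + 1) = j + 1 by ring.
by rewrite [k + _]addrC subrK; case/andP: hj => a1 a2; apply/andP; split; lra.
Qed.

(** Time 0 lies between the collisions numbered 0 and 1, which time reversal exchanges; hence the
    index [1 - k]. *)
Lemma itinerary_flip z T Z cc : itinerary z T Z cc -> Omega z ->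
  itinerary (flip z) (fun k => - T (1 - k)) (fun k => turn (Z (1 - k)) (cc (1 - k)))
    (fun k => cc (1 - k)).
Proof.
move=> [ch h01 fE] Oz.
have ch' : chain (fun k => - T (1 - k)) (fun k => turn (Z (1 - k)) (cc (1 - k)))
    (fun k => cc (1 - k)).
  split=> k; first exact/(turn_outgoing adm)/(ch_out ch).
  have := flight_turn adm (ch_out ch (- k)) (ch_flight ch (- k)).
  have -> : 1 - (k + 1) = - k by ring.
  rewrite [- k + 1]addrC.
  by have -> : - T (- k) - - T (1 - k) = T (1 - k) - T (- k) by ring.
have [zu zair] := (OmegaE r_pi adm _).1 Oz.
apply: (itinerary_of_chain ch').
- by rewrite subr0 subrr oppr_lt0 oppr_gt0; case/andP: h01 => -> ->.
- by apply/(OmegaE r_pi adm); split=> //; exact: flip_unit.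
have := turn_flight (ch_flight ch 0); rewrite add0r => tE.
case/andP: h01 => a1 a2.
rewrite (chain_pathE adm ch' (k := 0)) ?subr0 ?add0r ?subrr; last first.
  by rewrite oppr_le0 (ltW a2) oppr_gt0.
rewrite opprK tE geodesic_flip -geodesicD; congr flip.
rewrite -[RHS](flow0 Oz) fE (chain_pathE adm ch (k := 0)) ?add0r ?(ltW a1) //.
by congr geodesic; ring.
Qed.

Lemma Omega_flip z : Omega z -> Omega (flip z).
Proof.
move=> /(OmegaE r_pi adm)[zu zair]; apply/(OmegaE r_pi adm).
by split=> //; exact: flip_unit.
Qed.

Lemma flow_flip z t : Omega z -> Omega (flow C r (- t) z) ->
  flow C r t (flip z) = flip (flow C r (- t) z).
Proof.
move=> Oz Ot; have [T [Z [cc it]]] := flow_itinerary Oz.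
have [j /andP[j1 j2]] := itinerary_interval it Ot.
have [ch' _ ->] := itinerary_flip it Oz; have [ch _ ->] := it.
rewrite (chain_pathE adm ch (k := j)) ?(ltW j1) //.
have E1 : 1 - - j = j + 1 by ring.
rewrite (chain_pathE adm ch' (k := - j)); last first.
  rewrite E1; have -> : 1 - (- j + 1) = j by ring.
  by apply/andP; split; lra.
rewrite E1 (turn_flight (ch_flight ch j)) geodesic_flip -geodesicD.
by congr flip; congr geodesic; ring.
Qed.

Lemma Omega_tildeP z T Z cc : itinerary z T Z cc -> Omega z ->
  Omega_tilde C r z <-> forall k, dot (cc k) (Z k).2 < 0.
Proof.
move=> it Oz; have [ch h01 fE] := it.
have zE k : flow C r (T k) z = Z k by rewrite fE (chain_at adm ch).
have no k : dot (Z k).2 (normal (cc k) (Z k).1) = dot (cc k) (Z k).2.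
  have [_ zv _] := out_unit (ch_out ch k).
  by rewrite /normal !dotlin (dotC (Z k).2 (Z k).1) zv mulr0 subr0 dotC.
split=> [[_ graze] k|neg].
  have o := ch_out ch k; rewrite lt_neqAle (out_dir o) andbT -no -zE.
  apply: graze; first exact: out_center o.
  apply/(collidesE r_pi adm _ (out_center o)); rewrite zE; last exact: out_hit o.
  by case: (out_unit o).
split=> // t c Cc col; rewrite fE.
have tu := chain_path_unit adm ch t; have ts : sphere (chain_path T Z t).1 by case: tu.
rewrite fE in col; move/(collidesE r_pi adm ts Cc): col => hit.
have [[k hk]|[k tE]] := chain_path_cases adm ch t.
  by have := chain_path_air adm ch hk Cc; rewrite hit ltxx.
have o := ch_out ch (k + 1); rewrite tE (chain_at adm ch) in hit *.
have -> : c = cc (k + 1).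
  by apply/eqP; apply: contraT => ne; have := outgoing_far adm o Cc ne; rewrite hit ltxx.
by rewrite no lt_eqF.
Qed.

Lemma Omega_tilde_flow z s : Omega_tilde C r z -> Omega (flow C r s z) ->
  Omega_tilde C r (flow C r s z).
Proof.
move=> [Oz gr] Os; split=> // t c Cc; rewrite flowD //; exact: gr.
Qed.

Lemma Omega_tilde_flip z : Omega_tilde C r z -> Omega_tilde C r (flip z).
Proof.
move=> zt; have Oz : Omega z by case: zt.
have [T [Z [cc it]]] := flow_itinerary Oz.
have it' := itinerary_flip it Oz.
apply/(Omega_tildeP it' (Omega_flip Oz)) => k.
have := (Omega_tildeP it Oz).1 zt (1 - k); have [ch _ _] := it.
have [zu Cc hit dir] := ch_out ch (1 - k); have [zs zv _] := zu.
have [_ rc _ _] := bounce_props adm (adm_unit adm Cc) zs hit (etrans (dotC _ _) zv).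
by rewrite /turn /= dotNr rc opprK.
Qed.

End Flow.

(** * Differentials and scattering by one disk *)

Section Differentials.
Variable R : realType.
Local Notation V := 'rV[R]_3.
Local Notation VV := ('rV[R]_3 * 'rV[R]_3)%type.
Implicit Types (s t e d : R) (z w y : VV) (f g : VV -> VV) (A B : set VV).
Implicit Types (L : 'End(VV)).

Lemma coord_le (u : V) j : `|u 0 j| <= `|u|.
Proof.
rewrite [leRHS]/Num.norm /= mx_normrE.
exact: (le_trans _ (le_bigmax _ _ ((0 : 'I_1), j))).
Qed.

Lemma pair_norm_fst w : `|w.1| <= `|w|.
Proof. by rewrite [leRHS]/Num.norm /= le_max lexx. Qed.

Lemma pair_norm_snd w : `|w.2| <= `|w|.
Proof. by rewrite [leRHS]/Num.norm /= le_max lexx orbT. Qed.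

Lemma pair_expansion w : w =
  \sum_j w.1 0 j *: ((delta_mx 0 j, 0) : VV) + \sum_j w.2 0 j *: ((0, delta_mx 0 j) : VV).
Proof.
case: w => a b; rewrite [LHS]surjective_pairing [RHS]surjective_pairing; congr pair => /=.
  rewrite {1}[a]row_sum_delta !(big_morph fst (fun=> fun=> erefl) erefl) /=.
  by rewrite [X in _ + X]big1 ?addr0 // => j _; rewrite scaler0.
rewrite {1}[b]row_sum_delta !(big_morph snd (fun=> fun=> erefl) erefl) /=.
by rewrite [X in X + _]big1 ?add0r // => j _; rewrite scaler0.
Qed.

Lemma End_bounded L : exists2 K : R, 0 < K & forall w, `|L w| <= K * `|w|.
Proof.
pose K1 : R := \sum_j `|L ((delta_mx 0 j, 0) : VV)|.
pose K2 : R := \sum_j `|L ((0, delta_mx 0 j) : VV)|.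
exists (K1 + K2 + 1).
  by rewrite ltr_wpDl ?ltr01 // addr_ge0 // sumr_ge0.
move=> w; apply: (@le_trans _ _ ((K1 + K2) * `|w|)); last first.
  by rewrite ler_wpM2r // lerDl.
rewrite {1}(pair_expansion w) linearD /= !linear_sum /= mulrDl.
apply: (le_trans (ler_normD _ _)); apply: lerD.
  rewrite mulr_suml; apply: (le_trans (ler_norm_sum _ _ _)); apply: ler_sum => j _.
  rewrite linearZ /= normrZ mulrC ler_wpM2l // (le_trans (coord_le _ _)) //.
  exact: pair_norm_fst.
rewrite mulr_suml; apply: (le_trans (ler_norm_sum _ _ _)); apply: ler_sum => j _.
rewrite linearZ /= normrZ mulrC ler_wpM2l // (le_trans (coord_le _ _)) //.
exact: pair_norm_snd.
Qed.

Lemma linear_End f : (forall a u v, f (a *: u + v) = a *: f u + f v) ->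
  exists L, forall w, L w = f w.
Proof.
move=> lf.
pose F : {linear VV -> VV} := HB.pack_for {linear VV -> VV} f
  (GRing.isLinear.Build R VV VV _ f lf).
by exists (linfun F) => w; rewrite lfunE.
Qed.

Lemma near_normP z (P : VV -> Prop) : (\forall y \near z, P y) <->
  exists2 e, 0 < e & forall y, `|y - z| < e -> P y.
Proof.
split=> [/nbhs_normP[e e0 Pe]|[e e0 Pe]].
  by exists e => // s st; apply: Pe; rewrite /= distrC.
by apply/nbhs_normP; exists e => // s /= st; apply: Pe; rewrite distrC.
Qed.

Lemma is_diffP A f z L : is_diff_within A f z L <-> forall e, 0 < e ->
  exists2 d, 0 < d & forall y, A y -> `|y - z| < d ->
    `|f y - f z - L (y - z)| <= e * `|y - z|.
Proof.
split=> H e e0; have := H e e0.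
  by move=> /near_normP[d d0 hd]; exists d => // y Ay yz; exact: hd.
by case=> d d0 hd; apply/near_normP; exists d => // y yz Ay; exact: hd.
Qed.

Lemma is_diff_lin A z L : is_diff_within A L z L.
Proof.
apply/is_diffP => e e0; exists 1 => // y _ _.
by rewrite -linearB subrr normr0 mulr_ge0 // ltW.
Qed.

Lemma is_diff_eq_near A f g z L : f z = g z ->
  (exists2 d, 0 < d & forall y, A y -> `|y - z| < d -> f y = g y) ->
  is_diff_within A g z L -> is_diff_within A f z L.
Proof.
move=> fg [d d0 E] /is_diffP H; apply/is_diffP => e /H[d' d'0 hd].
exists (Order.min d d'); first by rewrite lt_min d0.
by move=> y Ay; rewrite lt_min => /andP[y1 y2]; rewrite fg E //; exact: hd.
Qed.

Lemma is_diff_continuous A f z L : is_diff_within A f z L -> forall e, 0 < e ->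
  exists2 d, 0 < d & forall y, A y -> `|y - z| < d -> `|f y - f z| < e.
Proof.
move=> /is_diffP/(_ 1 ltr01)[d d0 hd] e e0; have [K K0 hK] := End_bounded L.
exists (Order.min d (e / (K + 1))); first by rewrite lt_min d0 divr_gt0 // addr_gt0.
move=> y Ay; rewrite lt_min => /andP[y1]; rewrite ltr_pdivlMr ?addr_gt0 // => y2.
have -> : f y - f z = f y - f z - L (y - z) + L (y - z) by rewrite subrK.
have := ler_normD (f y - f z - L (y - z)) (L (y - z)); have := hd y Ay y1; have := hK (y - z).
by move: `|_| `|_| `|_| `|_ + _| y2 => a b c n; lra.
Qed.

Lemma is_diff_within_comp A B f g z L L' : is_diff_within A f z L ->
  is_diff_within B g (f z) L' ->
  (exists2 d, 0 < d & forall y, A y -> `|y - z| < d -> B (f y)) ->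
  is_diff_within A (g \o f) z (L' \o L)%VF.
Proof.
move=> df dg [d0 d00 fB]; have [K K0 hK] := End_bounded L; have [K' K'0 hK'] := End_bounded L'.
apply/is_diffP => e e0.
have K10 : 0 < K + 1 by rewrite addr_gt0.
have [d1 d10 h1] := (is_diffP _ _ _ _).1 df (e / (2 * K')) (divr_gt0 e0 (mulr_gt0 (ltr0n _ 2) K'0)).
have [d2 d20 h2] := (is_diffP _ _ _ _).1 df 1 ltr01.
have [d3 d30 h3] := (is_diffP _ _ _ _).1 dg (e / (2 * (K + 1))) (divr_gt0 e0 (mulr_gt0 (ltr0n _ 2) K10)).
have [d4 d40 h4] := is_diff_continuous df d30.
exists (Order.min (Order.min d0 d1) (Order.min d2 d4)).
  by rewrite !lt_min d00 d10 d20 d40.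
move=> y Ay; rewrite !lt_min => /andP[/andP[y0 y1] /andP[y2 y4]].
have H1 := h1 y Ay y1; have H2 := h2 y Ay y2; have H3 := h3 (f y) (fB y Ay y0) (h4 y Ay y4).
rewrite /= comp_lfunE.
have -> : g (f y) - g (f z) - L' (L (y - z)) =
  (g (f y) - g (f z) - L' (f y - f z)) + L' (f y - f z - L (y - z)).
  by rewrite [L' (f y - f z - _)]linearB /= addrA subrK.
have F : `|f y - f z| <= (K + 1) * `|y - z|.
  have := ler_normD (f y - f z - L (y - z)) (L (y - z)); rewrite subrK.
  by have := hK (y - z); move: `|_| `|_| `|_| `|_| H2 => a b c k; lra.
apply: (le_trans (ler_normD _ _)).
have -> : e * `|y - z| = e / (2 * (K + 1)) * ((K + 1) * `|y - z|) + K' * (e / (2 * K') * `|y - z|).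
  by field; rewrite !gt_eqF.
apply: lerD; first by apply: (le_trans H3); rewrite ler_wpM2l // divr_ge0 ?(ltW e0) // mulr_ge0 // ltW.
by apply: (le_trans (hK' _)); rewrite ler_wpM2l // ltW.
Qed.

Lemma differentiable_is_diff A f z : differentiable f z ->
  exists L, is_diff_within A f z L.
Proof.
move=> df; exists (linfun ('d f z)); apply/is_diffP => e e0.
have := diff_locally df => /eqaddoP/(_ e e0)/near_normP[d d0 hd].
exists d => // y _ yz; have := hd (y - z); rewrite subr0 => /(_ yz).
by rewrite !fctE /= subrK opprD addrA lfunE.
Qed.

(** A class of curves that contains geodesics, rotations about an axis and rotations of the
    velocity; the derivative at 0 is [K2]. *)
Definition trig (K0 K1 K2 : VV) t : VV := K0 + cos t *: K1 + sin t *: K2.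

Lemma trig_quotient K0 K1 K2 :
  h^-1 *: (trig K0 K1 K2 h - trig K0 K1 K2 0) @[h --> 0^'] --> K2.
Proof.
have S : h^-1 * sin h @[h --> 0^'] --> (1 : R).
  have : h^-1 *: ((sin \o shift 0) (h *: 1) - sin 0) @[h --> 0^'] --> 'D_1 (@sin R) 0.
    exact: (@derivable_sin R 0).
  rewrite derive_val cos0; apply: cvg_trans; apply: near_eq_cvg; near=> h.
  by rewrite /= sin0 subr0 addr0 [h *: 1]mulr1.
have Cq : h^-1 * (cos h - 1) @[h --> 0^'] --> (0 : R).
  have : h^-1 *: ((cos \o shift 0) (h *: 1) - cos 0) @[h --> 0^'] --> 'D_1 (@cos R) 0.
    exact: (@derivable_cos R 0).
  rewrite derive_val sin0 oppr0; apply: cvg_trans; apply: near_eq_cvg; near=> h.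
  by rewrite /= cos0 addr0 [h *: 1]mulr1.
have -> : (fun h => h^-1 *: (trig K0 K1 K2 h - trig K0 K1 K2 0)) =
  fun h => (h^-1 * (cos h - 1)) *: K1 + (h^-1 * sin h) *: K2.
  apply/funext => h; rewrite /trig cos0 sin0 scale1r scale0r addr0.
  rewrite -!scalerA -scalerDr scalerBl scale1r; congr (_ *: _).
  by rewrite opprD -(addrA K0) [K0 + _]addrC addrA addrK addrAC.
have : (h^-1 * (cos h - 1)) *: K1 + (h^-1 * sin h) *: K2 @[h --> (0 : R)^'] -->
    0 *: K1 + 1 *: K2 by apply: cvgD; apply: cvgZr_tmp.
by rewrite scale0r scale1r add0r.
Unshelve. all: by end_near. Qed.

(** This computes a differential already known to exist, one direction at a time, from a curve
    inside [A] whose image is explicit. *)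
Lemma diff_along A f z L K0 K1 K2 K0' K1' K2' : is_diff_within A f z L ->
  z = K0 + K1 -> (\forall t \near 0, A (trig K0 K1 K2 t)) ->
  (\forall t \near 0, f (trig K0 K1 K2 t) = trig K0' K1' K2' t) ->
  L K2 = K2'.
Proof.
move=> df zE At fE; have [K K0p hK] := End_bounded L.
pose c := trig K0 K1 K2; pose c' := trig K0' K1' K2'.
have c0 : c 0 = z by rewrite /c /trig cos0 sin0 scale1r scale0r addr0 zE.
have fz : f z = c' 0 by have := nbhs_singleton fE; rewrite -/(c 0) c0.
pose q h := h^-1 *: (c h - c 0); pose q' h := h^-1 *: (c' h - c' 0).
have hq : q h @[h --> 0^'] --> K2 by exact: trig_quotient.
have hq' : q' h @[h --> 0^'] --> K2' by exact: trig_quotient.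
have main e : 0 < e -> `|K2' - L K2| <= e.
  move=> e0; pose e1 := e / (3 * (`|K2| + 1)); pose e2 := e / (3 * (K + 1)).
  have b1 : 0 < 3 * (`|K2| + 1) by rewrite mulr_gt0 // ltr_wpDl.
  have b2 : 0 < 3 * (K + 1) by rewrite mulr_gt0 // addr_gt0.
  have e10 : 0 < e1 by rewrite divr_gt0.
  have e20 : 0 < e2 by rewrite divr_gt0.
  have e30 : 0 < e / 3 by rewrite divr_gt0.
  have [d d0 hd] := (is_diffP _ _ _ _).1 df e1 e10.
  have cc : c h @[h --> 0] --> c 0.
    apply: cvgD; first apply: cvgD; first exact: cvg_cst.
      by apply: cvgZr_tmp; exact: continuous_cos.
    by apply: cvgZr_tmp; exact: continuous_sin.
  have n1 : \forall h \near 0^', `|K2 - q h| < Order.min e2 1.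
    by apply: (cvgrPdist_lt _ _).1; [exact: hq|rewrite lt_min e20 ltr01].
  have n2 : \forall h \near 0^', `|K2' - q' h| < e / 3.
    by apply: (cvgrPdist_lt _ _).1; [exact: hq'|].
  have n3 : \forall h \near 0^', `|c 0 - c h| < d.
    have cc' : c h @[h --> (0 : R)^'] --> c 0 by apply: cvg_within_filter; exact: cc.
    by apply: (cvgrPdist_lt _ _).1; [exact: cc'|].
  have n4 : \forall h \near 0^', A (c h) by apply: nbhs_dnbhs.
  have n5 : \forall h \near 0^', f (c h) = c' h by apply: nbhs_dnbhs.
  have n6 : \forall h \near (0 : R)^', h != 0 by exact: nbhs_dnbhs_neq.
  have [h [h1 [h2 [h3 [h4 [h5 h6]]]]]] : exists h, `|K2 - q h| < Order.min e2 1 /\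
     `|K2' - q' h| < e / 3 /\ `|c 0 - c h| < d /\ A (c h) /\ f (c h) = c' h /\ h != 0.
    apply: (@filter_ex _ (0 : R)^'); near=> h; repeat split; by near: h.
  have : `|c' h - c' 0 - L (c h - c 0)| <= e1 * `|c h - c 0|.
    by rewrite -h5 -fz -c0; rewrite c0; apply: hd => //; rewrite -c0 distrC.
  rewrite -(ler_pM2l (_ : 0 < `|h^-1|)) ?normr_gt0 ?invr_neq0 // -normrZ.
  rewrite mulrCA -normrZ scalerBr -linearZ /= -/(q h) -/(q' h) => H.
  (* Three errors of size [e / 3]: the difference quotient of the image curve, the differentiability
     of [f], and the difference quotient of the curve. *)
  have -> : K2' - L K2 = (K2' - q' h) + (q' h - L (q h)) - L (K2 - q h).
    by rewrite [L (K2 - _)]linearB /= addrA subrK opprB addrA subrK.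
  move: h1; rewrite lt_min => /andP[h1 h1'].
  have nq : `|q h| <= `|K2| + 1.
    have := ler_normD (q h - K2) K2; rewrite subrK => /le_trans; apply.
    by rewrite addrC lerD2l distrC ltW.
  have H' : `|q' h - L (q h)| <= e / 3.
    apply: (le_trans H); apply: (@le_trans _ _ (e1 * (`|K2| + 1))).
      by rewrite ler_wpM2l // ltW.
    by rewrite /e1 invfM mulrA mulfVK // gt_eqF // ltr_wpDl.
  have H2 : `|L (K2 - q h)| <= e / 3.
    apply: (le_trans (hK _)); apply: (@le_trans _ _ ((K + 1) * e2)).
      by apply: ler_pM => //; [exact: ltW|rewrite lerDl|exact: ltW].
    by rewrite /e2 mulrC invfM mulrA mulfVK // gt_eqF // addr_gt0.
  apply: (le_trans (ler_normB _ _)); rewrite -lerBrDr.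
  apply: (le_trans (ler_normD _ _)); move: `|_| `|_| `|_| h2 H' H2 => x1 x2 x3; lra.
apply/eqP; rewrite eq_sym -subr_eq0 -normr_le0; apply/ler_addgt0Pl => e /main.
by rewrite addr0.
Unshelve. all: by end_near. Qed.

Lemma derive1_trig K0 K1 K2 (f : R -> VV) :
  (\forall s \near (0 : R), f s = trig K0 K1 K2 s) -> derive1 f 0 = K2.
Proof.
move=> fE; rewrite derive1E /derive.
apply: (cvg_lim (@norm_hausdorff _ _)).
have f0 := nbhs_singleton fE.
apply: cvg_trans (@trig_quotient K0 K1 K2); apply: near_eq_cvg.
near=> h; rewrite /= f0; congr (_ *: (_ - _)).
by rewrite [h *: 1]mulr1 addr0; symmetry; near: h; exact: nbhs_dnbhs.
Unshelve. all: by end_near. Qed.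

End Differentials.

(** * Differentiability of scalar products, products and square roots *)

Section Smooth.
Variable R : realType.
Local Notation V := 'rV[R]_3.
Local Notation VV := ('rV[R]_3 * 'rV[R]_3)%type.
Implicit Types (k : VV -> R) (f : VV -> VV) (y w : VV) (c u v : V).

Lemma End_differentiable (L : 'End(VV)) y : differentiable L y.
Proof.
apply: linear_differentiable => x; have [K K0 hK] := End_bounded L.
apply/cvgrPdist_lt => e e0; apply/near_normP; exists (e / K); first exact: divr_gt0.
move=> w; rewrite ltr_pdivlMr // distrC => lt; rewrite -linearB /=.
by apply: (le_lt_trans (hK _)); rewrite mulrC.
Qed.

Lemma linear_form_differentiable k y :
  (forall a (w w' : VV), k (a *: w + w') = a * k w + k w') ->
  continuous k -> differentiable k y.
Proof.
move=> lk ck.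
pose F : {linear VV -> R^o} := HB.pack_for {linear VV -> R^o} k
  (GRing.isLinear.Build R VV R^o _ k lk).
exact: (@linear_differentiable _ _ _ F y ck).
Qed.

Lemma dot1_differentiable c y : differentiable (fun y : VV => dot c y.1) y.
Proof.
apply: linear_form_differentiable => [a u v|x]; first by rewrite /= !dotlin.
by apply: cvg_dot; exact: cvg_fst.
Qed.

Lemma dot2_differentiable c y : differentiable (fun y : VV => dot c y.2) y.
Proof.
apply: linear_form_differentiable => [a u v|x]; first by rewrite /= !dotlin.
by apply: cvg_dot; exact: cvg_snd.
Qed.

Lemma dot_delta j u : dot (delta_mx 0 j) u = u 0 j.
Proof.
rewrite /dot mxE (bigD1 j) //= !mxE !eqxx mul1r big1 ?addr0 // => i ij.
by rewrite mxE (negPf ij) andbF mul0r.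
Qed.

Lemma scale_differentiable k f y : differentiable k y -> differentiable f y ->
  differentiable (fun y => k y *: f y) y.
Proof.
move=> dk df.
have -> : (fun y => k y *: f y) =
    (\sum_j (fun y => (k y * dot (delta_mx 0 j) (f y).1) *: ((delta_mx 0 j, 0) : VV)))
  + (\sum_j (fun y => (k y * dot (delta_mx 0 j) (f y).2) *: ((0, delta_mx 0 j) : VV))).
  apply/funext => x; rewrite !fctE !fct_sumE {1}(pair_expansion (f x)) scalerDr !scaler_sumr.
  by congr (_ + _); apply: eq_bigr => j _; rewrite scalerA dot_delta.
apply: differentiableD; apply: differentiable_sum => j; apply: differentiableZl;
  apply: differentiableM => //.
  exact: (differentiable_comp df (dot1_differentiable _ _)).
exact: (differentiable_comp df (dot2_differentiable _ _)).
Qed.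

Lemma sqrt_differentiable k y : differentiable k y -> 0 < k y ->
  differentiable (fun y => Num.sqrt (k y)) y.
Proof.
move=> dk k0; apply: (differentiable_comp dk).
by apply/derivable1_diffP; apply: ex_derive; exact: is_derive1_sqrt.
Qed.

End Smooth.

(** * Reflection by one disk and its differential *)

Section Scattering.
Variable R : realType.
Local Notation V := 'rV[R]_3.
Local Notation VV := ('rV[R]_3 * 'rV[R]_3)%type.
Implicit Types (s t : R) (y w z : VV) (u v : V).
Variables (c : V) (h : R).
Hypothesis cc : dot c c = 1.
Hypothesis h01 : 0 < h < 1.

Let A y := dot c y.1.
Let B y := dot c y.2.
Let Q y := A y ^+ 2 + B y ^+ 2.

(* For a geodesic which enters the disk of center [c], the cosine and the sine
   of the entrance time are algebraic functions of the initial condition. *)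
Definition hit_speed y := Num.sqrt (dot c y.1 ^+ 2 + dot c y.2 ^+ 2 - h ^+ 2).
Definition hit_cos y := (dot c y.1 * h + dot c y.2 * hit_speed y) /
  (dot c y.1 ^+ 2 + dot c y.2 ^+ 2).
Definition hit_sin y := (dot c y.2 * h - dot c y.1 * hit_speed y) /
  (dot c y.1 ^+ 2 + dot c y.2 ^+ 2).
Definition hit_point y : V := hit_cos y *: y.1 + hit_sin y *: y.2.
Definition hit_jump y := 2 * hit_speed y / (1 - h ^+ 2).

(* The geodesic [t |-> geodesic t (scatter y)] continues [t |-> geodesic t y]
   after its reflection. *)
Definition scatter y : VV :=
  (y.1 + (hit_jump y * hit_sin y) *: (c - h *: hit_point y),
   y.2 - (hit_jump y * hit_cos y) *: (c - h *: hit_point y)).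

Lemma h2_bound : 0 < 1 - h ^+ 2.
Proof. by case/andP: h01 => h0 h1; nra. Qed.

(** The sum [dot c y.1 ^+ 2 + dot c y.2 ^+ 2] is constant along a geodesic, so the speed of entrance
    is known without the time. The position and speed equations are then linear in [cos t] and
    [sin t]. *)
Lemma hit_at y t : dot c (geodesic t y).1 = h -> 0 < dot c (geodesic t y).2 ->
  [/\ hit_speed y = dot c (geodesic t y).2, hit_cos y = cos t, hit_sin y = sin t &
    dot c y.1 ^+ 2 + dot c y.2 ^+ 2 = h ^+ 2 + dot c (geodesic t y).2 ^+ 2].
Proof.
have E := cos2Dsin2 t; rewrite dot_geodesic1 dot_geodesic2 => hit.
set D := _ - _ => D0.
have q : dot c y.1 ^+ 2 + dot c y.2 ^+ 2 = h ^+ 2 + D ^+ 2.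
  rewrite -hit /D; transitivity ((dot c y.1 ^+ 2 + dot c y.2 ^+ 2) * (cos t ^+ 2 + sin t ^+ 2)).
    by rewrite E mulr1.
  by ring.
have sp : hit_speed y = D by rewrite /hit_speed q addrC addKr sqrtr_sqr gtr0_norm.
have q0 : dot c y.1 ^+ 2 + dot c y.2 ^+ 2 != 0.
  by rewrite q gt_eqF // ltr_wpDl ?sqr_ge0 // exprn_gt0.
split=> //.
- rewrite /hit_cos sp; apply: (mulIf q0); rewrite mulfVK //.
  rewrite -hit /D; transitivity ((dot c y.1 ^+ 2 + dot c y.2 ^+ 2) * cos t); ring.
- rewrite /hit_sin sp; apply: (mulIf q0); rewrite mulfVK //.
  rewrite -hit /D; transitivity ((dot c y.1 ^+ 2 + dot c y.2 ^+ 2) * sin t); ring.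
Qed.

Lemma scatter_at y t : unit_tangent y -> dot c (geodesic t y).1 = h ->
  0 < dot c (geodesic t y).2 -> scatter y =
  geodesic (- t) ((geodesic t y).1, bounce c (geodesic t y).1 (geodesic t y).2).
Proof.
move=> yu hit D0; have [sp hc hs _] := hit_at hit D0.
have [gs gv _] := geodesic_unit t yu.
have E := cos2Dsin2 t.
have bE : bounce c (geodesic t y).1 (geodesic t y).2 = (geodesic t y).2
    - hit_jump y *: (c - h *: (geodesic t y).1).
  rewrite /bounce /Defs.reflect /normal hit.
  have nn : dot (c - h *: (geodesic t y).1) (c - h *: (geodesic t y).1) = 1 - h ^+ 2.
    move: (geodesic t y) gs hit => [q p] /= gs hit.
    by rewrite /sphere /= in gs; rewrite !dotlin cc gs (dotC q c) hit; ring.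
  have vn : dot (geodesic t y).2 (c - h *: (geodesic t y).1) = dot c (geodesic t y).2.
    move: (geodesic t y) gv => [q p] /= gv.
    by rewrite !dotlin (dotC p q) gv (dotC p c); ring.
  by rewrite nn vn /hit_jump sp.
rewrite bE /scatter /hit_point hc hs; move: (hit_jump y) => k.
have g1 : geodesic (- t) (geodesic t y) = y by rewrite geodesicK.
have -> : cos t *: y.1 + sin t *: y.2 = (geodesic t y).1 by [].
rewrite -{1 3}g1; move: (geodesic t y) => [q p]; rewrite /geodesic /= cosN sinN.
by congr pair; apply: row3P; rewrite !mxE; ring.
Qed.

(** The entrance time decreases by [s] while the collision itself is unchanged. The proof is
    algebraic and holds also where the geodesic misses the disk. *)
Lemma scatter_geodesic s y : scatter (geodesic s y) = geodesic s (scatter y).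
Proof.
have E := cos2Dsin2 s.
have qE : dot c (geodesic s y).1 ^+ 2 + dot c (geodesic s y).2 ^+ 2 =
    dot c y.1 ^+ 2 + dot c y.2 ^+ 2.
  rewrite dot_geodesic1 dot_geodesic2.
  transitivity ((dot c y.1 ^+ 2 + dot c y.2 ^+ 2) * (cos s ^+ 2 + sin s ^+ 2)); first by ring.
  by rewrite E mulr1.
have sE : hit_speed (geodesic s y) = hit_speed y by rewrite /hit_speed qE.
have cE : hit_cos (geodesic s y) = hit_cos y * cos s + hit_sin y * sin s.
  by rewrite /hit_cos /hit_sin qE sE dot_geodesic1 dot_geodesic2; ring.
have siE : hit_sin (geodesic s y) = hit_sin y * cos s - hit_cos y * sin s.
  by rewrite /hit_cos /hit_sin qE sE dot_geodesic1 dot_geodesic2; ring.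
have pE : hit_point (geodesic s y) = hit_point y.
  rewrite /hit_point cE siE /geodesic /=; move: (hit_cos y) (hit_sin y) => C S.
  transitivity ((cos s ^+ 2 + sin s ^+ 2) *: (C *: y.1 + S *: y.2)); last by rewrite E scale1r.
  by apply: row3P; rewrite !mxE; ring.
rewrite /scatter pE cE siE /hit_jump sE.
move: (hit_cos y) (hit_sin y) (hit_point y) (_ / _) => C S q k.
by rewrite /geodesic /=; congr pair; apply: row3P; rewrite !mxE; ring.
Qed.

(** The Rodrigues formula: rotation by the angle [e] about the unit axis [c]. *)
Definition rotate (e : R) u : V :=
  cos e *: u + sin e *: cross c u + ((1 - cos e) * dot c u) *: c.

Lemma dot_rotate e u : dot c (rotate e u) = dot c u.
Proof. by rewrite /rotate !dotlin dot_cross_l cc; ring. Qed.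

Lemma scatter_rotate e y :
  scatter (rotate e y.1, rotate e y.2) =
  (rotate e (scatter y).1, rotate e (scatter y).2).
Proof.
pose y' : VV := (rotate e y.1, rotate e y.2).
have sE : hit_speed y' = hit_speed y by rewrite /hit_speed /= !dot_rotate.
have cE : hit_cos y' = hit_cos y by rewrite /hit_cos sE /= !dot_rotate.
have siE : hit_sin y' = hit_sin y by rewrite /hit_sin sE /= !dot_rotate.
rewrite -/y' /scatter /hit_point /hit_jump cE siE sE /=.
move: (hit_cos y) (hit_sin y) (_ / (1 - h ^+ 2)) => C S k.
have rl a u v : rotate e (u + a *: v) = rotate e u + a *: rotate e v.
  rewrite /rotate !dotlin crossDr crossZr; apply: row3P; rewrite !mxE; ring.
have rc : rotate e c = c.
  by rewrite /rotate cc crossvv; apply: row3P; rewrite !mxE; ring.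
have rl2 a a' u v : rotate e (a *: u + a' *: v) = a *: rotate e u + a' *: rotate e v.
  rewrite rl; congr (_ + _); rewrite -[a *: u]add0r rl.
  by rewrite [X in X + _](_ : _ = 0) ?add0r // /rotate dot0r; apply: row3P; rewrite !mxE /= ; ring.
have rq : rotate e (c - h *: (C *: y.1 + S *: y.2)) =
    c - h *: (C *: rotate e y.1 + S *: rotate e y.2).
  by rewrite -scaleNr rl rc rl2 scaleNr.
have rlB a u v : rotate e (u - a *: v) = rotate e u - a *: rotate e v.
  by rewrite -scaleNr rl scaleNr.
by rewrite rl rq rlB rq.
Qed.

Lemma scatter_differentiable y t : dot c (geodesic t y).1 = h ->
  0 < dot c (geodesic t y).2 -> differentiable scatter y.
Proof.
move=> hit D0; have [sp _ _ q] := hit_at hit D0.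
have dA := dot1_differentiable c y; have dB := dot2_differentiable c y.
have q0 : dot c y.1 ^+ 2 + dot c y.2 ^+ 2 != 0.
  by rewrite q gt_eqF // ltr_wpDl ?sqr_ge0 // exprn_gt0.
have dQ : differentiable (fun y : VV => dot c y.1 ^+ 2 + dot c y.2 ^+ 2) y.
  have -> : (fun y : VV => dot c y.1 ^+ 2 + dot c y.2 ^+ 2) =
      fun y => dot c y.1 * dot c y.1 + dot c y.2 * dot c y.2 by [].
  by apply: differentiableD; apply: differentiableM.
have dD : differentiable hit_speed y.
  apply: (@sqrt_differentiable _ (fun y => dot c y.1 ^+ 2 + dot c y.2 ^+ 2 - h ^+ 2)).
    by apply: differentiableB.
  by rewrite q addrC addKr exprn_gt0.
have dV : differentiable (fun y : VV => (dot c y.1 ^+ 2 + dot c y.2 ^+ 2)^-1) y.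
  exact: (differentiableV dQ).
have dC : differentiable hit_cos y.
  apply: differentiableM => //; apply: differentiableD; apply: differentiableM => //.
have dS : differentiable hit_sin y.
  apply: differentiableM => //; apply: differentiableB; apply: differentiableM => //.
have dk : differentiable hit_jump y.
  by apply: differentiableM => //; apply: differentiableM.
(* These maps move one component of a pair into a given slot, so that [scatter] is a combination of
   scalar functions and linear maps. *)
have [L1 L1E] : exists L : 'End(VV), forall w, L w = (w.1, 0).
  apply: linear_End => a u v; rewrite /=; congr pair => //=.
  by rewrite scaler0 addr0.
have [L2 L2E] : exists L : 'End(VV), forall w, L w = (w.2, 0).
  apply: linear_End => a u v; rewrite /=; congr pair => //=.
  by rewrite scaler0 addr0.
have [L3 L3E] : exists L : 'End(VV), forall w, L w = (0, w.1).
  apply: linear_End => a u v; rewrite /=; congr pair => //=.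
  by rewrite scaler0 addr0.
pose N y : VV := (c, 0) - h *: (hit_cos y *: L1 y + hit_sin y *: L2 y).
have dN : differentiable N y.
  apply: differentiableB => //; apply: differentiableZ; apply: differentiableD;
    apply: scale_differentiable => //; exact: End_differentiable.
have -> : scatter = fun y => (y + (hit_jump y * hit_sin y) *: N y)
    - (hit_jump y * hit_cos y) *: L3 (N y).
  apply/funext => w; rewrite /scatter /hit_point L3E /N !L1E !L2E.
  rewrite [RHS]surjective_pairing /=; congr pair.
    by rewrite scaler0 subr0.
  by rewrite !(scaler0, addr0, subr0).
apply: differentiableB; first apply: differentiableD => //.
  by apply: scale_differentiable => //; apply: differentiableM.
apply: scale_differentiable; first by apply: differentiableM.
exact: (differentiable_comp dN (End_differentiable _ _)).
Qed.

(** A contact vector: [X] is the displacement orthogonal to the trajectory and [P] its covariant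
    derivative along it. *)
Definition frame z (X P : R) : VV :=
  (X *: cross z.1 z.2, P *: cross z.1 z.2).

Definition flow_dir z : VV := (z.2, - z.1).

Lemma geodesic_linear s (a : R) w w' :
  geodesic s (a *: w + w') = a *: geodesic s w + geodesic s w'.
Proof. by rewrite /geodesic /=; congr pair; apply: row3P; rewrite !mxE; ring. Qed.

Lemma geodesicDr s w w' : geodesic s (w + w') = geodesic s w + geodesic s w'.
Proof. by have := geodesic_linear s 1 w w'; rewrite !scale1r. Qed.

Lemma geodesicZ s a w : geodesic s (a *: w) = a *: geodesic s w.
Proof. by rewrite /geodesic /=; congr pair; apply: row3P; rewrite !mxE; ring. Qed.

Lemma flow_dir_geodesic s z : flow_dir (geodesic s z) = geodesic s (flow_dir z).
Proof. by rewrite /geodesic /flow_dir /=; congr pair; apply: row3P; rewrite !mxE; ring. Qed.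

Lemma frame_geodesic s z X P : frame (geodesic s z) X P = frame z X P.
Proof. by rewrite /frame geodesic_cross. Qed.

Lemma geodesic_frame s z X P :
  geodesic s (frame z X P) = frame z (X * cos s + P * sin s) (P * cos s - X * sin s).
Proof. by rewrite /geodesic /frame /=; congr pair; apply: row3P; rewrite !mxE; ring. Qed.

Lemma geodesic_trig s z : geodesic s z = trig 0 z (flow_dir z) s.
Proof.
by rewrite /trig /geodesic; congr pair; apply: row3P; rewrite !mxE /=; ring.
Qed.

(** An infinitesimal rotation of the sphere, split into its part along the flow and its contact
    part. *)
Lemma cross_frame z u : unit_tangent z -> (cross u z.1, cross u z.2) =
  dot u (cross z.1 z.2) *: flow_dir z + frame z (- dot u z.2) (dot u z.1).
Proof.
move=> zu; have [zs zv vv] := zu; rewrite /sphere /= in zs.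
have e := frame_expansion u zu.
set n := cross z.1 z.2 in e *.
have n1 : cross n z.1 = z.2.
  by rewrite /n cross_anti cross_cross_l zv zs scale0r sub0r scale1r opprK.
have n2 : cross n z.2 = - z.1.
  by rewrite /n (cross_anti z.1) crossNl cross_anti opprK cross_cross_l (dotC z.2) zv vv
    scale0r sub0r scale1r.
rewrite /frame /flow_dir -/n; congr pair => /=.
  rewrite {1}e !(crossDl, crossZl) crossvv n1 (cross_anti z.2) -/n.
  by apply: row3P; rewrite !mxE; ring.
rewrite {1}e !(crossDl, crossZl) crossvv n2 -/n.
by apply: row3P; rewrite !mxE; ring.
Qed.

Lemma rotate_trig y :
  (fun e => (rotate e y.1, rotate e y.2)) = trig (dot c y.1 *: c, dot c y.2 *: c)
    (y.1 - dot c y.1 *: c, y.2 - dot c y.2 *: c) (cross c y.1, cross c y.2).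
Proof.
by apply/funext => e; rewrite /trig /rotate; congr pair; apply: row3P; rewrite !mxE /=; ring.
Qed.

(* Differentiate along three curves on which [scatter] is explicit: the geodesic,
   a rotation about [c], and a rotation of the velocity at the collision point. *)
Lemma scatter_diff y t : unit_tangent y -> dot c (geodesic t y).1 = h ->
  0 < dot c (geodesic t y).2 ->
  exists2 L : 'End(VV), is_diff_within setT scatter y L &
    L (flow_dir y) = flow_dir (scatter y) /\
    forall X P, L (geodesic (- t) (frame y X P)) =
      - geodesic (- t) (frame (scatter y) X (P + 2 * h / dot c (geodesic t y).2 * X)).
Proof.
move=> yu hit D0; have [L dL] := differentiable_is_diff setT (scatter_differentiable hit D0).
exists L => //; have yT := geodesic_unit t yu; have ySE := scatter_at yu hit D0.
case qpE : (geodesic t y) hit D0 yT ySE => [q p] /= hit D0 yT ySE.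
set y' := scatter y in ySE *; set D := dot c p in D0 *.
set p' := bounce c q p in ySE.
have [/= qs qp pp] := yT.
have h2 := h2_bound; have h2' : 1 - h ^+ 2 != 0 by rewrite gt_eqF.
have [N NE0] : exists N, N = c - h *: q by eexists.
have nn : dot N N = 1 - h ^+ 2.
  by rewrite NE0; rewrite /sphere /= in qs; rewrite !dotlin cc qs (dotC q c) hit; ring.
have vN v : dot v q = 0 -> dot v N = dot c v.
  by move=> vq; rewrite NE0 !dotlin vq (dotC v c); ring.
have bE v : dot v q = 0 -> bounce c q v = v - (2 * dot c v / (1 - h ^+ 2)) *: N.
  by move=> vq; rewrite /bounce /Defs.reflect /normal hit -NE0 nn vN.
have pq : dot p q = 0 by rewrite dotC.
have p'E : p' = p - (2 * D / (1 - h ^+ 2)) *: N by rewrite /p' bE.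
have cN : dot c N = 1 - h ^+ 2 by rewrite NE0 !dotlin cc hit; ring.
have cp' : dot c p' = - D.
  by rewrite p'E dotDr dotNr dotZr cN -/D; field.
have y'T : unit_tangent (q, p').
  split=> //=.
    have qN : dot q N = 0 by rewrite NE0 !dotlin (dotC q c) hit; rewrite /sphere /= in qs; rewrite qs; ring.
    by rewrite p'E dotDr dotNr dotZr qN qp; ring.
  by rewrite p'E !dotlin nn (dotC N p) (vN p pq) pp -/D; field.
have y'qp : geodesic t y' = (q, p') by rewrite ySE geodesicNK.
set n := cross q p; set n' := cross q p'.
have m'E : dot c n' = dot c n.
  rewrite /n' p'E crossDr crossNr crossZr NE0 crossDr crossNr crossZr crossvv scaler0 subr0.
  rewrite !dotlin (cross_anti q c) dotNr dot_cross_l; ring.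
(* The reflection reverses the orientation of the tangent plane. This is the origin of the sign that
   each collision contributes to the differential. *)
have n'E : bounce c q n = - n'.
  have nq : dot n q = 0 by rewrite dotC dot_cross_l.
  rewrite bE // /n' p'E crossDr crossNr crossZr -/n.
  have -> : cross q N = cross q c.
    by rewrite NE0 crossDr crossNr crossZr crossvv scaler0 subr0.
  have ce := frame_expansion c yT; rewrite /= hit -/n -/D in ce.
  have nnE : dot n n = 1 by rewrite dot_cross_cross qs pp qp; ring.
  have pars : 1 = h ^+ 2 + D ^+ 2 + dot c n ^+ 2 by rewrite -cc (parseval c yT) /= hit.
  have qc : cross q c = D *: n - dot c n *: p.
    rewrite {1}ce !(crossDr, crossZr) crossvv scaler0 add0r -/n /n cross_cross_l qp.
    rewrite (_ : dot q q = 1) // scale0r sub0r scale1r -/n scalerN //.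
  have NE : N = D *: p + dot c n *: n by rewrite NE0 {1}ce; apply: row3P; rewrite !mxE; ring.
  have -> : 1 - h ^+ 2 = D ^+ 2 + dot c n ^+ 2 by rewrite {1}pars; ring.
  rewrite qc NE; apply: row3P; rewrite !mxE; field;
    by rewrite -(_ : 1 - h ^+ 2 = D ^+ 2 + dot c n ^+ 2) //; rewrite {1}pars; ring.
have dir1 : L (flow_dir y) = flow_dir y'.
  apply: (diff_along (K0 := 0) (K1 := y) (K0' := 0) (K1' := y') dL).
  - by rewrite add0r.
  - by near=> s.
  - by near=> s; rewrite -!geodesic_trig scatter_geodesic.
have dir2 : L (cross c y.1, cross c y.2) = (cross c y'.1, cross c y'.2).
  apply: (diff_along (K0 := (dot c y.1 *: c, dot c y.2 *: c))
    (K1 := (y.1 - dot c y.1 *: c, y.2 - dot c y.2 *: c))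
    (K0' := (dot c y'.1 *: c, dot c y'.2 *: c))
    (K1' := (y'.1 - dot c y'.1 *: c, y'.2 - dot c y'.2 *: c)) dL).
  - by rewrite [LHS]surjective_pairing; congr pair => /=; rewrite addrC subrK.
  - by near=> s.
  - by near=> s; rewrite -!rotate_trig scatter_rotate.
(* Rotating the velocity about the collision point changes neither this point nor its time, and the
   reflection is linear in the velocity. *)
have dir3 : L (geodesic (- t) (0, n)) = geodesic (- t) (0, - n').
  have lim : dot c p * cos s + dot c n * sin s @[s --> (0 : R)] --> dot c p * cos 0 + dot c n * sin 0.
    apply: cvgD; apply: cvgM; [exact: cvg_cst|exact: continuous_cos|exact: cvg_cst|exact: continuous_sin].
  have npos : \forall s \near (0 : R), 0 < dot c p * cos s + dot c n * sin s.
    by apply: (cvgr_gt _ lim); rewrite cos0 sin0 mulr1 mulr0 addr0.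
  apply: (diff_along (K0 := geodesic (- t) (q, 0)) (K1 := geodesic (- t) (0, p))
    (K0' := geodesic (- t) (q, 0)) (K1' := geodesic (- t) (0, p')) dL).
  - rewrite -geodesicDr -[LHS](geodesicK t) qpE; congr geodesic; congr pair => /=.
      by rewrite addr0.
    by rewrite add0r.
  - by near=> s.
  near=> s; rewrite /trig -!geodesicZ -!geodesicDr.
  pose v := cos s *: p + sin s *: n.
  have -> : (q, 0) + cos s *: ((0, p) : VV) + sin s *: ((0, n) : VV) = (q, v).
    by congr pair => /=; rewrite ?scaler0 ?addr0 // add0r.
  have vu : unit_tangent (q, v).
    have E := cos2Dsin2 s.
    have nq : dot q n = 0 by exact: dot_cross_l.
    have pn : dot p n = 0 by exact: dot_cross_r.
    have nnE : dot n n = 1 by rewrite dot_cross_cross qs pp qp; ring.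
    move: (n) nq pn nnE @v => n0 nq pn nnE v.
    split=> //=; rewrite /v !dotlin ?qp ?nq ?pp ?(dotC n0 p) ?pn ?nnE; lra.
  have vq : dot v q = 0 by case: vu => _ /= + _; rewrite dotC.
  rewrite (scatter_at (t := t)).
  - rewrite geodesicNK /=; congr geodesic; congr pair => /=; rewrite ?scaler0 ?addr0 // add0r.
    rewrite -n'E /p' /v !bE ?dotlin ?pq; last by rewrite dotC dot_cross_l; ring.
    + by apply: row3P; rewrite !mxE; ring.
    + by rewrite dotC dot_cross_l.
    + by [].
  - exact: geodesic_unit.
  - by rewrite geodesicNK.
  - by rewrite geodesicNK /= /v !dotlin mulrC (mulrC (sin s)); near: s.
split=> // X P.
have F01 : L (geodesic (- t) (frame y 0 1)) = - geodesic (- t) (frame y' 0 1).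
  have fE : frame y 0 1 = (0, n).
    by rewrite -(frame_geodesic t) qpE /frame /= scale0r scale1r.
  have fE' : frame y' 0 1 = (0, n').
    by rewrite -(frame_geodesic t) y'qp /frame /= scale0r scale1r.
  rewrite fE fE' dir3 -[in RHS]scaleN1r -geodesicZ; congr geodesic; congr pair => /=.
    by rewrite scaler0.
  by rewrite scaleN1r.
have geoN z : geodesic t (cross c z.1, cross c z.2) =
    (cross c (geodesic t z).1, cross c (geodesic t z).2).
  by rewrite /geodesic /= !(crossDr, crossZr, crossNr).
(* The contact part of the rotation about [c] has coordinates [(- D, h)] before the collision and
   [(D, h)] after it, since the normal speed changes sign. *)
have F2 : L (geodesic (- t) (frame y (- D) h)) = geodesic (- t) (frame y' D h).
  have E z q0 p0 : geodesic t z = (q0, p0) -> unit_tangent (q0, p0) ->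
     geodesic (- t) (frame z (- dot c p0) (dot c q0)) =
     (cross c z.1, cross c z.2) - dot c (cross q0 p0) *: flow_dir z.
    move=> zE zu; rewrite -[RHS](geodesicK t); congr geodesic.
    have cf := cross_frame c zu; rewrite /= in cf.
    rewrite -scaleNr addrC geodesic_linear geoN zE /= cf -flow_dir_geodesic zE.
    by rewrite scaleNr addrA addNr add0r -(frame_geodesic t) zE.
  have e1 := E y q p qpE yT; rewrite hit -/D in e1.
  have e2 := E y' q p' y'qp y'T; rewrite cp' hit opprK -/n' m'E in e2.
  by rewrite e1 e2 linearB /= linearZ /= dir1 dir2.
have fr z a b a' b' k k' : k *: frame z a b + k' *: frame z a' b' =
    frame z (k * a + k' * a') (k * b + k' * b').
  by rewrite /frame /=; congr pair; apply: row3P; rewrite !mxE; ring.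
have D0' : D != 0 by rewrite gt_eqF.
(* The two directions just computed form a basis. Each contributes [h * X / D] to the image, hence
   the shear of rate [2 * h / D]. *)
have -> : frame y X P = (- (X / D)) *: frame y (- D) h + (P + h * X / D) *: frame y 0 1.
  by rewrite fr; congr frame; field.
have LZ (k : R) w : L (k *: w) = k *: L w by exact: linearZ.
rewrite geodesic_linear geodesicZ linearD /= !LZ F2 F01.
rewrite scalerN -scaleNr -!geodesicZ -geodesicDr fr -[RHS]scaleN1r -geodesicZ.
have frN k z a b : k *: frame z a b = frame z (k * a) (k * b).
  by rewrite /frame /=; congr pair; apply: row3P; rewrite !mxE; ring.
by rewrite frN; congr (geodesic _ (frame _ _ _)); field.
Unshelve. all: by end_near. Qed.

End Scattering.

(** * The flow near a collision *)

Section LocalFlow.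
Variable R : realType.
Local Notation V := 'rV[R]_3.
Local Notation VV := ('rV[R]_3 * 'rV[R]_3)%type.
Implicit Types (s t u a b d e : R) (c : V) (z y : VV) (G : R -> VV).
Variables (C : set V) (r : R).
Hypothesis r_pi : 0 < r < pi.
Hypothesis adm : admissible C (cos r).
Local Notation h := (cos r).
Local Notation open_air := (open_air C r).
Local Notation Omega := (Omega C r).

Lemma dot_bounded c : exists2 K : R, 0 < K & forall u : V, `|dot c u| <= K * `|u|.
Proof.
exists (\sum_j `|c 0 j| + 1); first by rewrite ltr_wpDl // sumr_ge0.
move=> u; apply: (@le_trans _ _ ((\sum_j `|c 0 j|) * `|u|)); last first.
  by rewrite ler_wpM2r // lerDl.
rewrite /dot mxE mulr_suml; apply: (le_trans (ler_norm_sum _ _ _)).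
apply: ler_sum => j _; rewrite mxE normrM ler_wpM2l //; exact: coord_le.
Qed.

Lemma dot_geodesic_close c : exists2 K : R, 0 < K & forall y z s,
  `|dot c (geodesic s y).1 - dot c (geodesic s z).1| <= K * `|y - z| /\
  `|dot c (geodesic s y).2 - dot c (geodesic s z).2| <= K * `|y - z|.
Proof.
have [K K0 hK] := dot_bounded c; exists (K + K); first exact: addr_gt0.
move=> y z s; have n1 := hK (y.1 - z.1); have n2 := hK (y.2 - z.2).
have m1 : `|dot c (y.1 - z.1)| <= K * `|y - z|.
  by apply: (le_trans n1); rewrite ler_wpM2l ?(ltW K0) //; exact: (pair_norm_fst (y - z)).
have m2 : `|dot c (y.2 - z.2)| <= K * `|y - z|.
  by apply: (le_trans n2); rewrite ler_wpM2l ?(ltW K0) //; exact: (pair_norm_snd (y - z)).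
have bnd (a b x x' : R) : `|a| <= 1 -> `|b| <= 1 -> `|x| <= K * `|y - z| ->
    `|x'| <= K * `|y - z| -> `|x * a + x' * b| <= (K + K) * `|y - z|.
  move=> a1 b1 hx hx'; rewrite mulrDl; apply: (le_trans (ler_normD _ _)).
  apply: lerD; rewrite normrM -[K * _]mulr1.
    exact: (ler_pM (normr_ge0 _) (normr_ge0 _) hx a1).
  exact: (ler_pM (normr_ge0 _) (normr_ge0 _) hx' b1).
split.
  rewrite !dot_geodesic1; have -> : dot c y.1 * cos s + dot c y.2 * sin s -
    (dot c z.1 * cos s + dot c z.2 * sin s) =
    dot c (y.1 - z.1) * cos s + dot c (y.2 - z.2) * sin s by rewrite !dotlin; ring.
  by apply: bnd; rewrite ?cos_max ?sin_max.
rewrite !dot_geodesic2; have -> : dot c y.2 * cos s - dot c y.1 * sin s -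
  (dot c z.2 * cos s - dot c z.1 * sin s) =
  dot c (y.2 - z.2) * cos s + dot c (y.1 - z.1) * - sin s by rewrite !dotlin; ring.
by apply: bnd; rewrite ?normrN ?cos_max ?sin_max.
Qed.

(** By compactness the maximum over [[a, b]] is below [m], and the dependence on the initial
    condition is Lipschitz uniformly in time. *)
Lemma margin c z a b m : (forall s, a <= s <= b -> dot c (geodesic s z).1 < m) ->
  \forall y \near z, forall s, a <= s <= b -> dot c (geodesic s y).1 < m.
Proof.
have [ab lt|ba _] := leP a b; last first.
  by near=> y => s /andP[s1 s2]; exfalso; lra.
have cf : {within `[a, b], continuous (fun s => dot c (geodesic s z).1)}.
  by apply: continuous_subspaceT => s; exact: cvg_dot_geodesic.
have [x hx xmax] := EVT_max ab cf; rewrite in_itv /= in hx.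
have [K K0 hK] := dot_geodesic_close c.
have e0 : 0 < (m - dot c (geodesic x z).1) / K by rewrite divr_gt0 // subr_gt0 lt.
apply/near_normP; exists ((m - dot c (geodesic x z).1) / K) => // y.
rewrite ltr_pdivlMr // => yz s hs.
have /xmax : s \in `[a, b]%R by rewrite in_itv.
have [/ler_normlP[_] + _] := hK y z s; lra.
Unshelve. all: by end_near. Qed.

Lemma margin_all (P : set V) z a b :
  (forall c, C c -> P c -> forall s, a <= s <= b -> dot c (geodesic s z).1 < h) ->
  \forall y \near z, forall c, C c -> P c -> forall s, a <= s <= b ->
    dot c (geodesic s y).1 < h.
Proof.
move=> lt; apply: (near_centers adm (FF := nbhs_filter _) (P := fun c y => P c -> forall s, a <= s <= b ->
  dot c (geodesic s y).1 < h)) => c Cc.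
have [Pc|nPc] := EM (P c); last by near=> y.
by apply: filterS (margin (lt c Cc Pc)) => y.
Unshelve. all: by end_near. Qed.

Lemma geodesic_air_near z t : open_air (geodesic t z).1 ->
  exists2 e : R, 0 < e & forall s, `|s - t| < e -> open_air (geodesic s z).1.
Proof.
by move=> op; apply/near_distP; exact: (open_air_near adm (@geodesic1_cvg _ z t) op).
Qed.

Lemma free_flow_near z t : Omega z -> 0 <= t ->
  (forall s, 0 <= s <= t -> open_air (geodesic s z).1) ->
  \forall y \near z, Omega y -> flow C r t y = geodesic t y.
Proof.
move=> Oz t0 air.
have := @margin_all setT z 0 t (fun c Cc _ s hs => air s hs c Cc).
apply: filterS => y airy Oy.
have airy' s : 0 <= s <= t -> open_air (geodesic s y).1 by move=> hs c Cc; exact: airy.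
have [e e0 he] := geodesic_air_near (airy' 0 (introT andP (conj (lexx _) t0))).
have [e' e'0 he'] := geodesic_air_near (airy' t (introT andP (conj t0 (lexx _)))).
have [tG G0] := flow_trajectory r_pi adm Oy.
refine (traj_propagate r_pi adm (a := - e) (b := t + e') (m := 0) tG _ _ _ _).
- move=> s /andP[s1 s2]; have [s0|s0] := ltP s 0.
    by apply: he; rewrite subr0 ltr0_norm //; lra.
  have [st|st] := leP s t; first by apply: airy'; rewrite s0.
  by apply: he'; rewrite gtr0_norm; lra.
- by apply/andP; split; lra.
- by rewrite geodesic0.
- by apply/andP; split; lra.
Qed.

Lemma traj_bounce G y a t c : trajectory C r G -> a < t ->
  (forall s, a < s < t -> G s = geodesic s y) -> C c ->
  dot c (geodesic t y).1 = h ->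
  exists2 e : R, 0 < e & forall s, t < s < t + e -> G s =
    geodesic (s - t) ((geodesic t y).1, bounce c (geodesic t y).1 (geodesic t y).2).
Proof.
move=> tG at_ Gy Cc hit.
have qE : (G t).1 = (geodesic t y).1.
  apply: (@cvg_unique _ (@norm_hausdorff _ _) ((G s).1 @[s --> t^'-])).
    by apply: cvg_within_filter; exact: (traj_cont tG (x := t)).
  apply: cvg_left_eq (@geodesic1_cvg _ y t).
  exists (t - a); first by rewrite subr_gt0.
  by move=> s /andP[s1 s2]; rewrite Gy //; apply/andP; split; lra.
rewrite -qE in hit.
have [e e0 [v [vu Gt Gl Gr _]]] := crossing r_pi adm tG Cc hit.
exists e => // s hs; rewrite Gr //; congr geodesic.
rewrite [LHS]surjective_pairing Gt qE.
suff -> : v = (geodesic t y).2 by [].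
pose u := t - Order.min e (t - a) / 2.
have ta : 0 < t - a by rewrite subr_gt0.
have m0 : 0 < Order.min e (t - a) by rewrite lt_min e0.
have me := ge_min e e (t - a); have md := ge_min (t - a) e (t - a).
rewrite !lexx /= orbT in me md.
have u1 : t - e < u < t by apply/andP; split; rewrite /u; lra.
have u2 : a < u < t by apply/andP; split; rewrite /u; lra.
have := Gl u u1; rewrite Gy // => E.
have := congr1 (geodesic (t - u)) E; rewrite -!geodesicD.
have -> : t - u + u = t by ring.
by have -> : t - u + (u - t) = 0 by [ring]; rewrite geodesic0 => ->.
Qed.

Lemma before_hit c y t s : dot c (geodesic t y).1 = h -> 0 < dot c (geodesic t y).2 ->
  t - pi < s < t -> dot c (geodesic s y).1 < h.
Proof.
move=> hit D0 /andP[s1 s2]; have [h0 _] := h_bounds adm.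
have hu : 0 < t - s < pi by apply/andP; split; lra.
have s0 := sin_gt0_pi hu; have c1 := cos_lt1 hu.
have -> : geodesic s y = geodesic (- (t - s)) (geodesic t y).
  by rewrite -geodesicD; congr geodesic; ring.
rewrite dot_geodesic1 hit cosN sinN.
by move: (dot c _) (cos _) (sin _) D0 c1 s0 => D k l D0 k1 l0; nra.
Qed.

Lemma after_hit c y t s : C c -> unit_tangent y -> dot c (geodesic t y).1 = h ->
  0 < dot c (geodesic t y).2 -> t < s < t + pi ->
  dot c (geodesic s (scatter c h y)).1 < h.
Proof.
move=> Cc yu hit D0 /andP[s1 s2].
have cc := adm_unit adm Cc.
rewrite (scatter_at cc yu hit D0) -geodesicD.
have [gs gv _] := geodesic_unit t yu.
have [_ rc _ _] := bounce_props adm cc gs hit (etrans (dotC _ _) gv).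
have hu : 0 < s - t < pi by apply/andP; split; lra.
have s0 := sin_gt0_pi hu; have c1 := cos_lt1 hu.
have [h0 _] := h_bounds adm.
rewrite dot_geodesic1 /= hit rc.
by move: (dot c _) (cos _) (sin _) D0 c1 s0 => D k l D0 k1 l0; nra.
Qed.

(** A transversal entrance has the level below [h] before it and above [h] after it. Both survive a
    perturbation, and the intermediate value theorem provides the new hitting time. *)
Lemma hit_time c z t e : dot c (geodesic t z).1 = h -> 0 < dot c (geodesic t z).2 ->
  0 < e -> \forall y \near z, exists s, [/\ t - e < s < t + e,
    dot c (geodesic s y).1 = h & 0 < dot c (geodesic s y).2].
Proof.
move=> hit D0 e0.
have cD : dot c (geodesic s z).2 @[s --> t] --> dot c (geodesic t z).2.
  by apply: cvg_dot; exact: geodesic2_cvg.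
have /near_distP[e1 e10 he1] : \forall s \near t, dot c (geodesic t z).2 / 2 < dot c (geodesic s z).2.
  by apply: (cvgr_gt _ cD); lra.
have /rnear_distP[e2 e20 he2] := sweep_increases h D0.
have pp := @pi_gt0 R.
pose d := Order.min (Order.min e e1) (Order.min e2 pi) / 2.
have [d0 [de [de1 [de2 dp]]]] : 0 < d /\ d < e /\ d < e1 /\ d < e2 /\ d < pi.
  have m0 : 0 < Order.min (Order.min e e1) (Order.min e2 pi) by rewrite !lt_min e0 e10 e20 pp.
  have : Order.min (Order.min e e1) (Order.min e2 pi) <= Order.min (Order.min e e1) (Order.min e2 pi) by [].
  rewrite {1}le_min !le_min => /andP[/andP[x1 x2] /andP[x3 x4]].
  by rewrite /d; repeat split; lra.
have lo : dot c (geodesic (t - d) z).1 < h by apply: (before_hit hit D0); apply/andP; split; lra.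
have hi : h < dot c (geodesic (t + d) z).1.
  by rewrite addrC geodesicD dot_geodesic1 hit; apply: he2; rewrite d0 add0r.
have [K K0 hK] := dot_geodesic_close c.
pose m := Order.min (Order.min (h - dot c (geodesic (t - d) z).1) (dot c (geodesic (t + d) z).1 - h))
  (dot c (geodesic t z).2 / 2).
have m0 : 0 < m by rewrite !lt_min !subr_gt0 lo hi divr_gt0.
have [m1 [m2 m3]] : m <= h - dot c (geodesic (t - d) z).1 /\
    m <= dot c (geodesic (t + d) z).1 - h /\ m <= dot c (geodesic t z).2 / 2.
  by have : m <= m by []; rewrite {2}/m !le_min => /andP[/andP[]].
apply/near_normP; exists (m / K); first exact: divr_gt0.
move=> y; rewrite ltr_pdivlMr // => yz.
have cf : {within `[t - d, t + d], continuous (fun s => dot c (geodesic s y).1)}.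
  by apply: continuous_subspaceT => s; exact: cvg_dot_geodesic.
have ly : dot c (geodesic (t - d) y).1 < h.
  by have [/ler_normlP[_] + _] := hK y z (t - d); lra.
have hy : h < dot c (geodesic (t + d) y).1.
  by have [/ler_normlP[+ _] _] := hK y z (t + d); lra.
have tdd : t - d <= t + d by lra.
have hmm : Order.min (dot c (geodesic (t - d) y).1) (dot c (geodesic (t + d) y).1) <= h <=
    Order.max (dot c (geodesic (t - d) y).1) (dot c (geodesic (t + d) y).1).
  by rewrite ge_min le_max (ltW ly) (ltW hy) orbT.
have [s] := IVT tdd cf hmm.
rewrite in_itv /= => /andP[s1 s2] hs.
exists s; split=> //; first by apply/andP; clear - s1 s2 de; split; lra.
have ne1 : `|s - t| < e1 by rewrite ltr_norml; apply/andP; clear - s1 s2 de1; split; lra.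
have [_ /ler_normlP[+ _]] := hK y z s; have := he1 s ne1.
by clear - m3 yz; lra.
Qed.

Lemma one_collision_flow y c s0 s t t1 : Omega y -> C c ->
  s0 < 0 -> 0 < s -> s < t -> t < t1 -> s - s0 < pi -> t1 - s < pi ->
  dot c (geodesic s y).1 = h -> 0 < dot c (geodesic s y).2 ->
  (forall c', C c' -> c' <> c -> forall u, s0 < u < s ->
     dot c' (geodesic u y).1 < h) ->
  (forall c', C c' -> c' <> c -> forall u, s < u < t1 ->
     dot c' (geodesic u (scatter c h y)).1 < h) ->
  flow C r t y = geodesic t (scatter c h y).
Proof.
move=> Oy Cc s00 s0' st tt1 p1 p2 hits Ds f1 f2.
have [yu yair] := (OmegaE r_pi adm y).1 Oy.
have cc := adm_unit adm Cc.
have [tG G0] := flow_trajectory r_pi adm Oy.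
have air1 u : s0 < u < s -> open_air (geodesic u y).1.
  move=> hu c' Cc'; have [->|/eqP ne] := eqVneq c' c; last exact: f1.
  apply: (before_hit hits Ds); case/andP: hu => u1 u2; rewrite u2 andbT.
  by clear - u1 p1; lra.
have G1 : forall u, s0 < u < s -> flow C r u y = geodesic u y.
  have z0 : s0 < 0 < s by rewrite s00.
  have g0 : flow C r 0 y = geodesic 0 y by rewrite geodesic0.
  by move=> u hu; exact: (traj_propagate r_pi adm (m := 0) tG air1 z0 g0 hu).
have [e' e'0 G2] := traj_bounce tG (lt_trans s00 s0') G1 Cc hits.
have ySE := scatter_at cc yu hits Ds.
have G2' u : s < u < s + e' -> flow C r u y = geodesic u (scatter c h y).
  by move=> hu; rewrite ySE -geodesicD; exact: G2.
have air2 u : s < u < t1 -> open_air (geodesic u (scatter c h y)).1.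
  move=> hu c' Cc'; have [->|/eqP ne] := eqVneq c' c; last exact: f2.
  apply: (after_hit Cc yu hits Ds); case/andP: hu => u1 u2; rewrite u1.
  by clear - u2 p2; lra.
have [m [m1 m2 m3]] : exists m, [/\ s < m, m < s + e' & m < t1].
  exists (s + Order.min e' (t1 - s) / 2).
  have m0 : 0 < Order.min e' (t1 - s) by rewrite lt_min e'0 subr_gt0 (lt_trans st).
  have : Order.min e' (t1 - s) <= Order.min e' (t1 - s) by [].
  rewrite le_min => /andP[].
  by move: (Order.min _ _) m0 => k k0 k1 k2; split; clear - k0 k1 k2; lra.
have hm : s < m < t1 by rewrite m1.
have ht : s < t < t1 by rewrite st.
have gm : flow C r m y = geodesic m (scatter c h y) by rewrite G2' // m1.
exact: (traj_propagate r_pi adm tG air2 hm gm ht).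
Qed.

(** All nearby points hit the same disk, once, so the closed formula describes the flow on a whole
    neighbourhood and can be differentiated there. *)
Lemma one_collision z c s0 t0 t t1 : Omega z -> C c ->
  s0 < 0 -> 0 < t0 -> t0 < t -> t < t1 -> t0 - s0 < pi -> t1 - t0 < pi ->
  dot c (geodesic t0 z).1 = h -> 0 < dot c (geodesic t0 z).2 ->
  (forall c', C c' -> c' <> c -> forall s, s0 <= s <= t0 ->
     dot c' (geodesic s z).1 < h) ->
  (forall c', C c' -> c' <> c -> forall s, t0 <= s <= t1 ->
     dot c' (geodesic s (scatter c h z)).1 < h) ->
  \forall y \near z, Omega y -> flow C r t y = geodesic t (scatter c h y).
Proof.
move=> Oz Cc s00 t00 t0t tt1 p1 p2 hit D0 far1 far2.
have zu : unit_tangent z by case: Oz.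
have cc := adm_unit adm Cc.
(* The collision time of a neighbour is not exactly [t0], so the incoming geodesic must avoid the
   other disks slightly after [t0], and the outgoing one slightly before. *)
have /near_distP[e e0 he] : \forall s \near t0, forall c', C c' -> c' <> c ->
    dot c' (geodesic s z).1 < h /\ dot c' (geodesic s (scatter c h z)).1 < h.
  apply: (near_centers adm (FF := nbhs_filter _) (P := fun c' s => c' <> c -> dot c' (geodesic s z).1 < h /\
    dot c' (geodesic s (scatter c h z)).1 < h)) => c' Cc'.
  have [->|ne] := EM (c' = c); first by near=> s.
  have l1 : dot c' (geodesic t0 z).1 < h by apply: far1 => //; rewrite lexx andbT; lra.
  have l2 : dot c' (geodesic t0 (scatter c h z)).1 < h by apply: far2 => //; rewrite lexx /=; lra.
  have n1 : \forall s \near t0, dot c' (geodesic s z).1 < h.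
    exact: (cvgr_lt _ (@cvg_dot_geodesic _ c' z t0)).
  have n2 : \forall s \near t0, dot c' (geodesic s (scatter c h z)).1 < h.
    exact: (cvgr_lt _ (@cvg_dot_geodesic _ c' (scatter c h z) t0)).
  by near=> s => _; split; near: s.
pose d := Order.min (Order.min (Order.min e t0) (t - t0))
  (Order.min (pi - (t0 - s0)) (pi - (t1 - t0))) / 2.
have [d0 [de [dt0 [dtt [dp1 dp2]]]]] : 0 < d /\ d < e /\ d < t0 /\ d < t - t0 /\
    d < pi - (t0 - s0) /\ d < pi - (t1 - t0).
  set M := Order.min (Order.min (Order.min e t0) (t - t0)) _ in d *.
  have M0 : 0 < M by rewrite !lt_min e0 t00 !subr_gt0 t0t p1 p2.
  have : M <= M by [].
  rewrite {2}/M !le_min => /andP[/andP[/andP[x1 x2] x3] /andP[x4 x5]].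
  by rewrite /d; repeat split; lra.
have far1' : forall c', C c' -> c' <> c -> forall s, s0 <= s <= t0 + d ->
     dot c' (geodesic s z).1 < h.
  move=> c' Cc' ne s /andP[sa sb]; have [st|st] := leP s t0; first by apply: far1 => //; rewrite sa.
  by case: (he s _ c' Cc' ne) => //; rewrite gtr0_norm; lra.
have far2' : forall c', C c' -> c' <> c -> forall s, t0 - d <= s <= t1 ->
     dot c' (geodesic s (scatter c h z)).1 < h.
  move=> c' Cc' ne s /andP[sa sb]; have [st|st] := leP t0 s; first by apply: far2 => //; rewrite st.
  by case: (he s _ c' Cc' ne) => //; rewrite ltr0_norm; lra.
have n1 := margin_all (P := fun c' => c' <> c) far1'.
have n2 := margin_all (P := fun c' => c' <> c) far2'.
have n3 := hit_time hit D0 d0.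
have sc : scatter c h y @[y --> z] --> scatter c h z.
  exact: (differentiable_continuous (scatter_differentiable hit D0)).
have {}n2 := sc _ n2; rewrite /nbhs /= in n2.
near=> y => Oy.
have f1 : forall c', C c' -> c' <> c -> forall s, s0 <= s <= t0 + d ->
  dot c' (geodesic s y).1 < h by near: y.
have f2 : forall c', C c' -> c' <> c -> forall s, t0 - d <= s <= t1 ->
  dot c' (geodesic s (scatter c h y)).1 < h by near: y; exact: n2.
have [s [/andP[sd1 sd2] hits Ds]] : exists s, [/\ t0 - d < s < t0 + d,
    dot c (geodesic s y).1 = h & 0 < dot c (geodesic s y).2] by near: y.
clear - r_pi adm s00 t00 t0t tt1 p1 p2 d0 de dt0 dtt dp1 dp2 f1 f2 sd1 sd2 hits Ds Oy Cc.
apply: (one_collision_flow Oy Cc (s0 := s0) (s := s) (t1 := t1)) => //; try lra.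
  by move=> c' Cc' ne u /andP[u1 u2]; apply: f1 => //; apply/andP; split; lra.
by move=> c' Cc' ne u /andP[u1 u2]; apply: f2 => //; apply/andP; split; lra.
Unshelve. all: by end_near. Qed.

End LocalFlow.

(** * Products of rotations and shears *)

Section Shears.
Variable R : realType.
Implicit Types (s t a b X Q : R) (w : R * R) (n m : nat).

(* The coordinates of a contact vector in the moving frame rotate along a
   geodesic, and undergo a shear at a collision. *)
Definition swing t w : R * R := (w.1 * cos t + w.2 * sin t, w.2 * cos t - w.1 * sin t).
Definition kick b w : R * R := (w.1, w.2 + b * w.1).

Lemma swingD s t w : swing s (swing t w) = swing (s + t) w.
Proof. by rewrite /swing cosD sinD /=; congr pair; ring. Qed.

Lemma swing0 w : swing 0 w = w.
Proof. by case: w => X P; rewrite /swing cos0 sin0 /= !mulr1 !mulr0 addr0 subr0. Qed.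

Variables (tau rate : nat -> R) (k sg : R).

Fixpoint shear_orbit n w : R * R :=
  if n is n'.+1 then kick (rate n') (swing (tau n') (shear_orbit n' w)) else w.

(** The orbit is affine in the slope, along the orbit of the vertical vector [(0, 1)]; this makes
    orbits of different slopes comparable. *)
Lemma shear_orbit_shift n a w : shear_orbit n (w.1, w.2 + a) =
  ((shear_orbit n w).1 + a * (shear_orbit n (0, 1)).1,
   (shear_orbit n w).2 + a * (shear_orbit n (0, 1)).2).
Proof.
elim: n => [|n /= ->]; first by rewrite /= mulr0 addr0 mulr1.
by rewrite /kick /swing /=; congr pair; ring.
Qed.

Lemma shear_orbit_shift1 n a w : (shear_orbit n (w.1, w.2 + a)).1 =
  (shear_orbit n w).1 + a * (shear_orbit n (0, 1)).1.
Proof. by rewrite shear_orbit_shift. Qed.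

Lemma shear_orbit_shift2 n a w : (shear_orbit n (w.1, w.2 + a)).2 =
  (shear_orbit n w).2 + a * (shear_orbit n (0, 1)).2.
Proof. by rewrite shear_orbit_shift. Qed.

Lemma shear_orbit_scale n a w : shear_orbit n (a * w.1, a * w.2) =
  (a * (shear_orbit n w).1, a * (shear_orbit n w).2).
Proof. by elim: n => //= n ->; rewrite /kick /swing /=; congr pair; ring. Qed.

Hypothesis k1 : 1 < k.
Hypothesis sg0 : 0 < sg.
Hypothesis cos_tau : forall n, 0 <= cos (tau n).
Hypothesis sin_tau : forall n, sg <= sin (tau n).
Hypothesis rate_ge : forall n, 2 * k <= rate n.

Definition growth := 1 + (k - 1) * sg.

Lemma growth_gt1 : 1 < growth.
Proof. by rewrite /growth ltrDl mulr_gt0 // subr_gt0. Qed.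

Lemma growth_expr n : n%:R * (growth - 1) < growth ^+ n.
Proof.
have g1 := growth_gt1; elim: n => [|n IH]; first by rewrite mul0r expr0 ltr01.
have : 1 <= growth ^+ n by rewrite exprn_ege1 // ltW.
rewrite exprS -natr1; move: (growth ^+ n) IH => x; move: growth g1 => g g1 IH x1.
have : 0 <= (g - 1) * (x - 1) by rewrite mulr_ge0 // subr_ge0 // ltW.
lra.
Qed.

(** With nonnegative cosine and sine, [cos + sin >= 1]; the remaining [(k - 1) * sin] is at least
    [(k - 1) * sg]. *)
Lemma tau_growth n : growth <= cos (tau n) + k * sin (tau n).
Proof.
have K1 := k1; have S0 := sg0; rewrite /growth; move: (cos_tau n) (sin_tau n) (cos2Dsin2 (tau n)).
move: (cos _) (sin _) => c s c0 s1 E.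
have cs : 1 <= c + s.
  have : 1 <= (c + s) ^+ 2 by have := mulr_ge0 c0 (ltW (lt_le_trans S0 s1)); nra.
  by rewrite -[1](expr1n _ 2) ler_sqr ?nnegrE //; lra.
by have : (k - 1) * sg <= (k - 1) * s; [rewrite ler_pM2l // subr_gt0|lra].
Qed.

(* Unstable cone, in the coordinates just after a collision. *)
Definition cone w := 0 < w.1 /\ k * w.1 < w.2.
Definition opp w : R * R := (- w.1, - w.2).

(** Half of the rate restores the slope [k]; the other half pays for the term [- X * sin] of the
    rotation, which [k > 1] makes smaller than [k * Q * sin]. *)
Lemma cone_step n w : cone w -> cone (kick (rate n) (swing (tau n) w)) /\
  growth * w.1 <= (kick (rate n) (swing (tau n) w)).1.
Proof.
have K1 := k1; have S0 := sg0; case: w => X Q [/= X0 XQ]; have g := tau_growth n; have g1 := growth_gt1.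
rewrite /kick /swing /cone /=; move: (cos_tau n) (sin_tau n) (rate_ge n) g.
move: (cos _) (sin _) (rate n) growth g1 => c s b gr g1 c0 s1 b2 g.
have s0 : 0 < s by lra.
have x1 : gr * X <= X * c + Q * s.
  have : k * X * s <= Q * s by rewrite ler_pM2r // ltW.
  have : gr * X <= (c + k * s) * X by rewrite ler_pM2r.
  by lra.
have x0 : 0 < X * c + Q * s by apply: lt_le_trans x1; rewrite mulr_gt0 // (lt_trans ltr01).
split=> //; split=> //.
have : 2 * k * (X * c + Q * s) <= b * (X * c + Q * s) by rewrite ler_pM2r.
suff : 0 < Q * c - X * s + k * (X * c + Q * s) by lra.
have e1 : k * X * c <= Q * c by rewrite ler_wpM2r // ltW.
have e2 : k * (k * X * s) <= k * (Q * s) by rewrite ler_pM2l ?ler_pM2r ?(ltW XQ) //; lra.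
have e3 : 0 <= k * (X * c) by rewrite !mulr_ge0 // ?ltW //; lra.
have e4 : 0 <= k * X * c by rewrite !mulr_ge0 // ?ltW //; lra.
have e5 : 0 < X * s by rewrite mulr_gt0.
have e6 : X * s < k * (k * X * s).
  have -> : k * (k * X * s) = k * k * (X * s) by ring.
  by rewrite ltr_pMl //; nra.
lra.
Qed.

Lemma opp_step n w : kick (rate n) (swing (tau n) (opp w)) = opp (kick (rate n) (swing (tau n) w)).
Proof. by rewrite /kick /swing /opp /=; congr pair; ring. Qed.

Lemma opp_cone_step n w : cone (opp (shear_orbit n w)) -> cone (opp (shear_orbit n.+1 w)).
Proof. by move=> /(cone_step n)[+ _]; rewrite opp_step. Qed.

Lemma cone_le n m w : (n <= m)%N -> cone (shear_orbit n w) -> cone (shear_orbit m w).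
Proof.
move=> /subnK <-; elim: (m - n)%N => // d IH /IH; rewrite addSn.
by case/(cone_step (d + n)).
Qed.

Lemma opp_cone_le n m w : (n <= m)%N -> cone (opp (shear_orbit n w)) ->
  cone (opp (shear_orbit m w)).
Proof.
by move=> /subnK <-; elim: (m - n)%N => // d IH /IH; rewrite addSn; exact: opp_cone_step.
Qed.

Lemma cone_opp w : cone w -> ~ cone (opp w).
Proof. by move=> [w1 _] [/= w2 _]; lra. Qed.

(** The vertical vector is outside the cone, but its first image is inside it, with first coordinate
    [sin (tau 0) >= sg]. *)
Lemma vertical_orbit n : cone (shear_orbit n.+1 (0, 1)) /\
  sg * growth ^+ n <= (shear_orbit n.+1 (0, 1)).1.
Proof.
have K1 := k1; have S0 := sg0; elim: n => [|n [cn gn]].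
  rewrite /cone /kick /swing /= mul0r add0r mul1r mul0r subr0 mul1r expr0 mulr1.
  move: (cos_tau 0%N) (sin_tau 0%N) (rate_ge 0%N); move: (cos _) (sin _) (rate _) => c s b c0 s1 b2.
  split=> //; split; first by lra.
  have : 2 * k * s <= b * s by rewrite ler_pM2r //; lra.
  by have : 0 < k * s; [rewrite mulr_gt0; lra|lra].
have [c1 g1] := cone_step n.+1 cn; split=> //; apply: le_trans g1.
rewrite exprS mulrCA ler_wpM2l //; exact: ltW (lt_trans ltr01 growth_gt1).
Qed.

Lemma cone_shift n m a w : 0 <= a -> cone (shear_orbit n.+1 w) ->
  cone (shear_orbit n.+1 (w.1, w.2 + a)).
Proof.
move=> a0 [w1 w2]; have [[v1 v2] _] := vertical_orbit n.
have K1 := k1; rewrite /cone shear_orbit_shift1 shear_orbit_shift2; move: (shear_orbit _ w) (shear_orbit _ (0, 1)) w1 w2 v1 v2.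
move=> [X Q] [Y P] /= w1 w2 v1 v2; have := mulr_ge0 a0 (ltW v1); split; first by lra.
have : a * (k * Y) <= a * P by rewrite ler_wpM2l // ltW.
lra.
Qed.

Lemma cone_open n w : cone (shear_orbit n w) -> exists2 e : R, 0 < e &
  cone (shear_orbit n (w.1, w.2 - e)).
Proof.
move=> [w1 w2].
have K1 := k1; have E e := shear_orbit_shift n (- e) w.
move: (shear_orbit n w) (shear_orbit _ (0, 1)) w1 w2 E => [X Q] [Y P] /= w1 w2 E.
pose M := 1 + `|Y| + `|P - k * Y|.
have M1 : `|Y| < M /\ `|P - k * Y| < M.
  by have := normr_ge0 Y; have := normr_ge0 (P - k * Y); rewrite /M; lra.
have M0 : 0 < M by have := normr_ge0 Y; lra.
pose e := Order.min X (Q - k * X) / M.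
have e0 : 0 < e by rewrite divr_gt0 // lt_min w1 subr_gt0.
have [eX eQ] : e * M <= X /\ e * M <= Q - k * X.
  by rewrite /e mulfVK ?gt_eqF // !ge_min !lexx orbT.
exists e => //; rewrite E /cone /=.
have a1 : e * Y < e * M by rewrite ltr_pM2l //; apply: le_lt_trans M1.1; exact: ler_norm.
have a2 : e * (P - k * Y) < e * M by rewrite ltr_pM2l //; apply: le_lt_trans M1.2; exact: ler_norm.
by split; lra.
Qed.

Lemma opp_shear_orbit n w : opp (shear_orbit n w) = shear_orbit n (opp w).
Proof. by elim: n => //= n <-; rewrite opp_step. Qed.

(** [A] is the set of slopes that enter the cone and [B] of those that enter its opposite. They are
    disjoint and stable under small changes, and [A] is closed upwards, so its infimum belongs to
    neither. *)
Lemma stable_slope_exists : exists q, forall n,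
  ~ cone (shear_orbit n (1, q)) /\ ~ cone (opp (shear_orbit n (1, q))).
Proof.
have K1 := k1; have S0 := sg0.
pose A := [set q | exists n, cone (shear_orbit n.+1 (1, q))].
pose B := [set q | exists n, cone (opp (shear_orbit n.+1 (1, q)))].
have AB q : A q -> ~ B q.
  move=> [n cn] [m cm]; apply: (@cone_opp (shear_orbit (maxn n m).+1 (1, q))).
    by apply: cone_le cn; rewrite ltnS leq_maxl.
  by apply: opp_cone_le cm; rewrite ltnS leq_maxr.
have Aup q a : A q -> 0 <= a -> A (q + a).
  by move=> [n cn] a0; exists n; exact: (@cone_shift n 0 a (1, q) a0 cn).
have A1 : A (k + 1).
  exists 0%N; have : cone (1, k + 1) by split => /=; lra.
  by case/(cone_step 0).
(* Steep enough that the first rotation makes the first coordinate at most [cos - 2 < 0], because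
   [sin / sg >= 1]. *)
have B1 : B (- 2 / sg).
  exists 0%N; rewrite /cone /kick /swing /opp /= !mul1r.
  move: (cos_tau 0%N) (sin_tau 0%N) (rate_ge 0%N) (cos2Dsin2 (tau 0%N)).
  move: (cos _) (sin _) (rate _) => c s b c0 s1 b2 E.
  have c1 : c <= 1 by nra.
  have i0 : 0 < sg^-1 by rewrite invr_gt0.
  have s2 : 1 <= s / sg by rewrite ler_pdivlMr // mul1r.
  have -> : - 2 / sg * s = - 2 * (s / sg) by ring.
  have -> : - 2 / sg * c = - 2 * (c / sg) by ring.
  have c2 : 0 <= c / sg by rewrite mulr_ge0 // ltW.
  set x := s / sg in s2 *; set y := c / sg in c2 *.
  have n0 : 0 < - (c + - 2 * x) by lra.
  split=> //.
  have : 2 * k * - (c + - 2 * x) <= b * - (c + - 2 * x) by rewrite ler_pM2r.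
  have : 0 < k * - (c + - 2 * x) by rewrite mulr_gt0 //; lra.
  lra.
have lbA : lbound A (- 2 / sg).
  move=> q Aq; rewrite leNgt; apply/negP => lt.
  have : A (q + (- 2 / sg - q)) by apply: Aup => //; lra.
  by rewrite addrC subrK => /AB; apply.
have hA : has_inf A by split; [exists (k + 1)|exists (- 2 / sg)].
have nA : ~ A (inf A).
  move=> [n cn]; have [e e0 ce] := cone_open cn.
  have : inf A <= inf A - e by apply: ge_inf; [exists (- 2 / sg)|exists n].
  lra.
(* If [inf A] were in [B], so would be [inf A + e] for some [e > 0]; but that slope is above an
   element of [A]. *)
have nB : ~ B (inf A).
  move=> [n cn]; rewrite opp_shear_orbit in cn; have [e e0] := cone_open cn.
  have -> : ((opp (1, inf A)).1, (opp (1, inf A)).2 - e) = opp (1, inf A + e).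
    by rewrite /opp /=; congr pair; ring.
  rewrite -opp_shear_orbit => ce.
  have [q Aq lt] := inf_adherent e0 hA.
  have : A (q + (inf A + e - q)) by apply: Aup => //; lra.
  by rewrite addrC subrK => /AB; apply; exists n.
exists (inf A) => n; split=> cn; [apply: nA|apply: nB]; exists n.
  by apply: (cone_le (n := n)).
exact: opp_cone_step.
Qed.

(** The inverse step is [X = (cos + rate * sin) * X' - sin * Q']. Outside the cone [Q' <= k * X']
    for [X' > 0], and [rate >= 2 * k] leaves the coefficient [cos + k * sin]. *)
Lemma back_step n w : let w' := kick (rate n) (swing (tau n) w) in
  ~ cone w' -> ~ cone (opp w') -> growth * `|w'.1| <= `|w.1|.
Proof.
have K1 := k1; have S0 := sg0; cbv zeta; set w' := kick _ _ => nc no.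
have XE : w.1 = (cos (tau n) + sin (tau n) * rate n) * w'.1 - sin (tau n) * w'.2.
  rewrite /w' /kick /swing /=; transitivity (w.1 * (cos (tau n) ^+ 2 + sin (tau n) ^+ 2)).
    by rewrite cos2Dsin2 mulr1.
  by ring.
have main X Q : 0 < X -> ~ cone (X, Q) ->
    growth * X <= (cos (tau n) + sin (tau n) * rate n) * X - sin (tau n) * Q.
  move=> X0 nX; have QX : Q <= k * X by rewrite leNgt; apply/negP => lt; apply: nX.
  have := tau_growth n; move: (cos_tau n) (sin_tau n) (rate_ge n).
  move: (cos _) (sin _) (rate _) growth => c s b gr c0 s1 b2 g; have s0 : 0 < s by lra.
  have : gr * X <= (c + k * s) * X by rewrite ler_pM2r.
  have : s * Q <= s * (k * X) by rewrite ler_pM2l.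
  have : 2 * k * (s * X) <= b * (s * X) by rewrite ler_pM2r // mulr_gt0.
  lra.
have [X0|X0|X0] := ltgtP w'.1 0.
- have := main (- w'.1) (- w'.2); rewrite oppr_gt0 => /(_ X0 no).
  rewrite ltr0_norm // !mulrN -opprD -XE => le.
  by apply: (le_trans le); rewrite -normrN ler_norm.
- have := main w'.1 w'.2 X0; rewrite -XE gtr0_norm // => /(_ _)/le_trans; apply.
    by case: (w') nc.
  exact: ler_norm.
- by rewrite X0 normr0 mulr0.
Qed.

(** The second inequality makes the first coordinate control the whole vector, with a constant that
    does not involve the rates. *)
Lemma stable_contraction q w n : (forall n,
    ~ cone (shear_orbit n (1, q)) /\ ~ cone (opp (shear_orbit n (1, q)))) ->
  w.2 = w.1 * q ->
  growth ^+ n * `|(shear_orbit n w).1| <= `|w.1| /\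
  `|(shear_orbit n w).2| <= 2 / sg * `|(shear_orbit n w).1|.
Proof.
move=> hq wq; have K1 := k1; have S0 := sg0; pose y n := shear_orbit n (1, q).
have yE m : shear_orbit m w = (w.1 * (y m).1, w.1 * (y m).2).
  by rewrite -shear_orbit_scale /= mulr1 -wq -surjective_pairing.
have step m : growth * `|(y m.+1).1| <= `|(y m).1|.
  by have [? ?] := hq m.+1; apply: back_step.
have g0 : 0 <= growth := ltW (lt_trans ltr01 growth_gt1).
rewrite yE /= !normrM; split.
  rewrite mulrCA ler_piMr //.
  elim: n => [|n IH]; first by rewrite expr0 mul1r normr1.
  by apply: le_trans IH; rewrite exprSr -mulrA ler_wpM2l // exprn_ge0.
rewrite mulrCA ler_wpM2l //.
(* The kick leaves the first coordinate unchanged, so the next one is [X * cos + Q * sin]. Being at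
   most [|X|] in absolute value, it bounds [|Q| * sin] by [2 * |X|], whatever the rate. *)
have := step n; rewrite /y [shear_orbit n.+1 _]/= -/(y n).
move: (y n) (cos_tau n) (sin_tau n) => [X Q]; rewrite /kick /swing /=.
have := cos2Dsin2 (tau n); move: (cos _) (sin _) => c s E c0 s1 le.
have c1 : c <= 1 by nra.
have s0 : 0 < s by lra.
have t1 : `|X * c + Q * s| <= `|X|.
  by apply: le_trans le; rewrite ler_peMl // ltW // growth_gt1.
have t2 : `|X * c| <= `|X| by rewrite normrM (ger0_norm c0) ler_piMr.
have t3 : `|Q| * s <= 2 * `|X|.
  have -> : `|Q| * s = `|(X * c + Q * s) - X * c|.
    by rewrite addrC addrA addNr add0r normrM (gtr0_norm s0).
  by apply: (le_trans (ler_normB _ _)); lra.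
rewrite mulrAC ler_pdivlMr //; apply: le_trans t3; exact: ler_wpM2l.
Qed.

(** A vector differs from the stable one with the same first coordinate by a multiple [e] of
    [(0, 1)], whose orbit is unbounded unless [e = 0]. *)
Lemma bounded_stable q w : (forall n,
    ~ cone (shear_orbit n (1, q)) /\ ~ cone (opp (shear_orbit n (1, q)))) ->
  (exists K, forall n, `|(shear_orbit n w).1| <= K) -> w.2 = w.1 * q.
Proof.
move=> hq [K hK]; apply/eqP; rewrite -subr_eq0; apply: contraT => ne.
set e := w.2 - _ in ne; have e0 : 0 < `|e| by rewrite normr_gt0.
have g1 := growth_gt1; have g0 : 0 < growth := lt_trans ltr01 g1.
have K1 := k1; have S0 := sg0.
have main n : `|e| * (sg * growth ^+ n) <= K + `|w.1|.
  have wE : w = ((w.1, w.1 * q).1, (w.1, w.1 * q).2 + e).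
    by rewrite /e [LHS]surjective_pairing /=; congr pair; ring.
  have := hK n.+1; rewrite {1}wE shear_orbit_shift1.
  have [st _] := @stable_contraction q (w.1, w.1 * q) n.+1 hq erefl.
  have {}st : `|(shear_orbit n.+1 (w.1, w.1 * q)).1| <= `|w.1|.
    by apply: le_trans st; rewrite ler_peMl // exprn_ege1 // ltW.
  have [[v0 _] v1] := vertical_orbit n.
  move: (shear_orbit n.+1 (w.1, _)).1 st => X st.
  move: (shear_orbit n.+1 _).1 v0 v1 => Y v0 v1 le.
  have : `|e| * (sg * growth ^+ n) <= `|e * Y|.
    by rewrite normrM ler_pM2l // (le_trans v1) // ler_norm.
  have -> : e * Y = (X + e * Y) - X by rewrite addrC addrA addNr add0r.
  by have := ler_normB (X + e * Y) X; lra.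
have [n hn] : exists n, (K + `|w.1|) / (`|e| * sg) / (growth - 1) < n%:R.
  move: (_ / _ / _) => u; exists (Num.bound `|u|).
  by apply: le_lt_trans (ler_norm u) _; exact: archi_boundP.
have := main n; rewrite mulrA -ler_pdivlMl ?mulr_gt0 // mulrC.
rewrite ltr_pdivrMr ?subr_gt0 // in hn; move: hn.
have := growth_expr n; have : 0 < growth - 1 by rewrite subr_gt0.
lra.
Qed.

End Shears.

(** * The differential of the flow *)

Section FlowDifferential.
Variable R : realType.
Local Notation V := 'rV[R]_3.
Local Notation VV := ('rV[R]_3 * 'rV[R]_3)%type.
Implicit Types (s t u a d e : R) (c : V) (z y : VV) (w : R * R).
Implicit Types (T : int -> R) (Z : int -> VV) (cc : int -> V) (L : 'End(VV)).
Variables (C : set V) (r : R).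
Hypothesis r_pi : 0 < r < pi.
Hypothesis adm : admissible C (cos r).
Local Notation h := (cos r).
Local Notation open_air := (open_air C r).
Local Notation Omega := (Omega C r).
Local Notation itinerary := (itinerary C r).
Local Notation flow_diff t z L := (is_diff_within Omega (flow C r t) z L).

Lemma frame_swing t z w : geodesic t (frame z w.1 w.2) = frame z (swing t w).1 (swing t w).2.
Proof. by rewrite geodesic_frame. Qed.

Lemma geodesic_End t : exists L, forall y, L y = geodesic t y.
Proof. by apply: linear_End => a u v; exact: geodesic_linear. Qed.

Lemma Omega_near z : Omega z -> exists2 d : R, 0 < d & forall y, unit_tangent y ->
  `|y - z| < d -> Omega y.
Proof.
move=> /(OmegaE r_pi adm)[zu zair].
have zf : y.1 @[y --> z] --> z.1 by exact: cvg_fst.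
have : \forall y \near z, open_air y.1 by exact: (open_air_near adm zf zair).
move=> /near_normP[d d0 hd]; exists d => // y yu yz.
by apply/(OmegaE r_pi adm); split=> //; exact: hd.
Qed.

Lemma itinerary_path z T Z cc s k : itinerary z T Z cc -> T k <= s < T (k + 1) ->
  flow C r s z = geodesic (s - T k) (Z k).
Proof. by move=> [ch _ fE] hs; rewrite fE (chain_pathE adm ch hs). Qed.

Lemma itinerary_base z T Z cc : itinerary z T Z cc -> Omega z ->
  z = geodesic (- T 0) (Z 0).
Proof.
move=> it Oz; have [_ /andP[h0 h1] _] := it.
by rewrite -[LHS](flow0 r_pi adm Oz) (itinerary_path it (k := 0)) ?sub0r // (ltW h0) add0r.
Qed.

Lemma itinerary_start z T Z cc s : itinerary z T Z cc -> Omega z ->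
  T 0 <= s < T 1 -> flow C r s z = geodesic s z.
Proof.
move=> it Oz hs; rewrite (itinerary_path it (k := 0)) ?add0r //.
by rewrite [in RHS](itinerary_base it Oz) -geodesicD.
Qed.

Definition hit_rate Z cc (k : int) : R := 2 * h / - dot (cc k) (Z k).2.

Lemma flow_unit y s : Omega y -> unit_tangent (flow C r s y).
Proof. by move=> Oy; have [/traj_table/(_ s)[]] := flow_trajectory r_pi adm Oy. Qed.

Lemma flow_Omega_near z s L : Omega (flow C r s z) -> flow_diff s z L ->
  exists2 d : R, 0 < d & forall y, Omega y -> `|y - z| < d -> Omega (flow C r s y).
Proof.
move=> Os dL; have [d d0 hd] := Omega_near Os.
have [d' d'0 hd'] := is_diff_continuous dL d0; exists d'; first exact: d'0.
move=> y Oy yz.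
by apply: hd; [exact: flow_unit|exact: hd'].
Qed.

Lemma flow_diff_comp z s t L L' : Omega z -> Omega (flow C r s z) ->
  flow_diff s z L -> flow_diff t (flow C r s z) L' -> flow_diff (t + s) z (L' \o L)%VF.
Proof.
move=> Oz Os dL dL'; have near := flow_Omega_near Os dL.
apply: (is_diff_eq_near (g := flow C r t \o flow C r s)) => /=.
- by rewrite (flowD r_pi adm).
- have [d d0 hd] := near; exists d; first exact: d0.
  by move=> y Oy yz; rewrite /= (flowD r_pi adm t Oy (hd y Oy yz)).
by apply: (is_diff_within_comp (B := Omega)).
Qed.

Lemma free_diff z T Z cc t : itinerary z T Z cc -> Omega z -> 0 <= t < T 1 ->
  exists2 L, flow_diff t z L & L (flow_dir z) = flow_dir (flow C r t z) /\
    forall w, L (frame z w.1 w.2) = frame (flow C r t z) (swing t w).1 (swing t w).2.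
Proof.
move=> it Oz /andP[t0 t1]; have [ch /andP[h0 h1] fE] := it.
have fz s : 0 <= s <= t -> flow C r s z = geodesic s z.
  move=> /andP[s1 s2]; apply: (itinerary_start it Oz).
  by rewrite (le_trans (ltW h0)) //= (le_lt_trans s2).
have [L LE] := geodesic_End t; exists L.
  apply: (is_diff_eq_near (g := L)); last exact: is_diff_lin.
    by rewrite LE fz // t0 lexx.
  have : \forall y \near z, Omega y -> flow C r t y = geodesic t y.
    apply: (free_flow_near r_pi adm Oz t0) => s hs; rewrite -fz // fE.
    case/andP: hs => s1 s2; apply: (chain_path_air adm ch (k := 0)).
    by rewrite (lt_le_trans h0) //= add0r (le_lt_trans s2).
  by move=> /near_normP[d d0 hd]; exists d => // y Oy yz; rewrite LE hd.
rewrite !LE fz ?t0 ?lexx // flow_dir_geodesic; split=> // w.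
by rewrite LE frame_swing frame_geodesic.
Qed.

Lemma collision_diff z T Z cc t : itinerary z T Z cc -> Omega_tilde C r z ->
  T 1 < t < T 2 ->
  exists2 L, flow_diff t z L & L (flow_dir z) = flow_dir (flow C r t z) /\
    forall w, L (frame z w.1 w.2) =
      let w' := swing (t - T 1) (kick (hit_rate Z cc 1) (swing (T 1) w)) in
      - frame (flow C r t z) w'.1 w'.2.
Proof.
move=> it zt /andP[t1 t2]; have Oz : Omega z by case: zt.
have dn := (Omega_tildeP r_pi adm it Oz).1 zt 1.
have [ch /andP[h0 h1] fE] := it; have zu : unit_tangent z by case: Oz.
have pp := @pi_gt0 R.
have fl := ch_flight ch 0; rewrite add0r in fl.
have zT : geodesic (T 1 - T 0) (Z 0) = geodesic (T 1) z.
  by rewrite [in RHS](itinerary_base it Oz) -geodesicD.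
have o1 := ch_out ch 1; have Cc := out_center o1; have c1 := adm_unit adm Cc.
have hit := fl_hit fl; rewrite zT in hit.
have Z1 := fl_end fl; rewrite zT in Z1.
have [gs gv _] := geodesic_unit (T 1) zu.
have [_ rc _ _] := bounce_props adm c1 gs hit (etrans (dotC _ _) gv).
have DE : dot (cc 1) (geodesic (T 1) z).2 = - dot (cc 1) (Z 1).2 by rewrite Z1 /= rc opprK.
have D0 : 0 < dot (cc 1) (geodesic (T 1) z).2 by rewrite DE oppr_gt0.
have scE : scatter (cc 1) h z = geodesic (- T 1) (Z 1) by rewrite (scatter_at c1 zu hit D0) -Z1.
have fzE : flow C r t z = geodesic t (scatter (cc 1) h z).
  by rewrite (itinerary_path it (k := 1)) ?(ltW t1) // scE -geodesicD.
have h01 : 0 < h < 1 by rewrite (adm_pos adm) (adm_lt1 adm).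
have [L1 dL1 [L1f L1E]] := scatter_diff c1 h01 zu hit D0.
have [L2 L2E] := geodesic_End t.
have [g0 g1] : T 1 - T 0 <= pi / 2 /\ T 2 - T 1 <= pi / 2.
  by split; [case/andP: (fl_time fl)|case/andP: (fl_time (ch_flight ch 1))].
(* The times [T 0 / 2] and [(t + T 2) / 2] lie inside the two flights and leave room for neighbours.
   Flights of length at most [pi / 2] keep both windows shorter than [pi]. *)
have loc : \forall y \near z, Omega y -> flow C r t y = geodesic t (scatter (cc 1) h y).
  apply: (@one_collision _ C r r_pi adm z (cc 1) (T 0 / 2) (T 1) t ((t + T 2) / 2)) => //;
    try by clear - h0 h1 t1 t2 g0 g1 pp; lra.
    move=> c' Cc' ne s /andP[s1 s2].
    have [E|ne1] := eqVneq s (T 1); last first.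
      have hs : T 0 < s < T 1.
        by rewrite [s < _]lt_neqAle ne1 s2 andbT; clear - s1 h0; lra.
      rewrite -(itinerary_start it Oz) ?fE; last by case/andP: hs => /ltW -> ->.
      by apply: (chain_path_air adm ch (k := 0)) => //; rewrite add0r.
    by have := outgoing_far adm o1 Cc' (introN eqP ne); rewrite {1}Z1 /= -E.
  move=> c' Cc' ne s /andP[s1 s2]; rewrite scE -geodesicD.
  have [E|ne1] := eqVneq s (T 1); last first.
    apply: (chain_air ch (k := 1)) => //; rewrite lt_neqAle eq_sym ne1 s1.
    by clear - s2 t2; lra.
  by rewrite E subrr geodesic0; apply: (outgoing_far adm o1 Cc'); apply/eqP.
exists (L2 \o L1)%VF.
  apply: (is_diff_eq_near (g := L2 \o scatter (cc 1) h)) => /=.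
  - by rewrite L2E fzE.
  - by case/near_normP: loc => d d0 hd; exists d; [exact: d0|]; move=> y Oy yz; rewrite /= L2E; exact: (hd y yz Oy).
  apply: (is_diff_within_comp (B := setT)); last by exists 1.
    apply/is_diffP => e e0; have [d d0 hd] := (is_diffP _ _ _ _).1 dL1 e e0.
    by exists d => // y _; exact: hd.
  exact: is_diff_lin.
rewrite !comp_lfunE L1f !L2E fzE flow_dir_geodesic; split=> // w; rewrite comp_lfunE.
have -> : frame z w.1 w.2 = geodesic (- T 1) (frame z (swing (T 1) w).1 (swing (T 1) w).2).
  by rewrite -frame_swing geodesicK.
rewrite L1E linearN /= L2E -geodesicD frame_geodesic.
by rewrite DE (frame_swing _ _ (kick (hit_rate Z cc 1) (swing (T 1) w))).
Qed.

(* The vectors [collision_orbit n w] are the coordinates just after the collisions, those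
   of the initial vector being transported back to the last collision. *)
Definition collision_orbit T Z cc n w := shear_orbit (fun j => T j.+1 - T j)
  (fun j => hit_rate Z cc j.+1) n (swing (T 0) w).

(** Induction on the number of collisions: the orbit is cut at an instant of the flight before the
    last collision, and the one-collision differential is applied to the shifted itinerary. The sign
    records the orientation reversals. *)
Lemma flow_diff_orbit z T Z cc (n : nat) t : itinerary z T Z cc -> Omega_tilde C r z ->
  0 <= t -> T n < t < T (n%:Z + 1) ->
  exists2 L, flow_diff t z L & L (flow_dir z) = flow_dir (flow C r t z) /\
    forall w, L (frame z w.1 w.2) =
      let w' := swing (t - T n) (collision_orbit T Z cc n w) in
      (-1) ^+ n *: frame (flow C r t z) w'.1 w'.2.
Proof.
move=> it zt; have Oz : Omega z by case: zt.
have [ch /andP[h0 h1] fE] := it.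
elim: n t => [|n IH] t t0 /andP[t1 t2].
  have t01 : 0 <= t < T 1 by rewrite t0.
  have [L dL [Lf LE]] := free_diff it Oz t01; exists L => //; split=> // w.
  rewrite LE; cbv zeta; rewrite scale1r /collision_orbit [shear_orbit _ _ _ _]/= swingD.
  by have -> : t - T 0%N + T 0 = t by rewrite subrK.
have nE : n%:Z + 1 = n.+1%:Z by rewrite -addn1 PoszD.
(* For [n = 0] the time [T n] is negative; the maximum keeps the cutting instant nonnegative, as the
   induction hypothesis demands. *)
pose m := Order.max 0 (T n).
have [m0 [mT mN]] : 0 <= m /\ T n <= m /\ m < T n.+1.
  split; first by rewrite le_max lexx.
  split; first by rewrite le_max lexx orbT.
  rewrite gt_max -nE (chain_lt adm ch) andbT nE.
  by apply: (lt_le_trans h1); apply: (chain_le adm ch).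
pose s := (m + T n.+1) / 2.
have s0 : 0 <= s by rewrite /s; clear - m0 mN; lra.
have hs : T n < s < T (n%:Z + 1) by rewrite nE /s; clear - mT mN; lra.
have [L dL [Lf LE]] := IH s s0 hs.
have Os := itinerary_Omega r_pi adm it hs.
have st := Omega_tilde_flow r_pi adm zt Os.
have it' := itinerary_shift r_pi adm it Os hs.
have hts : T (n%:Z + 1) - s < t - s < T (n%:Z + 2) - s.
  have -> : n%:Z + 2 = n.+1%:Z + 1 by rewrite -nE; ring.
  by rewrite nE !ltrD2r t1.
have [L' dL' [Lf' LE']] := collision_diff it' st hts.
have fts : flow C r (t - s) (flow C r s z) = flow C r t z by rewrite (flowD r_pi adm) // subrK.
exists (L' \o L)%VF.
  by rewrite -[t](subrK s); exact: flow_diff_comp.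
rewrite !comp_lfunE Lf Lf' fts; split=> // w; rewrite comp_lfunE LE; cbv zeta.
have LZ (k : R) x : L' (k *: x) = k *: L' x by exact: linearZ.
rewrite LZ LE' fts; cbv zeta.
rewrite swingD exprS mulN1r scaleNr scalerN; set v := swing _ (kick _ _).
suff -> : v = swing (t - T n.+1) (collision_orbit T Z cc n.+1 w) by [].
rewrite /v nE addrA subrK; congr (swing _ _).
  by rewrite opprB addrA subrK.
by rewrite /collision_orbit [RHS]/= /hit_rate nE.
Qed.

End FlowDifferential.

(** * Tangent vectors, contact frame and Sasaki norm *)

Section Tangent.
Variable R : realType.
Local Notation VV := ('rV[R]_3 * 'rV[R]_3)%type.
Implicit Types (t u a d e X P : R) (z y w : VV) (L : 'End(VV)).

Lemma cross_frame_dot z : unit_tangent z -> [/\ dot z.1 (cross z.1 z.2) = 0,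
  dot z.2 (cross z.1 z.2) = 0 & dot (cross z.1 z.2) (cross z.1 z.2) = 1].
Proof.
move=> [zs zv vv]; rewrite /sphere /= in zs.
by rewrite dot_cross_l dot_cross_r dot_cross_cross zs vv zv; split=> //; ring.
Qed.

Lemma tangent_flow_dir z : unit_tangent z -> tangent z (flow_dir z).
Proof.
move=> [zs zv vv]; rewrite /sphere /= in zs; split; rewrite /flow_dir //= dotNr.
  by rewrite zs vv addrC subrr.
by rewrite dotC zv oppr0.
Qed.

Lemma tangent_frame z X P : unit_tangent z -> tangent z (frame z X P).
Proof.
move=> zu; have [n1 n2 _] := cross_frame_dot zu.
by split; rewrite /frame /= !dotlin ?n1 ?n2 ?(dotC _ z.2) ?n2 ?mulr0 ?addr0.
Qed.

Lemma tangent_expansion z w : unit_tangent z -> tangent z w ->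
  w = dot z.2 w.1 *: flow_dir z +
      frame z (dot (cross z.1 z.2) w.1) (dot (cross z.1 z.2) w.2).
Proof.
move=> zu [w1 w2 w3].
have e1 := frame_expansion w.1 zu; have e2 := frame_expansion w.2 zu.
have x1 : dot w.1 z.1 = 0 by rewrite dotC.
have x2 : dot w.2 z.2 = 0 by rewrite dotC.
have x3 : dot w.2 z.1 = - dot z.2 w.1.
  by apply/eqP; rewrite -addr_eq0 dotC (dotC z.2) w2.
rewrite [LHS]surjective_pairing {1}e1 {1}e2 x1 x2 x3 scale0r add0r scale0r addr0.
rewrite (dotC w.1 z.2) (dotC w.1 (cross _ _)) (dotC w.2 (cross _ _)).
by rewrite /flow_dir /frame [RHS]surjective_pairing /= scalerN scaleNr.
Qed.

Lemma frameE z X P : frame z X P = X *: frame z 1 0 + P *: frame z 0 1.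
Proof. by rewrite /frame; congr pair; apply: row3P; rewrite !mxE /=; ring. Qed.

Lemma frameZ z a X P : a *: frame z X P = frame z (a * X) (a * P).
Proof. by rewrite /frame; congr pair; apply: row3P; rewrite !mxE /=; ring. Qed.

Lemma sasaki_frame z X P : unit_tangent z ->
  sasaki_norm z (frame z X P) = Num.sqrt (X ^+ 2 + P ^+ 2).
Proof.
move=> zu; have [n1 n2 n3] := cross_frame_dot zu.
rewrite /sasaki_norm /frame /=; move: (cross z.1 z.2) n1 n3 => n n1 n3.
by rewrite !dotlin (dotC n) n1 n3; congr Num.sqrt; ring.
Qed.

Lemma flip_End : exists L, forall y, L y = flip y.
Proof.
apply: linear_End => a u v; rewrite /flip /=; congr pair.
by apply: row3P; rewrite !mxE; ring.
Qed.

Lemma flip_flow_dir z : flow_dir (flip z) = - flip (flow_dir z).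
Proof. by rewrite /flow_dir /flip; congr pair; apply: row3P; rewrite !mxE /=; ring. Qed.

Lemma flip_frame z X P : flip (frame z X P) = frame (flip z) (- X) P.
Proof.
by rewrite /flip /frame /= crossNr; congr pair; apply: row3P; rewrite !mxE /=; ring.
Qed.

Lemma flip_tangent z w : tangent z w -> tangent (flip z) (flip w).
Proof.
move=> [w1 w2 w3]; split; rewrite /flip /= ?dotNl ?dotNr ?opprK //.
by rewrite -opprD w2 oppr0.
Qed.

Lemma flip_sasaki z w : sasaki_norm (flip z) (flip w) = sasaki_norm z w.
Proof.
rewrite /sasaki_norm /flip /= dotNl; congr (Num.sqrt (_ + _)).
by move: w.2 z.1 => p x; rewrite !dotlin; ring.
Qed.

Lemma trig_cvg (K0 K1 K2 : VV) : trig K0 K1 K2 t @[t --> (0 : R)] --> K0 + K1.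
Proof.
have -> : K0 + K1 = trig K0 K1 K2 0 by rewrite /trig cos0 sin0 scale1r scale0r addr0.
apply: cvgD; first apply: cvgD; first exact: cvg_cst.
  by apply: cvgZr_tmp; exact: continuous_cos.
by apply: cvgZr_tmp; exact: continuous_sin.
Qed.

Lemma is_diff_sub A (f : VV -> VV) z L L' : is_diff_within A f z L ->
  is_diff_within A f z L' -> is_diff_within A (fun=> 0) z (L - L').
Proof.
move=> /is_diffP h1 /is_diffP h2; apply/is_diffP => e e0.
have e2 : 0 < e / 2 by rewrite divr_gt0.
have [d1 d10 {}h1] := h1 _ e2; have [d2 d20 {}h2] := h2 _ e2.
exists (Order.min d1 d2); first by rewrite lt_min d10.
move=> y Ay; rewrite lt_min => /andP[y1 y2].
have := h1 y Ay y1; have := h2 y Ay y2; rewrite subr0 sub0r normrN.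
rewrite add_lfunE opp_lfunE; set m := f y - f z => H2 H1.
have -> : L (y - z) - L' (y - z) = (m - L' (y - z)) - (m - L (y - z)).
  by rewrite opprB [RHS]addrC addrA subrK.
by apply: (le_trans (ler_normB _ _)); move: `|_| `|_| `|_| H1 H2 => p q n; lra.
Qed.

End Tangent.

(** * Existence, uniqueness and inversion of the differential of the flow *)

Section FlowDiff.
Variable R : realType.
Local Notation V := 'rV[R]_3.
Local Notation VV := ('rV[R]_3 * 'rV[R]_3)%type.
Implicit Types (s t u d X P : R) (z y w : VV) (L : 'End(VV)).
Variables (C : set V) (r : R).
Hypothesis r_pi : 0 < r < pi.
Hypothesis adm : admissible C (cos r).
Local Notation Omega := (Omega C r).
Local Notation flow_diff t z L := (is_diff_within Omega (flow C r t) z L).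

Lemma trig_Omega z (K0 K1 K2 : VV) : Omega z -> z = K0 + K1 ->
  (forall t, unit_tangent (trig K0 K1 K2 t)) ->
  \forall t \near (0 : R), Omega (trig K0 K1 K2 t).
Proof.
move=> Oz zE tu; have [d d0 hd] := Omega_near r_pi adm Oz.
have /cvgrPdist_lt/(_ d d0) := trig_cvg (K0 := K0) (K1 := K1) K2.
by apply: filterS => t; rewrite -zE distrC; exact: hd.
Qed.

(** Three curves in [Omega] span the tangent space: the geodesic, the rotation of the position with
    fixed velocity, and the rotation of the velocity at a fixed position. Along them the difference
    of two differentials is a differential of 0. *)
Lemma tangent_diff_unique (f : VV -> VV) z L L' w : Omega z -> is_diff_within Omega f z L ->
  is_diff_within Omega f z L' -> tangent z w -> L w = L' w.
Proof.
move=> Oz dL dL' tw; have dd := is_diff_sub dL dL'.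
have zu : unit_tangent z by case: Oz.
have [zs zv vv] := zu; rewrite /sphere /= in zs.
have [n1 n2 n3] := cross_frame_dot zu.
have eq0 (K0 K1 K2 : VV) : z = K0 + K1 -> (forall t, unit_tangent (trig K0 K1 K2 t)) -> L K2 = L' K2.
  move=> zE tu; have : (L - L') K2 = 0.
    apply: (diff_along (K0' := 0) (K1' := 0) dd zE); first exact: (trig_Omega Oz zE tu).
    by apply/near_distP; exists 1; rewrite ?ltr01 // => t _; rewrite /trig !scaler0 !addr0.
  by rewrite add_lfunE opp_lfunE => /eqP; rewrite subr_eq0 => /eqP.
have E0 : L (flow_dir z) = L' (flow_dir z).
  apply: (eq0 0 z); first by rewrite add0r.
  by move=> t; rewrite -geodesic_trig; exact: geodesic_unit.
have E1 : L (frame z 1 0) = L' (frame z 1 0).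
  apply: (eq0 (0, z.2) (z.1, 0)).
    by rewrite [LHS]surjective_pairing; congr pair => /=; rewrite ?add0r ?addr0.
  move=> t; rewrite /frame; move: (cross z.1 z.2) n1 n2 n3 => n n1 n2 n3.
  have E := cos2Dsin2 t.
  have -> : trig (0, z.2) (z.1, 0) (1 *: n, 0 *: n) t = (cos t *: z.1 + sin t *: n, z.2).
    by rewrite /trig; congr pair; apply: row3P; rewrite !mxE /=; ring.
  split; rewrite /sphere /= ?dotlin ?(dotC n z.1) ?(dotC n z.2) ?n1 ?n2 ?n3 ?zs ?zv //.
    by lra.
  by ring.
have E2 : L (frame z 0 1) = L' (frame z 0 1).
  apply: (eq0 (z.1, 0) (0, z.2)).
    by rewrite [LHS]surjective_pairing; congr pair => /=; rewrite ?add0r ?addr0.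
  move=> t; rewrite /frame; move: (cross z.1 z.2) n1 n2 n3 => n n1 n2 n3.
  have E := cos2Dsin2 t.
  have -> : trig (z.1, 0) (0, z.2) (0 *: n, 1 *: n) t = (z.1, cos t *: z.2 + sin t *: n).
    by rewrite /trig; congr pair; apply: row3P; rewrite !mxE /=; ring.
  split; rewrite /sphere /= ?dotlin ?(dotC n z.1) ?(dotC n z.2) ?n1 ?n2 ?n3 ?zs ?zv ?vv //.
    by ring.
  by lra.
have LZ (k k' k'' : R) (u v x : VV) (M : 'End(VV)) :
  M (k *: u + (k' *: v + k'' *: x)) = k *: M u + (k' *: M v + k'' *: M x).
  by rewrite !linearD !linearZ.
by rewrite (tangent_expansion zu tw) frameE !LZ E0 E1 E2.
Qed.

Lemma flow_diff_flip z t L (F : 'End(VV)) : (forall y, F y = flip y) -> Omega z ->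
  Omega (flow C r t z) -> flow_diff t z L -> flow_diff (- t) (flip z) (F \o (L \o F))%VF.
Proof.
move=> FE Oz Ot dL.
have Of y := @Omega_flip _ C r r_pi adm y.
have [d d0 hd] := flow_Omega_near r_pi adm Ot dL.
have fE y : Omega y -> Omega (flow C r t (flip y)) ->
    flow C r (- t) y = F (flow C r t (F y)).
  move=> Oy Oty; rewrite !FE.
  by have := flow_flip r_pi adm (t := - t) (Of y Oy); rewrite opprK flipK; apply.
have normF y : `|flip y - z| = `|y - flip z|.
  have -> : flip y - z = F (y - flip z).
    rewrite FE /flip /=; congr pair; apply: row3P; rewrite !mxE; ring.
  by rewrite FE; move: (y - _) => u; rewrite !prod_normE normrN.
apply: (is_diff_eq_near (g := F \o (flow C r t \o F))) => /=.
- by rewrite fE ?flipK //; exact: Of.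
- exists d; first exact: d0.
  move=> y Oy yz; have Oty : Omega (flow C r t (flip y)).
    by apply: hd; [exact: Of|rewrite normF; exact: yz].
  by rewrite /= (fE _ Oy Oty).
apply: (is_diff_within_comp (B := setT)); last by exists 1.
  apply: (is_diff_within_comp (B := Omega)); first exact: is_diff_lin.
    by rewrite FE flipK.
  by exists 1 => // y Oy _; rewrite FE; exact: Of.
exact: is_diff_lin.
Qed.

Lemma itinerary_forward z T Z cc t : itinerary C r z T Z cc -> 0 <= t ->
  Omega (flow C r t z) -> exists n : nat, T n < t < T (n%:Z + 1).
Proof.
move=> it t0 Ot; have [k /andP[k1 k2]] := itinerary_interval r_pi adm it Ot.
have [ch /andP[h0 h1] _] := it.
have k0 : 0 <= k.
  rewrite leNgt; apply/negP => lt0; have k10 : k + 1 <= 0 by rewrite lezD1.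
  by have := chain_le adm ch k10; lra.
by exists `|k|%N; rewrite gez0_abs // k1.
Qed.

Lemma flow_diff_exists z t : Omega_tilde C r z -> Omega (flow C r t z) ->
  exists2 L, flow_diff t z L & L (flow_dir z) = flow_dir (flow C r t z) /\
    forall X P, exists X' P', L (frame z X P) = frame (flow C r t z) X' P'.
Proof.
have pos z' t' : 0 <= t' -> Omega_tilde C r z' -> Omega (flow C r t' z') ->
  exists2 L, flow_diff t' z' L & L (flow_dir z') = flow_dir (flow C r t' z') /\
    forall X P, exists X' P', L (frame z' X P) = frame (flow C r t' z') X' P'.
  move=> t0 zt Ot; have Oz : Omega z' by case: zt.
  have [T [Z [cc it]]] := flow_itinerary r_pi adm Oz.
  have [n hn] := itinerary_forward it t0 Ot.
  have [L dL [Lf LE]] := flow_diff_orbit r_pi adm it zt t0 hn.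
  exists L; first exact: dL.
  split; first exact: Lf.
  move=> X P; have := LE (X, P); cbv zeta; move: (swing _ _) => w ->.
  by exists ((-1) ^+ n * w.1), ((-1) ^+ n * w.2); rewrite frameZ.
move=> zt Ot; have Oz : Omega z by case: zt.
have [t0|t0] := leP 0 t; first exact: pos.
have Of := @Omega_flip _ C r r_pi adm.
have ft : flow C r (- t) (flip z) = flip (flow C r t z).
  by have := flow_flip r_pi adm (t := - t) Oz; rewrite opprK; apply.
have Otf : Omega (flow C r (- t) (flip z)) by rewrite ft; exact: Of.
have t1 : 0 <= - t by lra.
have [L dL [Lf LE]] := pos _ _ t1 (Omega_tilde_flip r_pi adm zt) Otf.
have [F FE] := flip_End R.
have := flow_diff_flip FE (Of _ Oz) Otf dL; rewrite opprK flipK => dL'.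
exists (F \o (L \o F))%VF; first exact: dL'.

have FF (x : VV) : F (F x) = x by rewrite !FE flipK.
split.
  rewrite !comp_lfunE /=; have -> : F (flow_dir z) = - flow_dir (flip z).
    by rewrite FE flip_flow_dir opprK.
  have -> : L (- flow_dir (flip z)) = - L (flow_dir (flip z)) by exact: linearN.
  by rewrite Lf ft flip_flow_dir opprK -FE FF.
move=> X P; rewrite !comp_lfunE (FE (frame z X P)) flip_frame.
have [X' [P' ->]] := LE (- X) P; exists (- X'), P'.
by rewrite FE flip_frame ft flipK.
Qed.

Lemma flow_diff_inv z t L L' w : Omega z -> Omega (flow C r t z) -> flow_diff t z L ->
  flow_diff (- t) (flow C r t z) L' -> tangent z w -> L' (L w) = w.
Proof.
move=> Oz Ot dL dL' tw; have dLL := flow_diff_comp r_pi adm Oz Ot dL dL'.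
have dI : is_diff_within Omega (flow C r (- t + t)) z \1%VF.
  apply: (is_diff_eq_near (g := \1%VF)); last exact: is_diff_lin.
    by rewrite addNr (flow0 r_pi adm Oz) id_lfunE.
  exists 1; first exact: ltr01.
  by move=> y Oy _; rewrite addNr (flow0 r_pi adm Oy) id_lfunE.
have := tangent_diff_unique Oz dLL dI tw; rewrite comp_lfunE id_lfunE; exact.
Qed.

Lemma flow_diff_line z : Omega z -> flow_line C r z = <[flow_dir z]>%VS.
Proof.
move=> Oz; have [T [Z [cc it]]] := flow_itinerary r_pi adm Oz.
rewrite /flow_line (derive1_trig (K0 := 0) (K1 := z) (K2 := flow_dir z)) //.
have [_ /andP[h0 h1] _] := it.
apply/near_distP; exists (Order.min (- T 0) (T 1)); first by rewrite lt_min oppr_gt0 h0.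
move=> s; rewrite lt_min subr0 !ltr_norml => /andP[/andP[s1 s2] /andP[s3 s4]].
rewrite -geodesic_trig (itinerary_start r_pi adm it Oz) // s4 andbT.
by lra.
Qed.

End FlowDiff.

(** * Hyperbolicity *)

Section Stable.
Variable R : realType.
Local Notation V := 'rV[R]_3.
Local Notation VV := ('rV[R]_3 * 'rV[R]_3)%type.
Implicit Types (s t a b X P q : R) (z y w : VV) (L : 'End(VV)).
Implicit Types (T : int -> R) (Z : int -> VV) (cc : int -> V) (p : R * R) (n : nat).
Variables (C : set V) (r : R).
Hypothesis r_pi : 0 < r < pi.
Hypothesis adm : admissible C (cos r).
Local Notation h := (cos r).
Local Notation Omega := (Omega C r).
Local Notation itinerary := (itinerary C r).
Local Notation flow_diff t z L := (is_diff_within Omega (flow C r t) z L).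

Definition size2 p := Num.sqrt (p.1 ^+ 2 + p.2 ^+ 2).

Lemma size2_swing t p : size2 (swing t p) = size2 p.
Proof.
rewrite /size2 /swing /=; congr Num.sqrt.
transitivity ((p.1 ^+ 2 + p.2 ^+ 2) * (cos t ^+ 2 + sin t ^+ 2)); first by ring.
by rewrite cos2Dsin2 mulr1.
Qed.

Lemma size2_fst p : `|p.1| <= size2 p.
Proof. by rewrite -sqrtr_sqr ler_wsqrtr // lerDl sqr_ge0. Qed.

Lemma size2_le p : size2 p <= `|p.1| + `|p.2|.
Proof.
have s0 : 0 <= `|p.1| + `|p.2| by rewrite addr_ge0.
rewrite -[leRHS]ger0_norm // -sqrtr_sqr ler_wsqrtr //.
rewrite -(real_normK (num_real p.1)) -(real_normK (num_real p.2)).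
have := normr_ge0 p.1; have := normr_ge0 p.2; move: `|_| `|_| => a b a0 b0; nra.
Qed.

Definition curvature := h / Num.sqrt (1 - h ^+ 2).

Lemma curvature_gt1 : 1 < curvature.
Proof.
have [h0 h2] := h_bounds adm; have k := adm_curv adm.
rewrite /curvature ltr_pdivlMr ?sqrtr_gt0 // mul1r -[ltRHS]gtr0_norm // -sqrtr_sqr.
by rewrite ltr_sqrt ?exprn_gt0 //; lra.
Qed.

(** By Parseval the normal speed is at most [sqrt (1 - h ^+ 2)], with equality at head-on
    collisions. *)
Lemma hit_rate_ge z T Z cc (k : int) : itinerary z T Z cc -> Omega_tilde C r z ->
  2 * curvature <= hit_rate r Z cc k.
Proof.
move=> it zt; have Oz : Omega z by case: zt.
have dn := (Omega_tildeP r_pi adm it Oz).1 zt k; have [ch _ _] := it.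
have [zu Cc hit _] := ch_out ch k; have [h0 h2] := h_bounds adm.
have := parseval (cc k) zu; rewrite (adm_unit adm Cc) hit.
have := sqr_ge0 (dot (cc k) (cross (Z k).1 (Z k).2)).
rewrite /hit_rate; move: (dot _ (Z k).2) (_ ^+ 2) dn => D m D0 m0 E.
have s0 : 0 < Num.sqrt (1 - h ^+ 2) by rewrite sqrtr_gt0.
rewrite /curvature mulrA ler_pM2l ?mulr_gt0 // lef_pV2 ?posrE ?oppr_gt0 //.
by rewrite -[leLHS]gtr0_norm ?oppr_gt0 // -sqrtr_sqr ler_wsqrtr //; lra.
Qed.

Lemma itinerary_sin : exists2 sg : R, 0 < sg & forall z T Z cc, itinerary z T Z cc ->
  forall n, 0 <= cos (T n.+1 - T n) /\ sg <= sin (T n.+1 - T n).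
Proof.
have [sg sg0 hs] := flight_sin adm; exists sg => // z T Z cc [ch _ _] n.
have fl := ch_flight ch n; have := hs _ _ _ _ _ (ch_out ch n) fl.
have nE : n%:Z + 1 = n.+1%:Z by rewrite -addn1 PoszD.
rewrite nE in fl * => sn; split=> //.
by have /andP[t0 t1] := fl_time fl; rewrite cos_ge0_pihalf // t1 andbT; lra.
Qed.

Lemma itinerary_time z T Z cc n : itinerary z T Z cc -> T (n%:Z + 1) <= n.+1%:R * (pi / 2).
Proof.
move=> [ch /andP[h0 h1] _].
have g k : T (k + 1) - T k <= pi / 2 by case/andP: (fl_time (ch_flight ch k)).
elim: n => [|n IH]; first by have := g 0; rewrite add0r mul1r; lra.
have nE : n%:Z + 1 = n.+1%:Z by rewrite -addn1 PoszD.
have E : n.+2%:R = n.+1%:R + 1 :> R by rewrite natr1.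
by have := g n.+1; rewrite nE in IH; rewrite E; lra.
Qed.

Lemma itinerary_sample z T Z cc n : itinerary z T Z cc -> exists t,
  0 <= t /\ T n < t < T (n%:Z + 1).
Proof.
move=> [ch /andP[h0 h1] _]; have lt := chain_lt adm ch n.
have : T 1 <= T (n%:Z + 1) by apply: (chain_le adm ch); rewrite lerDr.
have [Tn|Tn] := leP 0 (T n) => le1.
  by exists ((T n + T (n%:Z + 1)) / 2); split; [lra|apply/andP; split; lra].
by exists (T (n%:Z + 1) / 2); split; [lra|apply/andP; split; lra].
Qed.

(** All differentials agree on tangent vectors, so quantifying over all of them avoids a choice and
    keeps the notion independent of any itinerary. *)
Definition bounded_forward z w := exists K, forall t L, 0 <= t -> Omega (flow C r t z) ->
  flow_diff t z L -> sasaki_norm (flow C r t z) (L w) <= K.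

Definition stable z w := (exists X P, w = frame z X P) /\ bounded_forward z w.

Lemma orbit_sasaki z T Z cc n t L X P : itinerary z T Z cc -> Omega_tilde C r z ->
  0 <= t -> T n < t < T (n%:Z + 1) -> flow_diff t z L ->
  sasaki_norm (flow C r t z) (L (frame z X P)) = size2 (collision_orbit r T Z cc n (X, P)).
Proof.
move=> it zt t0 hn dL; have Oz : Omega z by case: zt.
have [L' dL' [_ LE]] := flow_diff_orbit r_pi adm it zt t0 hn.
have zu : unit_tangent z by case: Oz.
rewrite (tangent_diff_unique r_pi adm Oz dL dL' (tangent_frame X P zu)).
have := LE (X, P); cbv zeta => ->; rewrite frameZ sasaki_frame; last exact: (flow_unit r_pi adm).
rewrite -(size2_swing (t - T n)) /size2 !exprMn sqrr_sign !mul1r //.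
Qed.

(** Converts contraction per collision into contraction in time: flights last at most [pi / 2], and
    the factor [g] accounts for the flight in progress. *)
Lemma growth_decay g t n : 1 < g -> t <= n.+1%:R * (pi / 2) ->
  (g ^+ n)^-1 <= g * (g `^ (- (2 / pi))) `^ t.
Proof.
move=> g1 tn; have g0 : 0 < g := lt_trans ltr01 g1.
have pp := @pi_gt0 R.
rewrite -powRrM -[X in X * _]powRr1 ?(ltW g0) // -powRD; last by rewrite (gt_eqF g0) implybT.
rewrite -powR_mulrn ?(ltW g0) // -powRN; apply: (ler_powR (ltW g1)).
have : t / (pi / 2) <= n.+1%:R by rewrite ler_pdivrMr // divr_gt0.
have -> : t / (pi / 2) = 2 / pi * t by rewrite invfM invrK; ring.
by rewrite mulNr -natr1; lra.
Qed.

Lemma stable_line : exists a lam : R, [/\ 0 < a, 0 < lam, lam < 1 &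
  forall z, Omega_tilde C r z -> exists v, [/\ v != 0,
    forall w, stable z w <-> exists k : R, w = k *: v &
    forall w t L, stable z w -> 0 <= t -> Omega (flow C r t z) -> flow_diff t z L ->
      sasaki_norm (flow C r t z) (L w) <= a * lam `^ t * sasaki_norm z w]].
Proof.
have [sg sg0 hs] := itinerary_sin; have k1 := curvature_gt1.
pose g := growth curvature sg; have g1 : 1 < g by exact: growth_gt1.
have g0 : 0 < g := lt_trans ltr01 g1.
have pp := @pi_gt0 R.
(* [1 + 2 / sg] bounds the size of a stable vector by its first coordinate just after a collision;
   the rest comes from [growth_decay]. *)
exists ((1 + 2 / sg) * g), (g `^ (- (2 / pi))); split.
- by rewrite mulr_gt0 // addr_gt0 // divr_gt0.
- exact: powR_gt0.
- have pp2 : 0 < 2 / pi :> R by rewrite divr_gt0.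
  rewrite powRN invf_lt1 ?powR_gt0 //.
  have := gt0_ltr_powR pp2 (x := 1) (y := g); rewrite powR1 !nnegrE; apply=> //; exact: ltW.
move=> z zt; have Oz : Omega z by case: zt.
have zu : unit_tangent z by case: Oz.
have [T [Z [cc it]]] := flow_itinerary r_pi adm Oz.
pose tau j := T j.+1 - T j; pose rate j := hit_rate r Z cc j.+1.
have tc j : 0 <= cos (tau j) by case: (hs _ _ _ _ it j).
have ts j : sg <= sin (tau j) by case: (hs _ _ _ _ it j).
have rg j : 2 * curvature <= rate j by exact: hit_rate_ge it zt.
have [q hq] := stable_slope_exists k1 sg0 tc ts rg.
have bd X P : (exists K, forall n, `|(shear_orbit tau rate n (swing (T 0) (X, P))).1| <= K) ->
    (swing (T 0) (X, P)).2 = (swing (T 0) (X, P)).1 * q.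
  exact: (bounded_stable k1 sg0 tc ts rg hq).
have ctr X P n : (swing (T 0) (X, P)).2 = (swing (T 0) (X, P)).1 * q ->
    size2 (collision_orbit r T Z cc n (X, P)) <= (1 + 2 / sg) * (g ^+ n)^-1 * size2 (X, P).
  move=> E; have [H1 H2] := stable_contraction k1 sg0 tc ts rg n hq E.
  rewrite -/g in H1; apply: (le_trans (size2_le _)).
  have H3 : `|(collision_orbit r T Z cc n (X, P)).1| <= (g ^+ n)^-1 * size2 (X, P).
    rewrite ler_pdivlMl ?exprn_gt0 // (le_trans H1) //.
    by rewrite -(size2_swing (T 0) (X, P)) size2_fst.
  rewrite -mulrA; apply: le_trans (ler_wpM2l _ H3); last by rewrite addr_ge0 // divr_ge0 // ltW.
  by rewrite mulrDl mul1r lerD2l.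
(* The stable slope [q] is found at the collision numbered 0, in the past of [z]; the vector is
   carried forward to time 0. *)
pose p := swing (- T 0) (1, q).
have pE (k : R) : swing (T 0) (k * p.1, k * p.2) = (k, k * q).
  have -> : (k * p.1, k * p.2) = swing (- T 0) (k, k * q).
    by rewrite /p /swing /=; congr pair; ring.
  by rewrite swingD subrr swing0.
exists (frame z p.1 p.2); split.
- have [_ _ nn] := cross_frame_dot zu.
  apply/eqP => E; have : sasaki_norm z (frame z p.1 p.2) = sasaki_norm z (frame z 0 0).
    by rewrite E /frame !scale0r.
  rewrite !(sasaki_frame _ _ zu) expr0n addr0 sqrtr0 -[Num.sqrt _]/(size2 p) size2_swing.
  by have := size2_fst (1, q); rewrite /= normr1 => + E'; rewrite E'; lra.
- move=> w; split.
    move=> [[X [P ->]] [K hK]].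
    have E : (swing (T 0) (X, P)).2 = (swing (T 0) (X, P)).1 * q.
      apply: bd; exists K => n; have [t [t0 hn]] := itinerary_sample n it.
      have [L dL _] := flow_diff_orbit r_pi adm it zt t0 hn.
      have := hK t L t0 (itinerary_Omega r_pi adm it hn) dL.
      rewrite (orbit_sasaki _ _ it zt t0 hn dL); exact: le_trans (size2_fst _).
    exists (swing (T 0) (X, P)).1; rewrite frameZ.
    have : (X, P) = swing (- T 0) (swing (T 0) (X, P)) by rewrite swingD addNr swing0.
    move: (swing (T 0) (X, P)) E => [k k'] /= ->; rewrite /p /swing /= => -[-> ->].
    by congr frame; ring.
  move=> [k ->]; rewrite frameZ; split; first by eexists _, _.
  have E : (swing (T 0) (k * p.1, k * p.2)).2 = (swing (T 0) (k * p.1, k * p.2)).1 * q by rewrite pE.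
  exists ((1 + 2 / sg) * size2 (k * p.1, k * p.2)) => t L t0 Ot dL.
  have [n hn] := itinerary_forward r_pi adm it t0 Ot.
  rewrite (orbit_sasaki _ _ it zt t0 hn dL); apply: (le_trans (ctr _ _ n E)).
  rewrite -mulrA ler_wpM2l ?addr_ge0 ?divr_ge0 ?(ltW sg0) // ler_piMl ?sqrtr_ge0 //.
  by rewrite invf_le1 ?exprn_gt0 // exprn_ege1 // ltW.
move=> w t L [[X [P ->]] [K hK]] t0 Ot dL.
have E : (swing (T 0) (X, P)).2 = (swing (T 0) (X, P)).1 * q.
  apply: bd; exists K => n; have [t' [t'0 hn]] := itinerary_sample n it.
  have [L' dL' _] := flow_diff_orbit r_pi adm it zt t'0 hn.
  have := hK t' L' t'0 (itinerary_Omega r_pi adm it hn) dL'.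
  rewrite (orbit_sasaki _ _ it zt t'0 hn dL'); exact: le_trans (size2_fst _).
have [n hn] := itinerary_forward r_pi adm it t0 Ot.
rewrite (orbit_sasaki _ _ it zt t0 hn dL) sasaki_frame //; apply: (le_trans (ctr _ _ n E)).
rewrite -[Num.sqrt _]/(size2 (X, P)) ler_wpM2r ?sqrtr_ge0 // -!mulrA ler_wpM2l //.
  by rewrite addr_ge0 // divr_ge0 // ltW.
apply: growth_decay => //; case/andP: hn => _ /ltW tn.
exact: le_trans tn (itinerary_time n it).
Qed.

End Stable.

(** * Unstable lines, transversality and the invariant splitting *)

Section Hyperbolic.
Variable R : realType.
Local Notation V := 'rV[R]_3.
Local Notation VV := ('rV[R]_3 * 'rV[R]_3)%type.
Implicit Types (t a e X P : R) (c : V) (z u v w : VV) (L : 'End(VV)).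

Lemma vline_scale (k : R) v : k != 0 -> <[k *: v]>%VS = <[v]>%VS.
Proof.
move=> k0; apply/eqP; rewrite eqEsubv -!memvE; apply/andP; split; apply/vlineP.
  by exists k.
by exists k^-1; rewrite scalerA mulVf // scale1r.
Qed.

(** The subspace is determined by the predicate and not by a spanning vector, so invariance of the
    predicate passes to it. *)
Definition line_space (S : VV -> Prop) : {vspace VV} :=
  xget 0%VS [set E : {vspace VV} | forall w, w \in E <-> S w].

Lemma line_spaceE (S : VV -> Prop) v : (forall w, S w <-> exists k : R, w = k *: v) ->
  line_space S = <[v]>%VS.
Proof.
move=> Sv; have Ev : [set E : {vspace VV} | forall w, w \in E <-> S w] <[v]>%VS.
  by move=> w; split; [move=> /vlineP/Sv|move=> /Sv/vlineP].
have := xgetPex 0%VS (ex_intro _ _ Ev); rewrite -/(line_space S) => H.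
by apply/vspaceP => w; apply/idP/idP; [move/H/Ev|move/Ev/H].
Qed.

Variables (C : set V) (r : R).
Hypothesis r_pi : 0 < r < pi.
Hypothesis adm : admissible C (cos r).
Local Notation Omega := (Omega C r).
Local Notation Omega_tilde := (Omega_tilde C r).
Local Notation stable := (stable C r).
Local Notation flow_diff t z L := (is_diff_within Omega (flow C r t) z L).

Lemma stable_tangent z w : unit_tangent z -> stable z w -> tangent z w.
Proof. by move=> zu [[X [P ->]] _]; exact: tangent_frame. Qed.

Lemma Omega_tilde_Omega z : Omega_tilde z -> Omega z.
Proof. by case. Qed.

Lemma Omega_unit z : Omega z -> unit_tangent z.
Proof. by case. Qed.

Definition stable_spec z v := v != 0 /\ forall w, stable z w <-> exists k : R, w = k *: v.

Lemma stable_specE z : Omega_tilde z -> exists v, stable_spec z v.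
Proof.
move=> zt; have [a [lam [_ _ _ H]]] := stable_line r_pi adm.
by have [v [v0 Sv _]] := H z zt; exists v.
Qed.

Lemma stable_forward z t L w : Omega_tilde z -> 0 <= t -> Omega (flow C r t z) ->
  flow_diff t z L -> stable z w -> stable (flow C r t z) (L w).
Proof.
move=> zt t0 Ot dL [[X [P wE]] [K hK]]; have Oz := Omega_tilde_Omega zt.
have zu := Omega_unit Oz.
have [L' dL' [_ LE]] := flow_diff_exists r_pi adm zt Ot; split.
  have [X' [P' E]] := LE X P; exists X', P'; rewrite -E wE.
  by apply: (tangent_diff_unique r_pi adm Oz dL dL'); exact: tangent_frame.
exists K => t' M t'0 Ott dM.
have ftt : flow C r t' (flow C r t z) = flow C r (t' + t) z by rewrite (flowD r_pi adm t' Oz Ot).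
have dML := flow_diff_comp r_pi adm Oz Ot dL dM.
have := hK (t' + t) _ (addr_ge0 t'0 t0) _ dML; rewrite comp_lfunE ftt; apply.
by rewrite -ftt.
Qed.

Lemma flow_back z t : Omega z -> Omega (flow C r t z) -> flow C r (- t) (flow C r t z) = z.
Proof. by move=> Oz Ot; rewrite (flowD r_pi adm (- t) Oz Ot) addNr (flow0 r_pi adm Oz). Qed.

(** For [t < 0], the forward differential from [flow C r t z] maps its stable line injectively,
    hence onto, the stable line of [z]; [L] is the inverse of that map. *)
Lemma stable_flow z t L w : Omega_tilde z -> Omega (flow C r t z) ->
  flow_diff t z L -> stable z w -> stable (flow C r t z) (L w).
Proof.
move=> zt Ot dL Sw; have Oz := Omega_tilde_Omega zt.
have [t0|t0] := leP 0 t; first exact: (stable_forward zt).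
have yt := Omega_tilde_flow r_pi adm zt Ot; have back := flow_back Oz Ot.
have t1 : 0 <= - t by lra.
have Oy : Omega (flow C r (- t) (flow C r t z)) by rewrite back.
have [L' dL' _] := flow_diff_exists r_pi adm yt Oy.
have [v' [v'0 Sv']] := stable_specE yt; have [v [v0 Sv]] := stable_specE zt.
have Sv'' : stable (flow C r t z) v' by apply/Sv'; exists 1; rewrite scale1r.
have := stable_forward yt t1 Oy dL' Sv''; rewrite back => /Sv[k kE].
have dL2 : flow_diff (- - t) (flow C r (- t) (flow C r t z)) L by rewrite opprK back.
have tv' := stable_tangent (Omega_unit Ot) Sv''.
have LLv := flow_diff_inv r_pi adm Ot Oy dL' dL2 tv'.
have k0 : k != 0.
  apply: contra_neq v'0 => k0; rewrite -LLv kE k0 scale0r; exact: linear0.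
have [k' ->] := (Sv w).1 Sw; apply/Sv'; exists (k' / k).
have -> : k' *: v = (k' / k) *: (k *: v) by rewrite scalerA mulfVK.
by rewrite -kE; rewrite [LHS]linearZ /= LLv.
Qed.

Definition unstable z w := stable (flip z) (flip w).

Lemma unstable_flow z t L w : Omega_tilde z -> Omega (flow C r t z) ->
  flow_diff t z L -> unstable z w -> unstable (flow C r t z) (L w).
Proof.
move=> zt Ot dL Uw; have Oz := Omega_tilde_Omega zt; have [F FE] := flip_End R.
have dF := flow_diff_flip r_pi adm FE Oz Ot dL.
have E : flow C r (- t) (flip z) = flip (flow C r t z).
  by have := flow_flip r_pi adm (t := - t) Oz; rewrite opprK; apply.
have Of : Omega (flow C r (- t) (flip z)) by rewrite E; exact: (Omega_flip r_pi adm).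
have := stable_flow (Omega_tilde_flip r_pi adm zt) Of dF Uw.
by rewrite E !comp_lfunE !FE flipK.
Qed.

Lemma unstable_spec z : Omega_tilde z -> exists2 v, v != 0 &
  forall w, unstable z w <-> exists k : R, w = k *: v.
Proof.
move=> zt; have [v [v0 Sv]] := stable_specE (Omega_tilde_flip r_pi adm zt).
have [F FE] := flip_End R; have FK x : F (F x) = x by rewrite !FE flipK.
have FZ (k : R) x : F (k *: x) = k *: F x by exact: linearZ.
exists (flip v).
  apply: contra_neq v0 => E; rewrite -(flipK v) E -FE; exact: linear0.
move=> w; rewrite /unstable; split.
  by move=> /Sv[k E]; exists k; rewrite -FE -FZ -E -FE FK.
by move=> [k ->]; apply/Sv; exists k; rewrite -!FE FZ FK.
Qed.

Lemma line_space_image (S S' : VV -> Prop) v v' L L' : v != 0 ->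
  (forall w, S w <-> exists k : R, w = k *: v) ->
  (forall w, S' w <-> exists k : R, w = k *: v') ->
  (forall w, S w -> S' (L w)) -> L' (L v) = v -> (L @: line_space S)%VS = line_space S'.
Proof.
move=> v0 Sv Sv' SL LL; rewrite (line_spaceE Sv) (line_spaceE Sv') limg_line.
have [|k kE] := (Sv' (L v)).1 _; first by apply: SL; apply/Sv; exists 1; rewrite scale1r.
rewrite kE vline_scale //; apply: contra_neq v0 => k0.
by rewrite -LL kE k0 scale0r; exact: linear0.
Qed.

Lemma small_time z a lam : Omega z -> 0 < a -> 0 < lam -> lam < 1 ->
  exists t, [/\ 0 <= t, Omega (flow C r t z) & a * lam `^ t < 1].
Proof.
move=> Oz a0 l0 l1; have l2 : ln lam < 0 by rewrite ln_lt0 // l0.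
(* At this time the power of [lam] is [expR (- a)], and [a < 1 + a <= expR a]. A slightly later time
   avoids the collisions. *)
pose t0 := a / - ln lam; have t00 : 0 <= t0 by rewrite divr_ge0 ?ltW // oppr_gt0.
have small : a * lam `^ t0 < 1.
  rewrite /powR gt_eqF // /t0 invrN mulrN mulNr mulfVK ?lt_eqF // expRN.
  by rewrite ltr_pdivrMr ?expR_gt0 // mul1r; have := expR_ge1Dx a; lra.
have [T [Z [cc it]]] := flow_itinerary r_pi adm Oz; have [ch _ _] := it.
have [k /andP[k1 k2]] := chain_locate adm ch t0.
exists ((t0 + T (k + 1)) / 2); split.
- by lra.
- by apply: (itinerary_Omega r_pi adm it (k := k)); apply/andP; split; lra.
- apply: le_lt_trans small; rewrite ler_pM2l //; apply: ger_powR; last by lra.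
  by rewrite l0 ltW.
Qed.

(** With [k = a * lam ^ t < 1], the image of [w] at time [t] has norm at most [k] times that of [w];
    being unstable, it is also contracted by [k] on the way back to [w]. *)
Lemma transversal z w : Omega_tilde z -> stable z w -> unstable z w -> w = 0.
Proof.
move=> zt Sw Uw; have Oz := Omega_tilde_Omega zt; have zu := Omega_unit Oz.
have [a [lam [a0 l0 l1 H]]] := stable_line r_pi adm.
have [t [t0 Ot small]] := small_time Oz a0 l0 l1.
have [L dL _] := flow_diff_exists r_pi adm zt Ot.
have [F FE] := flip_End R; have FK x : F (F x) = x by rewrite !FE flipK.
have [_ [_ _ c1]] := H z zt; have {}c1 := c1 w t L Sw t0 Ot dL.
have yt := Omega_tilde_flow r_pi adm zt Ot.
have yft := Omega_tilde_flip r_pi adm yt; have zft := Omega_tilde_flip r_pi adm zt.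
have E : flow C r (- t) (flip z) = flip (flow C r t z).
  by have := flow_flip r_pi adm (t := - t) Oz; rewrite opprK; apply.
have Of : Omega (flow C r (- t) (flip z)) by rewrite E; exact: (Omega_flip r_pi adm).
have back := flow_back (Omega_tilde_Omega zft) Of; rewrite opprK E in back.
have Ob : Omega (flow C r t (flip (flow C r t z))) by rewrite back; exact: (Omega_flip r_pi adm).
have [M dM _] := flow_diff_exists r_pi adm yft Ob.
have U1 := unstable_flow zt Ot dL Uw.
have [_ [_ _ c2]] := H _ yft; have {}c2 := c2 _ t M U1 t0 Ob dM.
have dF := flow_diff_flip r_pi adm FE Oz Ot dL.
have dM' : flow_diff (- - t) (flow C r (- t) (flip z)) M by rewrite opprK E.
have := flow_diff_inv r_pi adm (Omega_tilde_Omega zft) Of dF dM' (flip_tangent (stable_tangent zu Sw)).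
rewrite !comp_lfunE !FE flipK => MF; rewrite MF back !flip_sasaki in c2.
have [[X [P wE]] _] := Sw; have wN : sasaki_norm z w = Num.sqrt (X ^+ 2 + P ^+ 2).
  by rewrite wE sasaki_frame.
have N0 : 0 <= sasaki_norm z w by rewrite wN sqrtr_ge0.
have k0 : 0 < a * lam `^ t by rewrite mulr_gt0 // powR_gt0.
have N1 : sasaki_norm z w <= 0.
  move: c1 c2; move: (sasaki_norm _ (L w)) (sasaki_norm z w) => N1 N c1 c2.
  move: (a * _) k0 small c1 c2 => k k0 k1 c1 c2; rewrite leNgt; apply/negP => N2.
  have e1 : k * N1 <= k * (k * N) by rewrite ler_pM2l.
  have e2 : k * N < N by rewrite gtr_pMl.
  have e3 : k * (k * N) < k * N by rewrite ltr_pM2l.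
  lra.
have /eqP : Num.sqrt (X ^+ 2 + P ^+ 2) = 0 by apply/eqP; rewrite eq_le -wN N1 N0.
rewrite sqrtr_eq0 => XP; have X2 := sqr_ge0 X; have P2 := sqr_ge0 P.
have /eqP : X ^+ 2 = 0 by lra.
have /eqP : P ^+ 2 = 0 by lra.
rewrite !sqrf_eq0 => /eqP P0 /eqP X0; rewrite wE X0 P0 /frame !scale0r //.
Qed.

Theorem hyperbolic : uniformly_hyperbolic C r.
Proof.
have [a [lam [a0 l0 l1 H]]] := stable_line r_pi adm.
exists a, lam; split=> //; exists (fun z => line_space (unstable z)), (fun z => line_space (stable z)).
move=> z zt; cbv zeta; have Oz := Omega_tilde_Omega zt; have zu := Omega_unit Oz.
have [v [v0 Sv]] := stable_specE zt; have [u u0 Uu] := unstable_spec zt.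
have S_v : stable z v by apply/Sv; exists 1; rewrite scale1r.
have U_u : unstable z u by apply/Uu; exists 1; rewrite scale1r.
have [[Xv [Pv vE]] _] := S_v.
have [Xu [Pu uE]] : exists X P, u = frame z X P.
  have [[X [P E]] _] := U_u; exists (- X), P.
  by rewrite -(flipK u) E flip_frame flipK.
(* The determinant of the stable and unstable vectors in the contact frame. If it vanished,
   [Pu *: v = Pv *: u] and [Xu *: v = Xv *: u] would be both stable and unstable, hence zero, which
   forces [u = 0]. *)
have indep : Xv * Pu - Xu * Pv != 0.
  apply/eqP => D0.
  have e1 : Pu *: v = Pv *: u.
    rewrite vE uE !frameZ; congr frame; [|ring].
    by apply/eqP; rewrite -subr_eq0 -D0; apply/eqP; ring.
  have e2 : Xu *: v = Xv *: u.
    rewrite vE uE !frameZ; congr frame; [ring|].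
    by apply/eqP; rewrite eq_sym -subr_eq0 -D0; apply/eqP; ring.
  have z1 : Pu *: v = 0.
    by apply: (transversal zt); [apply/Sv; exists Pu|rewrite e1; apply/Uu; exists Pv].
  have z2 : Xu *: v = 0.
    by apply: (transversal zt); [apply/Sv; exists Xu|rewrite e2; apply/Uu; exists Xv].
  move/eqP: z1; rewrite scaler_eq0 (negPf v0) orbF => /eqP Pu0.
  move/eqP: z2; rewrite scaler_eq0 (negPf v0) orbF => /eqP Xu0.
  by move/eqP: u0; apply; rewrite uE Xu0 Pu0 /frame !scale0r.
have tf := tangent_flow_dir zu; have tX X P := tangent_frame X P zu.
have frameD (k k' X P X' P' : R) : k *: frame z X P + k' *: frame z X' P' =
    frame z (k * X + k' * X') (k * P + k' * P').
  by rewrite /frame; congr pair; apply: row3P; rewrite !mxE /=; ring.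
have coord (k X P : R) : k *: flow_dir z + frame z X P = 0 -> [/\ k = 0, X = 0 & P = 0].
  have [n1 n2 n3] := cross_frame_dot zu; have [zs zv vv] := zu; rewrite /sphere /= in zs.
  rewrite /flow_dir /frame; move: (cross z.1 z.2) n1 n2 n3 => n n1 n2 n3 E.
  have E1 := congr1 fst E; have E2 := congr1 snd E; rewrite /= in E1 E2.
  have := congr1 (dot z.2) E1; rewrite !dotlin vv n2 => k0.
  have := congr1 (dot n) E1; rewrite !dotlin n3 (dotC n) n2 => X0.
  have := congr1 (dot n) E2; rewrite !dotlin n3 (dotC n) n1 => P0.
  by split; lra.
split.
- rewrite (line_spaceE Sv) (line_spaceE Uu) (flow_diff_line r_pi adm Oz) => w; split.
    move=> /memv_addP[w' /memv_addP[w1 /vlineP[k1 ->] [w2 /vlineP[k2 ->] ->]] [w3 /vlineP[k3 ->] ->]].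
    rewrite uE vE -addrA frameD; move: tf (tX (k2 * Xu + k3 * Xv) (k2 * Pu + k3 * Pv)).
    move: (flow_dir z) (frame _ _ _) => f g [f1 f2 f3] [g1 g2 g3]; split => /=.
    + by rewrite !dotlin f1 g1; ring.
    + by rewrite !dotlin; transitivity (k1 * (dot z.1 f.2 + dot f.1 z.2) + (dot z.1 g.2 + dot g.1 z.2));
        [ring|rewrite f2 g2; ring].
    + by rewrite !dotlin f3 g3; ring.
  move=> tw; rewrite (tangent_expansion zu tw).
  set X := dot (cross _ _) w.1; set P := dot (cross _ _) w.2.
  have -> : frame z X P = ((P * Xv - X * Pv) / (Xv * Pu - Xu * Pv)) *: u +
      ((X * Pu - P * Xu) / (Xv * Pu - Xu * Pv)) *: v.
    by rewrite uE vE frameD; congr frame; field.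
  by rewrite addrA; apply: memv_add; [apply: memv_add|]; apply/vlineP; eexists.
- rewrite (line_spaceE Sv) (line_spaceE Uu) (flow_diff_line r_pi adm Oz).
  rewrite directv_addE directv_trivial andTb; apply/andP; split.
    apply/directv_addP/eqP; rewrite -subv0; apply/subvP => w.
    rewrite memv_cap => /andP[/vlineP[k ->] /vlineP[k' E]].
    have := coord k (- k' * Xu) (- k' * Pu); rewrite E -frameZ -uE scaleNr subrr => /(_ erefl)[k0 _ _].
    by rewrite -E k0 scale0r mem0v.
  rewrite -subv0; apply/subvP => w.
  rewrite memv_cap => /andP[/memv_addP[w1 /vlineP[k1 ->] [w2 /vlineP[k2 ->] ->]] /vlineP[k3 E]].
  have : k1 *: flow_dir z + frame z (k2 * Xu - k3 * Xv) (k2 * Pu - k3 * Pv) = 0.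
    rewrite -!mulNr -frameD -uE -vE addrA E scaleNr subrr //.
  case/coord=> _ e1 e2; rewrite E.
  have : k3 * (Xv * Pu - Xu * Pv) = 0.
    have -> : k3 * (Xv * Pu - Xu * Pv) = (k2 * Pu - k3 * Pv) * Xu - (k2 * Xu - k3 * Xv) * Pu by ring.
    by rewrite e1 e2 !mul0r subrr.
  by move/eqP; rewrite mulf_eq0 (negPf indep) orbF => /eqP ->; rewrite scale0r mem0v.
move=> t Ot; have yt := Omega_tilde_flow r_pi adm zt Ot.
have [L dL [Lf _]] := flow_diff_exists r_pi adm zt Ot.
have back := flow_back Oz Ot.
have Oy : Omega (flow C r (- t) (flow C r t z)) by rewrite back.
have [L' dL' _] := flow_diff_exists r_pi adm yt Oy.
have inv w : tangent z w -> L' (L w) = w by exact: (flow_diff_inv r_pi adm Oz Ot dL dL').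
exists L; split; first exact: dL.
- split.
  + by rewrite (flow_diff_line r_pi adm Oz) (flow_diff_line r_pi adm Ot) limg_line Lf.
  + have [u' _ Uu'] := unstable_spec yt.
    apply: (line_space_image (L' := L') u0 Uu Uu').
      by move=> w; exact: unstable_flow.
    by apply: inv; rewrite uE.
  + have [v' [_ Sv']] := stable_specE yt.
    apply: (line_space_image (L' := L') v0 Sv Sv').
      by move=> w; exact: stable_flow.
    by apply: inv; rewrite vE.
- move=> t0 w; rewrite (line_spaceE Sv) => /vlineP/Sv Sw; have [_ [_ _ ctr]] := H z zt; exact: ctr.
- move=> t0 w; rewrite (line_spaceE Uu) => /vlineP/Uu Uw; have zft := Omega_tilde_flip r_pi adm zt.
  have [_ [_ _ ctr]] := H _ zft; have [F FE] := flip_End R.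
  have dF := flow_diff_flip r_pi adm FE Oz Ot dL.
  have E : flow C r (- t) (flip z) = flip (flow C r t z).
    by have := flow_flip r_pi adm (t := - t) Oz; rewrite opprK; apply.
  have Of : Omega (flow C r (- t) (flip z)) by rewrite E; exact: (Omega_flip r_pi adm).
  have nt : 0 <= - t by lra.
  have := ctr _ _ _ Uw nt Of dF.
  by rewrite !comp_lfunE !FE flipK E !flip_sasaki.
Qed.

End Hyperbolic.

Theorem corollary8p2 (R : realType) (C : set 'rV[R]_3)
    (hC : regular_icosahedron C) :
  exists2 R1 : R, R1 < atan 2 / 2 &
    forall r : R, 0 < r -> R1 < r -> r < atan 2 / 2 ->
      uniformly_hyperbolic C r.
Proof.
exists (radius_min R); first exact: radius_min_lt.
move=> r r0 r1 r2; apply: hyperbolic; last exact: icosahedron_admissible.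
rewrite r0 /=; have [_ a2] := atan2_bounds R; have := @pi_gt0 R.
lra.
Qed.
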